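(* Let $V$ be a finite-dimensional complex vector space, $N\ge 1$, $R\in\mathrm{Mer}(V^{\otimes 2})^\times$ with $R^{t_1}\in\mathrm{Mer}(V^{\otimes 2})^\times$, $K^+,K^-\in\mathrm{Mer}(V)$, and $\boldsymbol z=(z_1,\dots,z_N)\in(\mathbb C^\times)^N$. Assume that $R$ satisfies the Yang–Baxter equation $$R_{12}(x/y)R_{13}(x)R_{23}(y)=R_{23}(y)R_{13}(x)R_{12}(x/y)\quad\text{in }\mathrm{End}(V^{\otimes 3}),\ \text{for generic }x,y,$$ and the regularity condition $R(1)\propto P$. Put $K'=\phi_{\tilde R}(K^+)$, let $$\mathcal T(x;\boldsymbol z)=\mathrm{Tr}_0\,K'_0(x)\,R_{01}(\tfrac1{xz_1})^{-1}\cdots R_{0N}(\tfrac1{xz_N})^{-1}K^-_0(x)\,R_{0N}(\tfrac{x}{z_N})\cdots R_{01}(\tfrac{x}{z_1})\in\mathrm{End}(V^{\otimes N}),$$ and, for $i=1,\dots,N$, let $$\begin{aligned}\mathcal A_i(\boldsymbol z;1)=\;&R_{i\,i-1}(\tfrac{z_i}{z_{i-1}})\cdots R_{i1}(\tfrac{z_i}{z_1})\,K^+_i(z_i)\,R_{1i}(z_1z_i)\cdots R_{i-1\,i}(z_{i-1}z_i)\\ &\cdot R_{i+1\,i}(z_{i+1}z_i)\cdots R_{Ni}(z_Nz_i)\,K^-_i(z_i)\,R_{Ni}(\tfrac{z_N}{z_i})^{-1}\cdots R_{i+1\,i}(\tfrac{z_{i+1}}{z_i})^{-1}.\end{aligned}$$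 Then: (1) For generic values of $\boldsymbol z$, $\ \mathcal T(z_i;\boldsymbol z)\propto\mathcal A_i(\boldsymbol z;1)$ for all $i=1,\dots,N$. (2) If furthermore $K^+$ and $K^-$ satisfy boundary unitarity, i.e. $K^\pm(x)K^\pm(x^{-1})\propto\mathrm{Id}_V$ for generic $x$, then for generic values of $\boldsymbol z$, $\ \mathcal T(z_i^{-1};\boldsymbol z)\propto\mathcal A_i(\boldsymbol z;1)^{-1}$ for all $i=1,\dots,N$. (3) If in addition (to all the assumptions above, including boundary unitarity) the left and right reflection equations $$R_{12}(x/y)K^+_1(x)R_{21}(xy)K^+_2(y)=K^+_2(y)R_{12}(xy)K^+_1(x)R_{21}(x/y),$$ $$R_{21}(x/y)K^-_1(x)R_{12}(xy)K^-_2(y)=K^-_2(y)R_{21}(xy)K^-_1(x)R_{12}(x/y)$$ hold in $\mathrm{End}(V^{\otimes 2})$ for generic $x,y$, then for generic $\boldsymbol z$, $\ [\mathcal T(z_i^{\pm1};\boldsymbol z),\mathcal T(z_j^{\pm1};\boldsymbol z)]=0$ for all $1\le i,j\le N$ and all (independent) choices of signs.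
   Context: $\mathrm{Mer}(V)$ is the algebra of meromorphic functions $\mathbb C\to\mathrm{End}(V)$, and $\mathrm{Mer}(V)^\times$ the subset of those whose values are invertible for generic argument. ''For generic values'' means outside a proper analytic subset, i.e. as an identity of meromorphic functions. $X\propto Y$ means $X=mY$ with $m\in\mathbb C^\times$; when $X,Y$ depend meromorphically on variables, $X\propto Y$ for generic values means $X=mY$ with $m$ a not identically zero scalar meromorphic function of those variables. Tensor-leg notation: the subscripts of an operator indicate in which tensor factors (and in which order) it acts, with identity action in the others; in $\mathcal T$ the factor labelled $0$ is an auxiliary copy of $V$ and $1,\dots,N$ label the factors of $V^{\otimes N}$. $P(v\otimes v')=v'\otimes v$ and $R_{21}=PRP$. Empty products are the identity. $X^{t_i}$, $\mathrm{Tr}_i X$ are the partial transpose and partial trace in the factor labelled $i$ (transposition in a fixed basis of $V$). $\tilde R(x):=((R(x)^{t_1})^{-1})^{t_1}$. For $Q\in\mathrm{Mer}(V^{\otimes 2})$ the linear map $\phi_Q:\mathrm{Mer}(V)\to\mathrm{Mer}(V)$ is defined by $\phi_Q(Y)_1(x)=\mathrm{Tr}_0\,Y_0(x)P_{01}Q_{01}(x^2)$ for generic $x$; $\phi_{\tilde R}$ is this map with $Q=\tilde R$. The operators $\mathcal A_i(\boldsymbol z;1)$ are the boundary quantum KZ transport matrices at shift parameter $p=1$. *)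

(* Defs.v *)
(* MathComp, MathComp-Analysis and the complex numbers R[i] of real-closed. *)
From HB Require Import structures.
From mathcomp Require Import all_boot all_order all_algebra.
From mathcomp Require Import complex.
From mathcomp Require Import boolp classical_sets reals topology normedtype derive.

Set Implicit Arguments.
Unset Strict Implicit.
Unset Printing Implicit Defensive.

Import Order.TTheory GRing.Theory Num.Theory.
Import numFieldNormedType.Exports.

Local Open Scope classical_set_scope.
Local Open Scope ring_scope.

(* The notions below are meant for C = R[i], with R a realType. *)

Section Meromorphic.
Context {C : numFieldType} {V : normedModType C}.
Implicit Types (D A : set V) (f : V -> C) (a : V).

(* [differentiable] is Frechet differentiability with a C-linear differential,
   i.e. complex differentiability. *)
Definition holomorphic_at f a : Prop :=
  \forall x \near a, differentiable (f : V -> C^o) x.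

(* Locally a quotient g / h of holomorphic functions, where the germ of h is
   not 0.  The values of f on the zero locus of h are unconstrained: a
   meromorphic function is represented by a total function whose values are
   meaningful only at generic points. *)
Definition meromorphic_at f a : Prop :=
  exists g h : V -> C,
    [/\ holomorphic_at g a, holomorphic_at h a,
        ~ (\forall x \near a, h x = 0) &
        \forall x \near a, h x != 0 -> f x = g x / h x].

Definition meromorphic_on D f : Prop := forall a, D a -> meromorphic_at f a.

Definition analytic_subset D A : Prop :=
  A `<=` D /\
  forall a, D a -> exists (k : nat) (F : 'I_k -> V -> C),
    (forall i, holomorphic_at (F i) a) /\
    (\forall x \near a, A x <-> forall i, F i x = 0).

Definition generically D (P : V -> Prop) : Prop :=
  exists A : set V,
    [/\ analytic_subset D A, A <> D & forall x, D x -> ~ A x -> P x].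

(* [m] is not the zero meromorphic function.  (As values off a generic set are
   meaningless, m x != 0 at a single x would say nothing.) *)
Definition propto_generically D p q (X Y : V -> 'M[C]_(p, q)) : Prop :=
  exists m : V -> C,
    [/\ meromorphic_on D m, ~ generically D (fun x => m x = 0) &
        generically D (fun x => X x = m x *: Y x)].

End Meromorphic.

Definition propto (C : numFieldType) p q (X Y : 'M[C]_(p, q)) : Prop :=
  exists2 m : C, m != 0 & X = m *: Y.

(* (C^x)^N, as a subset of C^N *)
Definition torus (C : numFieldType) (N : nat) : set 'rV[C]_N :=
  [set z | forall i, z 0 i != 0].
Arguments torus C N _ : clear implicits.

(* for generic (x, y) in (C^x)^2 *)
Definition generically2 (C : numFieldType) (P : C -> C -> Prop) : Prop :=
  generically (torus C 2) (fun w => P (w 0 ord0) (w 0 ord_max)).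

(* V = C^n with its standard basis e_0, ..., e_(n-1).  The basis of V^{(x)k} is
   indexed by f : 'I_k -> 'I_n (f a is the index of the basis vector in the
   factor a), and End(V^{(x)k}) consists of the matrices over that basis, acting
   on column vectors.  End(V) is the case k = 1. *)
Section Tensors.
Context {C : numFieldType} {n : nat}.

Definition multiindex (k : nat) := {ffun 'I_k -> 'I_n}.
Definition tensEnd (k : nat) := 'M[C]_#|multiindex k|.

Definition tmx k (F : multiindex k -> multiindex k -> C) : tensEnd k :=
  \matrix_(a, b) F (enum_val a) (enum_val b).
Definition tcoef k (X : tensEnd k) (f g : multiindex k) : C :=
  X (enum_rank f) (enum_rank g).

(* X acting in the factors s 0, s 1, ..., s (k-1) (in this order) of V^{(x)m},
   and as the identity in the others; s is meant to be injective. *)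
Definition legs k m (s : 'I_k -> 'I_m) (X : tensEnd k) : tensEnd m :=
  tmx (fun f g =>
    if [forall c, (c \in codom s) || (f c == g c)]
    then tcoef X [ffun a => f (s a)] [ffun a => g (s a)] else 0).

Definition leg1 m (a : 'I_m) (Y : tensEnd 1) : tensEnd m :=
  legs (fun=> a) Y.
Definition leg2 m (a b : 'I_m) (X : tensEnd 2) : tensEnd m :=
  legs (fun c : 'I_2 => if c == ord0 then a else b) X.

(* v (x) v' |-> v' (x) v *)
Definition flip : tensEnd 2 :=
  tmx (fun f g => ((f ord0 == g ord_max) && (f ord_max == g ord0))%:R).

Definition ptranspose k (i : 'I_k) (X : tensEnd k) : tensEnd k :=
  tmx (fun f g => tcoef X [ffun c => if c == i then g c else f c]
                          [ffun c => if c == i then f c else g c]).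

Definition considx k (a : 'I_n) (f : multiindex k) : multiindex k.+1 :=
  [ffun c => if unlift ord0 c is Some d then f d else a].

(* partial trace over the factor 0; the factor i.+1 becomes the factor i *)
Definition ptrace0 k (X : tensEnd k.+1) : tensEnd k :=
  tmx (fun f g => \sum_a tcoef X (considx a f) (considx a g)).

Definition Mer k (X : C -> tensEnd k) : Prop :=
  forall i j, meromorphic_on (setT : set C^o) (fun x => X x i j).

Definition Mer_unit k (X : C -> tensEnd k) : Prop :=
  Mer X /\ generically (setT : set C^o) (fun x => X x \in unitmx).

Definition yang_baxter (R : C -> tensEnd 2) : Prop :=
  let o1 : 'I_3 := inord 0 in let o2 : 'I_3 := inord 1 in
  let o3 : 'I_3 := inord 2 in
  generically2 (fun x y =>
    leg2 o1 o2 (R (x / y)) *m leg2 o1 o3 (R x) *m leg2 o2 o3 (R y) =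
    leg2 o2 o3 (R y) *m leg2 o1 o3 (R x) *m leg2 o1 o2 (R (x / y))).

(* As R represents a meromorphic function, its value at 1 is only meaningful
   because R is required to be holomorphic there. *)
Definition regular (R : C -> tensEnd 2) : Prop :=
  (forall i j, holomorphic_at (fun x : C^o => R x i j) 1) /\
  propto (R 1) flip.

Definition boundary_unitarity (K : C -> tensEnd 1) : Prop :=
  propto_generically [set x : C^o | x != 0]
    (fun x => K x *m K x^-1) (fun=> 1%:M).

Definition left_reflection (R : C -> tensEnd 2) (K : C -> tensEnd 1) : Prop :=
  let R12 x := leg2 ord0 ord_max (R x) in
  let R21 x := leg2 ord_max ord0 (R x) in
  let K1 x : tensEnd 2 := leg1 ord0 (K x) in
  let K2 x : tensEnd 2 := leg1 ord_max (K x) in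
  generically2 (fun x y =>
    R12 (x / y) *m K1 x *m R21 (x * y) *m K2 y =
    K2 y *m R12 (x * y) *m K1 x *m R21 (x / y)).

Definition right_reflection (R : C -> tensEnd 2) (K : C -> tensEnd 1) : Prop :=
  let R12 x := leg2 ord0 ord_max (R x) in
  let R21 x := leg2 ord_max ord0 (R x) in
  let K1 x : tensEnd 2 := leg1 ord0 (K x) in
  let K2 x : tensEnd 2 := leg1 ord_max (K x) in
  generically2 (fun x y =>
    R21 (x / y) *m K1 x *m R12 (x * y) *m K2 y =
    K2 y *m R21 (x * y) *m K1 x *m R12 (x / y)).

Definition tildeR (R : C -> tensEnd 2) (x : C) : tensEnd 2 :=
  ptranspose ord0 (invmx (ptranspose ord0 (R x))).

Definition phi (Q : C -> tensEnd 2) (Y : C -> tensEnd 1) (x : C) : tensEnd 1 :=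
  ptrace0 (leg1 ord0 (Y x) *m flip *m Q (x ^+ 2)).

(* Products are noncommutative: over i < N they run from left to right with
   increasing i, and with [rev_ord i] in place of i they run backwards. *)

(* The factor 0 of V^{(x)(N+1)} is the auxiliary one, and the spectral parameter
   z 0 i (i : 'I_N) belongs to the factor lift ord0 i = i + 1. *)
Definition transfer (R : C -> tensEnd 2) (Kp Km : C -> tensEnd 1) (N : nat)
    (x : C) (z : 'rV[C]_N) : tensEnd N :=
  let R0 (i : 'I_N) u : tensEnd N.+1 := leg2 ord0 (lift ord0 i) (R u) in
  ptrace0
    (leg1 ord0 (phi (tildeR R) Kp x)
     *m (\big[mulmx/1%:M]_(i < N) invmx (R0 i (x * z 0 i)^-1))
     *m leg1 ord0 (Km x)
     *m (\big[mulmx/1%:M]_(i < N) R0 (rev_ord i) (x / z 0 (rev_ord i)))).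

(* shift parameter p = 1 *)
Definition qKZ_transport (R : C -> tensEnd 2) (Kp Km : C -> tensEnd 1)
    (N : nat) (i : 'I_N) (z : 'rV[C]_N) : tensEnd N :=
  let Rl (a b : 'I_N) u : tensEnd N := leg2 a b (R u) in
  (\big[mulmx/1%:M]_(j < N | (rev_ord j < i)%N)
      Rl i (rev_ord j) (z 0 i / z 0 (rev_ord j)))
  *m leg1 i (Kp (z 0 i))
  *m (\big[mulmx/1%:M]_(j < N | (j < i)%N) Rl j i (z 0 j * z 0 i))
  *m (\big[mulmx/1%:M]_(j < N | (i < j)%N) Rl j i (z 0 j * z 0 i))
  *m leg1 i (Km (z 0 i))
  *m (\big[mulmx/1%:M]_(j < N | (i < rev_ord j)%N)
        invmx (Rl (rev_ord j) i (z 0 (rev_ord j) / z 0 i))).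

End Tensors.

Arguments multiindex n k : clear implicits.
Arguments tensEnd C n k : clear implicits.

(* Main.v *)
(* Write z_i^e for z_i and its inverse.  At x = z_i the regularity of R turns one factor of
   the transfer matrix into a permutation; the Yang-Baxter equation and unitarity move it
   through the word, the partial trace closes on K' and gives back K^+ (phi of R undoes phi of
   R~), and the remaining word is A_i up to a scalar.  At x = 1/z_i the same happens with the
   other product, and the word obtained is cancelled factor by factor by A_i, by unitarity of
   R and of K^+, K^-.  The A_i commute since a K-matrix dressed with R-matrices still satisfies
   the reflection equation.
   Unitarity R_12(u) R_21(1/u) = rho(u) Id is not a hypothesis: letting x tend to 1 in the
   Yang-Baxter equation gives V_23(u) = V_12(1/u) for V(u) = R_12(u) R_21(1/u), which forces V
   to be scalar.
   To evaluate identities at points, generic conditions must be stable under intersection and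
   under substitution of quotients of the z_i^e.  This rests on the identity theorem: an
   analytic subset of a connected open set is everything as soon as it has an interior point,
   proved from Cauchy's theorem on rectangles along complex lines. *)
Require Import Defs.
From mathcomp Require Import all_boot all_order all_algebra.
From mathcomp Require Import complex.
From mathcomp Require Import boolp classical_sets reals topology normedtype derive.
From mathcomp Require Import functions ereal sequences measure.
From mathcomp Require Import lebesgue_measure lebesgue_integral ftc.
From mathcomp Require Import perm ring lra.

Set Implicit Arguments.
Unset Strict Implicit.
Unset Printing Implicit Defensive.

Import Order.TTheory GRing.Theory Num.Theory.
Import numFieldNormedType.Exports.
Local Open Scope classical_set_scope.
Local Open Scope ring_scope.

(** * Line integrals in the complex plane *)

Section ComplexNorm.
Context {R : realType}.
Local Notation C := R[i].
Implicit Types z w : C.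

(** Values of a meromorphic function on a thin set are arbitrary, so no identity can be specialised
    directly. The finitely many conditions used, indexed by the 2 N values z_i and 1/z_i, are
    collected on one generic set of z; the algebra then takes place at a single such z, with plain
    matrices ([unitary_at], [yang_baxter_at]). The conditions on R are pullbacks along quotients of
    two of these values, which have to be onto: a square root enters when the two values are inverse
    to each other. The scalars have to be meromorphic and not identically zero. They are products of
    kappa, where R(1) = kappa P, of values of rho and of the boundary scalars. The function rho is
    meromorphic as a matrix entry, nonzero where R(u) and R(1/u) are invertible, and can be inverted
    because it is generically nonzero. All that is taken from complex analysis is an alternative: a
    function holomorphic on |w| < 2 either vanishes on |w| <= 1/2 or has no zero near 0 other than
    possibly 0. It comes from Cauchy's formula on the square with corners 1 + i, 1 - i, -1 + i, -1 -
    i, with an estimate of the remainder in place of a theory of power series. *)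

Definition cmod z : R := ComplexField.Normc.normc z.

Lemma normE z : `|z| = (cmod z)%:C%C. Proof. by []. Qed.
Lemma cmod_ge0 z : 0 <= cmod z. Proof. by rewrite -lecR -normE normr_ge0. Qed.
Lemma cmod0 : cmod 0 = 0. Proof. exact: ComplexField.Normc.normc0. Qed.
Lemma cmod1 : cmod 1 = 1. Proof. exact: ComplexField.Normc.normc1. Qed.
Lemma cmod_eq0 z : (cmod z == 0) = (z == 0).
Proof.
apply/eqP/eqP => [|->]; last exact: cmod0.
exact: ComplexField.Normc.eq0_normc.
Qed.
Lemma cmod_gt0 z : (0 < cmod z) = (z != 0).
Proof. by rewrite lt_def cmod_ge0 cmod_eq0 andbT. Qed.
Lemma cmodM z w : cmod (z * w) = cmod z * cmod w.
Proof. exact: ComplexField.Normc.normcM. Qed.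
Lemma cmodV z : cmod z^-1 = (cmod z)^-1.
Proof. exact: ComplexField.Normc.normcV. Qed.
Lemma cmodX z k : cmod (z ^+ k) = cmod z ^+ k.
Proof. by elim: k => [|k IH]; rewrite ?cmod1// !exprS cmodM IH. Qed.
Lemma cmodN z : cmod (- z) = cmod z.
Proof. by have := normrN z; rewrite !normE => /complexI. Qed.
Lemma cmodD z w : cmod (z + w) <= cmod z + cmod w.
Proof. by have := ler_normD z w; rewrite !normE -rmorphD lecR. Qed.
Lemma cmodB z w : cmod (z - w) <= cmod z + cmod w.
Proof. by rewrite (le_trans (cmodD _ _))// cmodN. Qed.
Lemma cmod_distC z w : cmod (z - w) = cmod (w - z).
Proof. by rewrite -cmodN opprB. Qed.
Lemma cmod_lbD z w : cmod z - cmod w <= cmod (z + w).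
Proof.
rewrite lerBlDr; apply: le_trans (cmodB (z + w) w).
by rewrite addrK.
Qed.
Lemma Re_le_cmod z : `|complex.Re z| <= cmod z.
Proof.
case: z => a b; rewrite /cmod/=.
rewrite -(@ler_pXn2r _ 2)// ?nnegrE ?sqrtr_ge0// real_normK ?num_real//.
by rewrite sqr_sqrtr ?addr_ge0 ?sqr_ge0// lerDl sqr_ge0.
Qed.
Lemma Im_le_cmod z : `|complex.Im z| <= cmod z.
Proof.
case: z => a b; rewrite /cmod/=.
rewrite -(@ler_pXn2r _ 2)// ?nnegrE ?sqrtr_ge0// real_normK ?num_real//.
by rewrite sqr_sqrtr ?addr_ge0 ?sqr_ge0// lerDr sqr_ge0.
Qed.
Lemma cmod_le_ReIm z : cmod z <= `|complex.Re z| + `|complex.Im z|.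
Proof.
case: z => a b; rewrite /cmod/=.
rewrite -(@ler_pXn2r _ 2)// ?nnegrE ?sqrtr_ge0 ?addr_ge0//.
rewrite sqr_sqrtr ?addr_ge0 ?sqr_ge0// sqrrD !real_normK ?num_real//.
rewrite -addrA lerD2l lerDr mulrn_wge0// mulr_ge0//.
Qed.
Lemma sqr_cmod z : cmod z ^+ 2 = complex.Re z ^+ 2 + complex.Im z ^+ 2.
Proof. by case: z => a b; rewrite /cmod/= sqr_sqrtr ?addr_ge0 ?sqr_ge0. Qed.
Lemma cmodR (x : R) : cmod x%:C%C = `|x|.
Proof. by rewrite /cmod/= expr0n/= addr0 sqrtr_sqr. Qed.

End ComplexNorm.

Section ComplexIntegral.
Context {R : realType}.
Local Notation C := R[i].
Local Notation mu := (@lebesgue_measure R).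
Implicit Types (h : R -> C) (a b c : R).

Definition ccont_at h (x : R) := {for x, continuous (h : R^o -> C^o)}.

(** Two-sided at the endpoints as well: the integrands are functions on the whole line. *)
Definition ccont_on h a b := forall x, a <= x <= b -> ccont_at h x.

Lemma ccont_atZ (k : C) h x : ccont_at h x -> ccont_at (fun y => k * h y) x.
Proof.
move=> hx; apply: (@continuousM C R^o (fun=> k) h x) => //; exact: cst_continuous.
Qed.

Lemma ccont_at_ReIm h x : ccont_at h x ->
  {for x, continuous (fun y : R^o => complex.Re (h y) : R^o)} /\
  {for x, continuous (fun y : R^o => complex.Im (h y) : R^o)}.
Proof.
move=> /cvgrPdist_lt hx; split; apply/cvgrPdist_lt => e e0;
  have e0' : 0 < e%:C%C :> C by rewrite ltcR.
  apply: filterS (hx _ e0') => y; rewrite normE ltcR -raddfB; apply: le_lt_trans.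
  exact: Re_le_cmod.
apply: filterS (hx _ e0') => y; rewrite normE ltcR -raddfB; apply: le_lt_trans.
exact: Im_le_cmod.
Qed.

(** Not an oriented integral: it is 0 when b < a, hence the hypotheses [a <= b] in what follows. *)
Definition rint (f : R -> R) a b : R := \int[mu]_(x in `[a, b]) f x.
Definition cint h a b : C :=
  Complex (rint (fun x => complex.Re (h x)) a b) (rint (fun x => complex.Im (h x)) a b).

Lemma cont_integrable (f : R^o -> R^o) a b :
  (forall x, a <= x <= b -> {for x, continuous f}) ->
  mu.-integrable `[a, b] (EFin \o f).
Proof.
move=> fc; apply: continuous_compact_integrable; first exact: segment_compact.
apply: continuous_in_subspaceT => x /set_mem/=; rewrite in_itv/=; exact: fc.
Qed.

Lemma ccont_integrable h a b : ccont_on h a b ->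
  mu.-integrable `[a, b] (EFin \o (fun x => complex.Re (h x))) /\
  mu.-integrable `[a, b] (EFin \o (fun x => complex.Im (h x))).
Proof.
by move=> hc; split; apply: cont_integrable => x /hc /ccont_at_ReIm[].
Qed.

Lemma cintD h k a b : ccont_on h a b -> ccont_on k a b ->
  cint (fun x => h x + k x) a b = cint h a b + cint k a b.
Proof.
move=> /ccont_integrable[h1 h2] /ccont_integrable[k1 k2].
apply/eqP; rewrite eq_complex /= /rint; apply/andP; split; apply/eqP.
  by under eq_Rintegral do rewrite raddfD; rewrite RintegralD.
by under eq_Rintegral do rewrite raddfD; rewrite RintegralD.
Qed.

Lemma cintZ p h a b : ccont_on h a b ->
  cint (fun x => p * h x) a b = p * cint h a b.
Proof.
move=> /ccont_integrable[h1 h2]; case: p => p q.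
have i1 r : mu.-integrable `[a, b] (EFin \o (fun x => r * complex.Re (h x))).
  by have := integrableZl _ r h1; apply.
have i2 r : mu.-integrable `[a, b] (EFin \o (fun x => r * complex.Im (h x))).
  by have := integrableZl _ r h2; apply.
apply/eqP; rewrite eq_complex /= /rint; apply/andP; split; apply/eqP.
  rewrite -!RintegralZl// -RintegralB//.
  by apply: eq_Rintegral => x _; case: (h x).
rewrite -!RintegralZl// -RintegralD//.
by apply: eq_Rintegral => x _; case: (h x).
Qed.

Lemma cint_split h a b c : a <= b -> b <= c -> ccont_on h a c ->
  cint h a c = cint h a b + cint h b c.
Proof.
move=> ab bc /ccont_integrable[h1 h2].
have H f : mu.-integrable `[a, c] (EFin \o f) -> rint f a c = rint f a b + rint f b c.
  (* The two intervals share the point b, which is dropped from the second one as a null set. *)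
  move=> fi; rewrite /rint -(@Rintegral_itv_obnd_cbnd _ b); last first.
    apply: integrableS fi => //; apply: subset_itv; rewrite bnd_simp//.
  by rewrite -(@Rintegral_itvB _ _ (BLeft a))// ?bnd_simp// addrC subrK.
by apply/eqP; rewrite eq_complex /= -!H// !eqxx.
Qed.

Lemma rint_cst r a b : a <= b -> rint (fun=> r) a b = r * (b - a).
Proof.
move=> ab; rewrite /rint Rintegral_cst//= lebesgue_measure_itv/= lte_fin.
case: ltP => [_|ba]; first by [].
by rewrite (le_anti (_ : a <= b <= a)) ?ab ?ba// subrr mulr0.
Qed.

Lemma rint_le (f g : R -> R) a b :
  mu.-integrable `[a, b] (EFin \o f) -> mu.-integrable `[a, b] (EFin \o g) ->
  (forall x, a <= x <= b -> f x <= g x) -> rint f a b <= rint g a b.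
Proof. by move=> fi gi fg; apply: le_Rintegral => // x /=; rewrite in_itv/=; exact: fg. Qed.

Lemma cst_integrable r a b : mu.-integrable `[a, b] (EFin \o (fun=> r)).
Proof. by apply: cont_integrable => x _; exact: cst_continuous. Qed.

(** The factor 2 comes from bounding the real and imaginary parts separately; a sharp constant would
    bring nothing to the limits taken below. *)
Lemma cint_bound h a b M : a <= b -> ccont_on h a b ->
  (forall x, a <= x <= b -> cmod (h x) <= M) ->
  cmod (cint h a b) <= 2 * M * (b - a).
Proof.
move=> ab /ccont_integrable[h1 h2] hM.
have H f : mu.-integrable `[a, b] (EFin \o f) ->
    (forall x, a <= x <= b -> `|f x| <= M) -> `|rint f a b| <= M * (b - a).
  move=> fi fM; rewrite ler_norml; apply/andP; split.
    rewrite -mulNr -rint_cst//; apply: rint_le => //; first exact: cst_integrable.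
    by move=> x /fM; rewrite ler_norml => /andP[].
  rewrite -rint_cst//; apply: rint_le => //; first exact: cst_integrable.
  by move=> x /fM; rewrite ler_norml => /andP[].
rewrite (le_trans (cmod_le_ReIm _))//= -mulrA mulr_natl mulr2n lerD//; apply: H => // x /hM;
  apply: le_trans; [exact: Re_le_cmod|exact: Im_le_cmod].
Qed.

(** The one integral that is computed by the fundamental theorem of calculus; constants aside,
    affine functions require nothing else. *)
Lemma cint_id a b : a <= b ->
  cint (fun x => x%:C%C) a b = ((b ^+ 2 - a ^+ 2) / 2)%:C%C.
Proof.
rewrite le_eqVlt => /predU1P[->|ab].
  rewrite subrr mul0r /cint/= /rint set_itv1 !Rintegral_set1//.
have E : rint id a b = (b ^+ 2 - a ^+ 2) / 2.
  pose F (x : R) := x ^+ 2 / 2.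
  have dF (x : R) : is_derive x 1 F x.
    have -> : F = (2^-1 : R) *: ((@GRing.exp R)^~ 2%N).
      by apply/funext => y; rewrite /F mulrC.
    by apply: is_derive_eq; rewrite /GRing.scale/=; field.
  have cF : continuous F.
    by move=> x; apply/differentiable_continuous/derivable1_diffP; exact: (@ex_derive _ _ _ _ _ _ _ (dF x)).
  rewrite /rint /Rintegral (@continuous_FTC2 _ _ F)//=.
  - by rewrite /F mulrBl.
  - by apply: continuous_subspaceT => x; exact: cvg_id.
  - split.
    + by move=> x _; exact: (@ex_derive _ _ _ _ _ _ _ (dF x)).
    + exact/cvg_at_right_filter/cF.
    + exact/cvg_at_left_filter/cF.
  - by move=> x _; rewrite derive1E derive_val.
by rewrite /cint/= E rint_cst ?mul0r ?ltW.
Qed.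

Lemma cint_cst p a b : a <= b -> cint (fun=> p) a b = p * (b - a)%:C%C.
Proof.
by move=> ab; rewrite /cint !rint_cst//; case: p => p q/=; apply/eqP; rewrite eq_complex/= !mulr0 subr0 add0r !eqxx.
Qed.

Lemma eq_cint h k a b : (forall x, a <= x <= b -> h x = k x) ->
  cint h a b = cint k a b.
Proof.
move=> hk; apply/eqP; rewrite eq_complex /= /rint; apply/andP; split; apply/eqP;
by apply: eq_Rintegral => x /set_mem; rewrite /= in_itv/= => /hk ->.
Qed.

Lemma Im_cint_ge h a b m : a <= b -> ccont_on h a b ->
  (forall x, a <= x <= b -> m <= complex.Im (h x)) ->
  m * (b - a) <= complex.Im (cint h a b).
Proof.
move=> ab /ccont_integrable[_ h2] hm; rewrite /= -rint_cst//; apply: rint_le => //.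
exact: cst_integrable.
Qed.

End ComplexIntegral.

(** * Bisection of rectangles *)

Section Bisection.
Context {R : realType}.
Implicit Types (P : R -> R -> R -> R -> Prop).

Definition in_rect (a b c d : R) (z : R[i]) :=
  a <= complex.Re z <= b /\ c <= complex.Im z <= d.

Lemma nested_intervals (a b : R^nat) :
  (forall n, a n <= a n.+1) -> (forall n, b n.+1 <= b n) ->
  (forall n, a n <= b n) -> exists x, forall n, a n <= x <= b n.
Proof.
move=> am bm ab.
have amono m n : (m <= n)%N -> a m <= a n.
  by move=> /subnK <-; elim: (n - m)%N => [|k IH]//; rewrite addSn (le_trans IH).
have bmono m n : (m <= n)%N -> b n <= b m.
  by move=> /subnK <-; elim: (n - m)%N => [|k IH]//; rewrite addSn (le_trans (bm _)).
have H m n : a m <= b n.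
  have := leq_total m n => /orP[mn|nm].
    exact: le_trans (amono _ _ mn) (ab n).
  exact: le_trans (ab m) (bmono _ _ nm).
exists (sup (range a)) => n; apply/andP; split.
  apply: ub_le_sup; last by exists n.
  by exists (b 0%N) => _ [m _ <-].
apply: ge_sup; first by exists (a 0%N), 0%N.
by move=> _ [m _ <-].
Qed.

Lemma half_pow_lt (L e : R) : 0 <= L -> 0 < e -> exists n, L / 2 ^+ n < e.
Proof.
move=> L0 e0; have [n nP] : exists n : nat, L / e < n%:R.
  exists (Num.bound (L / e)).
  by rewrite archi_boundP// divr_ge0// ltW.
exists n; rewrite ltr_pdivrMr ?exprn_gt0//.
move: nP; rewrite ltr_pdivrMr// mulrC => /lt_le_trans; apply.
by rewrite ler_pM2l// -natrX ler_nat ltnW// ltn_expl.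
Qed.

(** Compactness as an induction principle. If P failed, one of the quarters would fail in turn, and
    so on; the nested failing rectangles shrink to a point z, where the local hypothesis applies to
    them. *)
Lemma rect_bisection P (a b c d : R) : a <= b -> c <= d ->
  (forall a b c d : R, a <= b -> c <= d ->
    let p := (a + b) / 2 in let q := (c + d) / 2 in
    P a p c q -> P p b c q -> P a p q d -> P p b q d -> P a b c d) ->
  (forall z, in_rect a b c d z -> exists2 e : R, 0 < e &
    forall a' b' c' d', a <= a' -> b' <= b -> c <= c' -> d' <= d ->
     a' <= b' -> c' <= d' -> in_rect a' b' c' d' z ->
     b' - a' < e -> d' - c' < e -> P a' b' c' d') ->
  P a b c d.
Proof.
move=> ab cd HP loc; apply: contrapT => nP.
pose rect := (R * R * R * R)%type.
pose PP (q : rect) := let: (a, b, c, d) := q in P a b c d.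
(* A quarter on which P fails; the fourth is the default, as P fails there if it holds on the other
   three. *)
pose next (Q : rect) : rect := let: (a, b, c, d) := Q in
  let p := (a + b) / 2 in let q := (c + d) / 2 in
  if ~~ `[< P a p c q >] then (a, p, c, q) else
  if ~~ `[< P p b c q >] then (p, b, c, q) else
  if ~~ `[< P a p q d >] then (a, p, q, d) else (p, b, q, d).
pose Q n := iter n next (a, b, c, d).
pose ok (Q : rect) := let: (a, b, c, d) := Q in [/\ a <= b, c <= d & ~ P a b c d].
have nextP q : ok q -> ok (next q) /\
   (let: (a, b, c, d) := q in let: (a', b', c', d') := next q in
    [/\ a <= a', b' <= b, c <= c', d' <= d & b' - a' = (b - a) / 2 /\ d' - c' = (d - c) / 2]).
  case: q => [[[a1 b1] c1] d1]/= [ab1 cd1 nP1].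
  case: asboolP => h1 /=; last by split; split=> //; try lra; split; lra.
  case: asboolP => h2 /=; last by split; split=> //; try lra; split; lra.
  case: asboolP => h3 /=; last by split; split=> //; try lra; split; lra.
  split; last by split=> //; try lra; split; lra.
  split; try lra.
  by move=> h4; apply: nP1; apply: HP.
have Qok n : ok (Q n) by elim: n => [|n /nextP[]].
pose qa n := (Q n).1.1.1; pose qb n := (Q n).1.1.2.
pose qc n := (Q n).1.2; pose qd n := (Q n).2.
have QE n : Q n = (qa n, qb n, qc n, qd n).
  by rewrite /qa /qb /qc /qd; case: (Q n) => [[[]]].
have st n : [/\ qa n <= qa n.+1, qb n.+1 <= qb n, qc n <= qc n.+1, qd n.+1 <= qd n
   & qb n.+1 - qa n.+1 = (qb n - qa n) / 2 /\ qd n.+1 - qc n.+1 = (qd n - qc n) / 2].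
  by have [_] := nextP _ (Qok n); rewrite -[next _]/(Q n.+1) (QE n) (QE n.+1).
have okn n : [/\ qa n <= qb n, qc n <= qd n & ~ P (qa n) (qb n) (qc n) (qd n)].
  by have := Qok n; rewrite QE.
have [x xP] : exists x, forall n, qa n <= x <= qb n.
  apply: nested_intervals => n; first by have [] := st n.
    by have [] := st n.
  by have [] := okn n.
have [y yP] : exists y, forall n, qc n <= y <= qd n.
  apply: nested_intervals => n; first by have [] := st n.
    by have [] := st n.
  by have [] := okn n.
have [|e e0 He] := loc (Complex x y); first by split; [exact: xP 0%N|exact: yP 0%N].
have wid n : qb n - qa n = (b - a) / 2 ^+ n /\ qd n - qc n = (d - c) / 2 ^+ n.
  elim: n => [|n [I1 I2]]; first by rewrite expr0 !divr1.
  have [_ _ _ _ [-> ->]] := st n.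
  by rewrite I1 I2 exprSr invfM !mulrA.
have bd n : [/\ a <= qa n, qb n <= b, c <= qc n & qd n <= d].
  elim: n => [|n [i1 i2 i3 i4]]; first by [].
  have [s1 s2 s3 s4 _] := st n.
  by split; [exact: le_trans i1 s1|exact: le_trans s2 i2|exact: le_trans i3 s3|exact: le_trans s4 i4].
have [n nP'] : exists n, (b - a + (d - c)) / 2 ^+ n < e.
  by apply: half_pow_lt => //; rewrite addr_ge0// subr_ge0.
have [w1 w2] := wid n; have [i1 i2 i3 i4] := bd n; have [o1 o2] := okn n.
apply; apply: (He _ _ _ _ i1 i2 i3 i4 o1 o2); first by split; [exact: xP|exact: yP].
- rewrite w1; apply: le_lt_trans nP'; rewrite ler_pM2r ?invr_gt0 ?exprn_gt0//.
  by rewrite lerDl subr_ge0.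
- rewrite w2; apply: le_lt_trans nP'; rewrite ler_pM2r ?invr_gt0 ?exprn_gt0//.
  by rewrite lerDr subr_ge0.
Qed.

End Bisection.

(** * Cauchy's theorem on rectangles and the identity theorem *)

Section Goursat.
Context {R : realType}.
Local Notation C := R[i].
Implicit Types (f g : C -> C) (z w : C) (a b c d : R).

Definition ccont f z := {for (z : C^o), continuous (f : C^o -> C^o)}.

Definition cdiff f z := differentiable (f : C^o -> C^o) (z : C^o).

Lemma ccontP f z : ccont f z -> forall e : R, 0 < e -> exists2 d : R, 0 < d &
  forall w, cmod (w - z) < d -> cmod (f w - f z) < e.
Proof.
move=> /cvgrPdist_lt fz e e0; have e0' : 0 < e%:C%C :> C by rewrite ltcR.
have /nbhs_ballP[d /= d0 fd] := fz _ e0'.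
(* Radii of balls are elements of C; a positive one is real. *)
have dE : d = (complex.Re d)%:C%C by rewrite RRe_real// ger0_real// ltW.
exists (complex.Re d) => [|w wd]; first by rewrite -ltcR -dE.
rewrite cmod_distC -ltcR -normE; apply: fd.
by rewrite /ball/= dE distrC normE ltcR.
Qed.

Lemma cdiffP f z : cdiff f z -> exists l : C, forall e : R, 0 < e ->
  exists2 d : R, 0 < d &
  forall w, cmod (w - z) < d -> cmod (f w - f z - l * (w - z)) <= e * cmod (w - z).
Proof.
move=> /(@diff_derivable _ _ _ _ _ (1 : C^o)).
rewrite /derivable; set F := (fun h : C^o => (_ : C^o)) => /cvgrPdist_lt.
set l : C^o := lim _ => Fl; exists l => e e0.
have e0' : 0 < e%:C%C :> C by rewrite ltcR.
have := Fl _ e0'; rewrite near_withinE => /nbhs_ballP[d /= d0 fd].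
have dE : d = (complex.Re d)%:C%C by rewrite RRe_real// ger0_real// ltW.
exists (complex.Re d) => [|w wd]; first by rewrite -ltcR -dE.
have [->|wz] := eqVneq w z.
  by rewrite !subrr mulr0 subr0 cmod0 mulr0.
have wz0 : w - z != 0 by rewrite subr_eq0.
have /fd : ball (0 : C^o) d (w - z : C^o).
  by rewrite /ball/= sub0r normrN dE normE ltcR.
move=> /(_ wz0); rewrite /F /= normE ltcR /GRing.scale/= mulr1 subrK => H.
have -> : f w - f z - l * (w - z) = - ((l - (w - z)^-1 * (f w - f z)) * (w - z)).
  by field.
by rewrite cmodN cmodM ler_wpM2r ?cmod_ge0// ltW.
Qed.

Lemma ccont_cst p z : ccont (fun=> p) z.
Proof. exact: cst_continuous. Qed.

Lemma ccontD f g z : ccont f z -> ccont g z -> ccont (fun w => f w + g w) z.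
Proof. exact: continuousD. Qed.

Lemma ccontN f z : ccont f z -> ccont (fun w => - f w) z.
Proof. exact: continuousN. Qed.

Lemma ccontM f g z : ccont f z -> ccont g z -> ccont (fun w => f w * g w) z.
Proof. exact: continuousM. Qed.

Lemma ccontX f z k : ccont f z -> ccont (fun w => f w ^+ k) z.
Proof.
move=> fz; elim: k => [|k IH]; first exact: ccont_cst.
rewrite (_ : (fun w => _) = (fun w => f w * f w ^+ k)); first exact: ccontM.
by apply/funext => w; rewrite exprS.
Qed.

Lemma ccontV f z : f z != 0 -> ccont f z -> ccont (fun w => (f w)^-1) z.
Proof. exact: continuousV. Qed.

Lemma ccont_affine p q z : ccont (fun w => p * w + q) z.
Proof.
apply: ccontD; last exact: ccont_cst.
by apply: ccontM; [exact: ccont_cst|exact: cvg_id].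
Qed.

Definition hpt (c : R) (x : R) : C := Complex x c.
Definition vpt (a : R) (y : R) : C := Complex a y.

Lemma nonexpansive_cont (h : R -> C) x : (forall y, cmod (h x - h y) <= `|x - y|) ->
  {for x, continuous (h : R^o -> C^o)}.
Proof.
move=> hx; apply/cvgrPdist_lt => e e0.
have eE : e = (complex.Re e)%:C%C by rewrite RRe_real// ger0_real// ltW.
apply/nbhs_ballP; exists (complex.Re e); first by rewrite /= -ltcR -eE.
by move=> y; rewrite /ball/= normE eE ltcR; apply: le_lt_trans.
Qed.

Lemma hpt_cont c x : {for x, continuous (hpt c : R^o -> C^o)}.
Proof.
apply: nonexpansive_cont => y; rewrite (le_trans (cmod_le_ReIm _))//=.
by rewrite subrr normr0 addr0.
Qed.

Lemma vpt_cont a y : {for y, continuous (vpt a : R^o -> C^o)}.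
Proof.
apply: nonexpansive_cont => z; rewrite (le_trans (cmod_le_ReIm _))//=.
by rewrite subrr normr0 add0r.
Qed.

(** As [||] binds tighter than [/\], these are the two horizontal sides, then the two vertical
    ones. *)
Definition on_bdry a b c d z :=
  (a <= complex.Re z <= b /\ (complex.Im z == c) || (complex.Im z == d)) \/
  ((complex.Re z == a) || (complex.Re z == b) /\ c <= complex.Im z <= d).

Definition bdry_cont f a b c d := forall z, on_bdry a b c d z -> ccont f z.

(** The counterclockwise contour integral of f(z) dz; the factor i is dz = i dy on the vertical
    sides. *)
Definition rectint f a b c d : C :=
  cint (fun x => f (hpt c x)) a b - cint (fun x => f (hpt d x)) a b
  + 'i%C * (cint (fun y => f (vpt b y)) c d - cint (fun y => f (vpt a y)) c d).

Lemma bdry_ccont f a b c d : a <= b -> c <= d -> bdry_cont f a b c d ->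
  [/\ ccont_on (fun x => f (hpt c x)) a b, ccont_on (fun x => f (hpt d x)) a b,
   ccont_on (fun y => f (vpt b y)) c d & ccont_on (fun y => f (vpt a y)) c d].
Proof.
move=> ab cd fc; split => x xab;
  [apply: (@continuous_comp R^o C^o C^o (hpt c) f); first exact: hpt_cont
  |apply: (@continuous_comp R^o C^o C^o (hpt d) f); first exact: hpt_cont
  |apply: (@continuous_comp R^o C^o C^o (vpt b) f); first exact: vpt_cont
  |apply: (@continuous_comp R^o C^o C^o (vpt a) f); first exact: vpt_cont];
  apply: fc; [left|left|right|right]; by rewrite /= ?eqxx ?orbT.
Qed.

Lemma rectintD f g a b c d : a <= b -> c <= d -> bdry_cont f a b c d ->
  bdry_cont g a b c d ->
  rectint (fun w => f w + g w) a b c d = rectint f a b c d + rectint g a b c d.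
Proof.
move=> ab cd /(bdry_ccont ab cd)[f1 f2 f3 f4] /(bdry_ccont ab cd)[g1 g2 g3 g4].
by rewrite /rectint !cintD//; ring.
Qed.

Lemma rectintZ p f a b c d : a <= b -> c <= d -> bdry_cont f a b c d ->
  rectint (fun w => p * f w) a b c d = p * rectint f a b c d.
Proof.
move=> ab cd /(bdry_ccont ab cd)[f1 f2 f3 f4].
by rewrite /rectint !cintZ//; ring.
Qed.

Lemma eq_rectint f g a b c d : a <= b -> c <= d ->
  (forall z, on_bdry a b c d z -> f z = g z) ->
  rectint f a b c d = rectint g a b c d.
Proof.
move=> ab cd fg; rewrite /rectint.
by congr (_ - _ + _ * (_ - _)); apply: eq_cint => x xab; apply: fg;
  [left|left|right|right]; rewrite /= ?eqxx ?orbT.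
Qed.

Lemma rectint_bound f a b c d M : a <= b -> c <= d -> bdry_cont f a b c d ->
  (forall z, on_bdry a b c d z -> cmod (f z) <= M) ->
  cmod (rectint f a b c d) <= 4 * M * (b - a + (d - c)).
Proof.
move=> ab cd /(bdry_ccont ab cd)[f1 f2 f3 f4] fM.
have H1 : cmod (cint (fun x => f (hpt c x)) a b) <= 2 * M * (b - a).
  by apply: cint_bound => // x xab; apply: fM; left; rewrite /= eqxx.
have H2 : cmod (cint (fun x => f (hpt d x)) a b) <= 2 * M * (b - a).
  by apply: cint_bound => // x xab; apply: fM; left; rewrite /= eqxx orbT.
have H3 : cmod (cint (fun x => f (vpt b x)) c d) <= 2 * M * (d - c).
  by apply: cint_bound => // x xab; apply: fM; right; rewrite /= eqxx orbT.
have H4 : cmod (cint (fun x => f (vpt a x)) c d) <= 2 * M * (d - c).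
  by apply: cint_bound => // x xab; apply: fM; right; rewrite /= eqxx.
rewrite /rectint (le_trans (cmodD _ _))// cmodM.
have -> : cmod ('i%C : C) = 1 by rewrite /cmod/= expr0n/= add0r expr1n sqrtr1.
rewrite mul1r.
have := lerD (le_trans (cmodB _ _) (lerD H1 H2)) (le_trans (cmodB _ _) (lerD H3 H4)).
move=> /le_trans; apply; lra.
Qed.

Lemma rectint_hsplit f a m b c d : a <= m -> m <= b -> c <= d ->
  bdry_cont f a m c d -> bdry_cont f m b c d ->
  rectint f a b c d = rectint f a m c d + rectint f m b c d.
Proof.
move=> am mb cd f1 f2.
have H e : e = c \/ e = d -> ccont_on (fun x => f (hpt e x)) a b.
  move=> he x /andP[ax xb]; have [xm|mx] := leP x m.
    have [A B _ _] := bdry_ccont am cd f1.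
    by case: he => ->; [apply: A|apply: B]; rewrite ax.
  have [A B _ _] := bdry_ccont mb cd f2.
  by case: he => ->; [apply: A|apply: B]; rewrite ltW.
rewrite /rectint (cint_split am mb (H c _)); last by left.
by rewrite (cint_split am mb (H d _)); [ring|right].
Qed.

Lemma rectint_vsplit f a b c m d : a <= b -> c <= m -> m <= d ->
  bdry_cont f a b c m -> bdry_cont f a b m d ->
  rectint f a b c d = rectint f a b c m + rectint f a b m d.
Proof.
move=> ab cm md f1 f2.
have H e : e = a \/ e = b -> ccont_on (fun x => f (vpt e x)) c d.
  move=> he x /andP[ax xb]; have [xm|mx] := leP x m.
    have [_ _ A B] := bdry_ccont ab cm f1.
    by case: he => ->; [apply: B|apply: A]; rewrite ax.
  have [_ _ A B] := bdry_ccont ab md f2.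
  by case: he => ->; [apply: B|apply: A]; rewrite ltW.
rewrite /rectint (cint_split cm md (H b _)); last by right.
by rewrite (cint_split cm md (H a _)); [ring|left].
Qed.

Lemma on_bdry_rect a b c d z : a <= b -> c <= d -> on_bdry a b c d z -> in_rect a b c d z.
Proof.
by move=> ab cd; rewrite /in_rect => -[[? /orP[]/eqP ->]|[/orP[]/eqP -> ?]]; split; rewrite ?lexx ?ab ?cd.
Qed.

Lemma rectint_affine p q a b c d : a <= b -> c <= d ->
  rectint (fun w => p * w + q) a b c d = 0.
Proof.
move=> ab cd.
have cR (x : R^o) : {for x, continuous ((fun x => x%:C%C) : R^o -> C^o)}.
  exact: hpt_cont.
have H e : cint (fun x => p * hpt e x + q) a b =
    p * ((b ^+ 2 - a ^+ 2) / 2)%:C%C + (p * (e%:C%C * 'i%C) + q) * (b - a)%:C%C.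
  rewrite (@eq_cint _ _ (fun x => p * x%:C%C + (p * (e%:C%C * 'i%C) + q))); last first.
    move=> x _; rewrite /hpt; have -> : (x +i* e)%C = x%:C%C + e%:C%C * 'i%C.
      by simpc.
    by ring.
  rewrite cintD ?cintZ ?cint_id ?cint_cst//.
  - by move=> x _; exact: cR.
  - by move=> x _; apply: cvgM; [exact: cvg_cst|exact: cR].
  - by move=> x _; exact: cvg_cst.
have V e : cint (fun x => p * vpt e x + q) c d =
    p * 'i%C * ((d ^+ 2 - c ^+ 2) / 2)%:C%C + (p * e%:C%C + q) * (d - c)%:C%C.
  rewrite (@eq_cint _ _ (fun x => p * 'i%C * x%:C%C + (p * e%:C%C + q))); last first.
    move=> x _; rewrite /vpt; have -> : (e +i* x)%C = e%:C%C + x%:C%C * 'i%C.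
      by simpc.
    by ring.
  rewrite cintD ?cintZ ?cint_id ?cint_cst//.
  - by move=> x _; exact: cR.
  - by move=> x _; apply: cvgM; [exact: cvg_cst|exact: cR].
  - by move=> x _; exact: cvg_cst.
have ii : 'i%C * 'i%C = -1 :> C by rewrite -expr2 sqr_i.
rewrite /rectint !H !V !rmorphB/=; ring: ii.
Qed.

(** Near a point, f is an affine map, of integral 0, up to e times the distance; so on a small
    rectangle with sides of sum s the integral is at most 4 e s^2. This bound survives bisection: s
    is halved and there are four pieces. *)
Lemma goursat f a b c d : a <= b -> c <= d ->
  (forall z, in_rect a b c d z -> cdiff f z) -> rectint f a b c d = 0.
Proof.
move=> ab cd fd.
suff H e : 0 < e -> cmod (rectint f a b c d) <= 4 * e * (b - a + (d - c)) ^+ 2.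
  apply/eqP; rewrite -cmod_eq0 eq_le cmod_ge0 andbT leNgt; apply/negP => r0.
  set s := (b - a + (d - c)) in H.
  have s0 : 0 < 8 * (s ^+ 2 + 1) by rewrite mulr_gt0// ltr_wpDl ?sqr_ge0.
  have /H := divr_gt0 r0 s0; set r := cmod _ in r0 *.
  rewrite leNgt => /negP; apply; rewrite mulrC mulrA mulrA ltr_pdivrMr//.
  by have := sqr_ge0 s; nra.
move=> e0.
(* Inclusion in the initial rectangle is part of P, since the bisection step ranges over all
   rectangles. *)
pose P a' b' c' d' := a <= a' -> b' <= b -> c <= c' -> d' <= d ->
  cmod (rectint f a' b' c' d') <= 4 * e * (b' - a' + (d' - c')) ^+ 2.
have fc a' b' c' d' : a <= a' -> b' <= b -> c <= c' -> d' <= d ->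
   a' <= b' -> c' <= d' -> bdry_cont f a' b' c' d'.
  move=> h1 h2 h3 h4 h5 h6 z /on_bdry_rect -/(_ h5 h6)[/andP[k1 k2] /andP[k3 k4]].
  apply: differentiable_continuous; apply: fd; split.
    by rewrite (le_trans h1 k1) (le_trans k2 h2).
  by rewrite (le_trans h3 k3) (le_trans k4 h4).
suff: P a b c d by apply.
apply: rect_bisection => //.
  move=> {}a' {}b' {}c' {}d' ab' cd' p q.
  have [pa pb] : a' <= p /\ p <= b' by rewrite /p; split; lra.
  have [qa qb] : c' <= q /\ q <= d' by rewrite /q; split; lra.
  move=> P1 P2 P3 P4 h1 h2 h3 h4.
  have pb' := le_trans pb h2; have pa' := le_trans h1 pa.
  have qb' := le_trans qb h4; have qa' := le_trans h3 qa.
  have {}P1 := P1 h1 pb' h3 qb'; have {}P2 := P2 pa' h2 h3 qb'.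
  have {}P3 := P3 h1 pb' qa' h4; have {}P4 := P4 pa' h2 qa' h4.
  rewrite (@rectint_hsplit f a' p b')//; try exact: fc.
  rewrite (@rectint_vsplit f a' p c' q)//; try exact: fc.
  rewrite (@rectint_vsplit f p b' c' q)//; try exact: fc.
  have H := lerD (lerD P1 P3) (lerD P2 P4).
  apply: le_trans (cmodD _ _) _.
  apply: le_trans (lerD (cmodD _ _) (cmodD _ _)) _.
  apply: le_trans H _.
  have -> : p - a' = (b' - a') / 2 by rewrite /p; field.
  have -> : b' - p = (b' - a') / 2 by rewrite /p; field.
  have -> : q - c' = (d' - c') / 2 by rewrite /q; field.
  have -> : d' - q = (d' - c') / 2 by rewrite /q; field.
  by rewrite le_eqVlt; apply/orP; left; apply/eqP; field.
move=> z zr; have [l fl] := cdiffP (fd _ zr); have [dl d0 H] := fl _ e0.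
exists (dl / 2); first by rewrite divr_gt0.
move=> a' b' c' d' h1 h2 h3 h4 ab' cd' zr' w1 w2 _ _ _ _.
have near w : in_rect a' b' c' d' w -> cmod (w - z) <= b' - a' + (d' - c').
  move=> [/andP[r1 r2] /andP[r3 r4]]; move: zr' => [/andP[s1 s2] /andP[s3 s4]].
  rewrite (le_trans (cmod_le_ReIm _))// !raddfB/= lerD// ler_norml; lra.
(* Subtracts the tangent affine map at z, with the slope l of f there. *)
have -> : rectint f a' b' c' d' = rectint (fun w => f w - (l * w + (f z - l * z))) a' b' c' d'.
  rewrite -[LHS]subr0 -(rectint_affine l (f z - l * z) ab' cd') -[X in _ - X]mul1r -mulNr.
  rewrite -rectintZ//; last first.
    by move=> w _; exact: ccont_affine.
  rewrite -rectintD//; first by apply: eq_rectint => // w _; rewrite mulN1r.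
    exact: fc.
  by move=> w _; apply: ccontM; [exact: ccont_cst|exact: ccont_affine].
rewrite expr2 !mulrA; rewrite -(mulrA 4); apply: rectint_bound => //.
  by move=> w wb; apply: ccontD; [exact: fc wb|apply: ccontN; exact: ccont_affine].
move=> w /(on_bdry_rect ab' cd') /near wz.
have -> : f w - (l * w + (f z - l * z)) = f w - f z - l * (w - z) by ring.
have lt : cmod (w - z) < dl by apply: le_lt_trans wz _; lra.
by apply: le_trans (H _ lt) _; rewrite ler_pM2l.
Qed.

End Goursat.

Section Cauchy.
Context {R : realType}.
Local Notation C := R[i].
Implicit Types (f g : C -> C) (z w : C) (a b c d : R).

Lemma cdiff_cont f z : cdiff f z -> ccont f z.
Proof. exact: differentiable_continuous. Qed.

Lemma cdiff_quot f z w : cdiff f w -> w != z ->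
  cdiff (fun u => (f u - f z) / (u - z)) w.
Proof.
move=> fw wz; have dB (h : C^o -> C^o) (p : C^o) : differentiable h (w : C^o) ->
    differentiable (fun u : C^o => h u - p) (w : C^o).
  by move=> hw; exact: differentiableB.
apply: (@differentiableM C^o C^o (fun u => f u - f z) (fun u => (u - z)^-1)); first exact: dB.
by apply: (@differentiableV C^o C^o (fun u => u - z)); [exact: dB|rewrite subr_eq0].
Qed.

Local Notation rint_sq g := (rectint g (-1) 1 (-1) 1).

(** The four strips between the two rectangles do not contain the singularity z, so Goursat's
    theorem applies to each of them. *)
Lemma rectint_shrink g z a b c d a' b' c' d' :
  a <= a' -> a' < complex.Re z < b' -> b' <= b ->
  c <= c' -> c' < complex.Im z < d' -> d' <= d ->
  (forall w, in_rect a b c d w -> w != z -> cdiff g w) ->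
  rectint g a b c d = rectint g a' b' c' d' /\ bdry_cont g a' b' c' d'.
Proof.
set p := complex.Re z; set q := complex.Im z.
move=> aa /andP[ap pb] bb cc /andP[cq qd] dd gd.
have ab := lt_trans ap pb; have cd := lt_trans cq qd.
have gc u v s t : u <= v -> s <= t -> a <= u -> v <= b -> c <= s -> t <= d ->
    p != u -> p != v -> q != s -> q != t -> bdry_cont g u v s t.
  move=> uv st h1 h2 h3 h4 n1 n2 n3 n4 w wb; apply: cdiff_cont; apply: gd.
    have [/andP[r1 r2] /andP[r3 r4]] := on_bdry_rect uv st wb.
    by split; [rewrite (le_trans h1 r1) (le_trans r2 h2)|rewrite (le_trans h3 r3) (le_trans r4 h4)].
  apply/eqP => wE; case: wb; rewrite wE -/p -/q /=.
    by move=> [_ /orP[/eqP E|/eqP E]]; move: n3 n4; rewrite E eqxx.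
  by move=> [/orP[/eqP E|/eqP E] _]; move: n1 n2; rewrite E eqxx.
have g0 u v s t : u <= v -> s <= t -> a <= u -> v <= b -> c <= s -> t <= d ->
   [|| p < u, v < p, q < s | t < q] -> rectint g u v s t = 0 /\ bdry_cont g u v s t.
  move=> uv st h1 h2 h3 h4 hz.
  have wd w : in_rect u v s t w -> cdiff g w.
    move=> [/andP[r1 r2] /andP[r3 r4]]; apply: gd.
      by split; [rewrite (le_trans h1 r1) (le_trans r2 h2)|rewrite (le_trans h3 r3) (le_trans r4 h4)].
    apply: contraTneq hz => wE; rewrite wE -/p -/q in r1 r2 r3 r4.
    by rewrite !ltNge r1 r2 r3 r4.
  split; first exact: goursat.
  by move=> w /(on_bdry_rect uv st) /wd /cdiff_cont.
have ab' := ltW ab; have cd' := ltW cd.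
have apb := le_trans aa ab'; have abb := le_trans ab' bb.
have cpd := le_trans cc cd'; have cdd := le_trans cd' dd.
have ab0 := le_trans aa abb; have cd0 := le_trans cc cdd.
have pa' : p != a' by rewrite gt_eqF.
have pb' : p != b' by rewrite lt_eqF.
have qc' : q != c' by rewrite gt_eqF.
have qd' : q != d' by rewrite lt_eqF.
have pb'' : p != b by rewrite lt_eqF// (lt_le_trans pb).
have qc : q != c by rewrite gt_eqF// (le_lt_trans cc).
have qd'' : q != d by rewrite lt_eqF// (lt_le_trans qd).
have bc1 : bdry_cont g a' b' c' d'.
  exact: gc.
have [z1 c1] : rectint g a a' c d = 0 /\ bdry_cont g a a' c d.
  by apply: g0; rewrite ?lexx ?ap ?orbT.
have [z2 c2] : rectint g b' b c d = 0 /\ bdry_cont g b' b c d.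
  by apply: g0; rewrite ?lexx ?pb ?orbT.
have [z3 c3] : rectint g a' b' c c' = 0 /\ bdry_cont g a' b' c c'.
  by apply: g0; rewrite ?lexx ?cq ?orbT.
have [z4 c4] : rectint g a' b' d' d = 0 /\ bdry_cont g a' b' d' d.
  by apply: g0; rewrite ?lexx ?qd ?orbT.
split=> //.
rewrite (@rectint_hsplit _ g _ a')// ?z1 ?add0r; last first.
  exact: gc.
rewrite (@rectint_hsplit _ g _ b')// ?z2 ?addr0; last first.
  exact: gc.
rewrite (@rectint_vsplit _ g _ _ _ c')// ?z3 ?add0r; last first.
  exact: gc.
by rewrite (@rectint_vsplit _ g _ _ _ d')// ?z4 ?addr0.
Qed.

(** The quotient is bounded near z by differentiability of f, so its integral over a square of side
    2 e around z is O(e); shrinking the contour shows that this is the whole integral. *)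
Lemma cauchy_quotient f z :
  (forall w, in_rect (-1) 1 (-1) 1 w -> cdiff f w) -> cmod z < 1 ->
  rint_sq (fun w => (f w - f z) / (w - z)) = 0.
Proof.
move=> fd z1; set g := fun w => _.
have zr : in_rect (-1) 1 (-1) 1 z.
  have := le_lt_trans (Re_le_cmod z) z1; have := le_lt_trans (Im_le_cmod z) z1.
  by rewrite !ltr_norml => /andP[? ?] /andP[? ?]; split; apply/andP; split; apply: ltW.
have [l fl] := cdiffP (fd _ zr); have [d0 d00 H] := fl _ ltr01.
have gM w : w != z -> cmod (w - z) < d0 -> cmod (g w) <= cmod l + 1.
  move=> wz /H; rewrite mul1r => fw.
  rewrite /g cmodM cmodV ler_pdivrMr ?cmod_gt0 ?subr_eq0//.
  have -> : f w - f z = (f w - f z - l * (w - z)) + l * (w - z) by ring.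
  by rewrite (le_trans (cmodD _ _))// mulrDl mul1r cmodM addrC lerD2l.
have := le_lt_trans (Re_le_cmod z) z1; have := le_lt_trans (Im_le_cmod z) z1.
set p := complex.Re z; set q := complex.Im z.
rewrite !ltr_norml /= => /andP[q1 q2] /andP[p1 p2].
have gd w : in_rect (-1) 1 (-1) 1 w -> w != z -> cdiff g w.
  by move=> /fd fw wz; exact: cdiff_quot.
(* [rectint_bound] gives 4 (|l| + 1) (2 e + 2 e) on the small square, and [e < d0 / 2] keeps its
   boundary within d0 of z. *)
have key e : 0 < e -> e < d0 / 2 -> p - e > -1 -> p + e < 1 -> q - e > -1 -> q + e < 1 ->
    cmod (rint_sq g) <= 16 * (cmod l + 1) * e.
  move=> e0 ed e1 e2 e3 e4.
  have [-> bc] : rint_sq g = rectint g (p - e) (p + e) (q - e) (q + e) /\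
      bdry_cont g (p - e) (p + e) (q - e) (q + e).
    by apply: (rectint_shrink (z := z)) => //; rewrite -?/p -?/q; clear -e0 e1 e2 e3 e4; lra.
  clear gd.
  apply: le_trans (rectint_bound (M := cmod l + 1) _ _ bc _) _; try lra.
  move=> w wb; apply: gM.
    apply/eqP => wE; case: wb; rewrite wE -/p -/q /=.
      by move=> [_ /orP[/eqP E|/eqP E]]; lra.
    by move=> [/orP[/eqP E|/eqP E] _]; lra.
  have [||/andP[r1 r2] /andP[r3 r4]] := on_bdry_rect _ _ wb; try lra.
  apply: le_lt_trans (cmod_le_ReIm _) _; rewrite !raddfB/= -/p -/q.
  apply: le_lt_trans (_ : e + e < _); last lra.
  by rewrite lerD// ler_norml; lra.
apply/eqP; rewrite -cmod_eq0 eq_le cmod_ge0 andbT leNgt; apply/negP => r0.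
set r := cmod _ in r0 key.
have M0 : 0 < 16 * (cmod l + 1) by rewrite mulr_gt0// ltr_wpDl ?cmod_ge0.
pose e := Num.min (Num.min (d0 / 4) (r / (16 * (cmod l + 1)) / 2))
   (Num.min (Num.min ((p + 1) / 2) ((1 - p) / 2)) (Num.min ((q + 1) / 2) ((1 - q) / 2))).
have /and3P[/andP[e1 e2] /andP[e3 e4] /andP[e5 e6]] :
   [&& (e <= d0 / 4) && (e <= r / (16 * (cmod l + 1)) / 2),
       (e <= (p + 1) / 2) && (e <= (1 - p) / 2) & (e <= (q + 1) / 2) && (e <= (1 - q) / 2)].
  by rewrite -!le_min.
have e0 : 0 < e.
  by rewrite !lt_min; repeat (apply/andP; split); try lra; rewrite !divr_gt0.
have := key e e0; rewrite leNgt.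
have : 16 * (cmod l + 1) * e < r.
  apply: le_lt_trans (ler_wpM2l (ltW M0) e2) _.
  have -> : 16 * (cmod l + 1) * (r / (16 * (cmod l + 1)) / 2) = r / 2.
    by move: M0; set K := 16 * _ => M0; field; rewrite gt_eqF.
  lra.
by move=> -> /=; lra.
Qed.

Lemma rect_bounded f a b c d : a <= b -> c <= d ->
  (forall w, in_rect a b c d w -> ccont f w) ->
  exists M : R, forall w, in_rect a b c d w -> cmod (f w) <= M.
Proof.
move=> ab cd fc.
pose P a b c d := exists M : R, forall w, in_rect a b c d w -> cmod (f w) <= M.
apply: (@rect_bisection _ P) => //.
  move=> a' b' c' d' ab' cd' p q [M1 H1] [M2 H2] [M3 H3] [M4 H4].
  exists (Num.max (Num.max M1 M2) (Num.max M3 M4)) => w [/andP[r1 r2] /andP[r3 r4]].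
  rewrite !le_max.
  have [h1|h1] := leP (complex.Re w) p; have [h2|h2] := leP (complex.Im w) q.
  - by rewrite H1//; split; apply/andP.
  - by rewrite H3 ?orbT//; split; apply/andP; split=> //; exact: ltW.
  - by rewrite H2 ?orbT//; split; apply/andP; split=> //; exact: ltW.
  - by rewrite H4 ?orbT//; split; apply/andP; split=> //; exact: ltW.
move=> z zr; have [d0 d00 H] := ccontP (fc _ zr) ltr01.
exists (d0 / 2); first by rewrite divr_gt0.
move=> a' b' c' d' _ _ _ _ _ _ [/andP[s1 s2] /andP[s3 s4]] w1 w2.
exists (cmod (f z) + 1) => w [/andP[r1 r2] /andP[r3 r4]].
have wz : cmod (w - z) < d0.
  apply: le_lt_trans (cmod_le_ReIm _) _; rewrite !raddfB/=.
  apply: le_lt_trans (_ : (b' - a') + (d' - c') < _); last lra.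
  by rewrite lerD// ler_norml; lra.
have -> : f w = f z + (f w - f z) by ring.
by rewrite (le_trans (cmodD _ _))// lerD2l ltW// H.
Qed.

Lemma bdry_ge1 w : on_bdry (-1) 1 (-1) 1 w -> 1 <= cmod w.
Proof.
by case=> [[_ /orP[]/eqP E]|[/orP[]/eqP E _]];
  [apply: le_trans (Im_le_cmod w)|apply: le_trans (Im_le_cmod w)
  |apply: le_trans (Re_le_cmod w)|apply: le_trans (Re_le_cmod w)];
  rewrite E ?normrN normr1.
Qed.

Lemma bdry_subr_neq0 z w : cmod z < 1 -> on_bdry (-1) 1 (-1) 1 w -> w - z != 0.
Proof.
move=> z1 /bdry_ge1 w1; rewrite subr_eq0; apply/eqP => wz.
by move: z1; rewrite ltNge -wz w1.
Qed.

Lemma bdry_neq0 w : on_bdry (-1) 1 (-1) 1 w -> w != 0.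
Proof. by move=> /bdry_ge1 w1; rewrite -cmod_gt0 (lt_le_trans _ w1). Qed.

(* The imaginary part of the integrand along each side has a positive lower bound,
   so that the winding number need not be computed. *)
Lemma winding_neq0 z : cmod z < 1 -> rint_sq (fun w => (w - z)^-1) != 0.
Proof.
move=> z1; set g := fun w => _.
have N1 : (-1 : R) <= 1 by lra.
have gc : bdry_cont g (-1) 1 (-1) 1.
  move=> w wb; apply: ccontV; first exact: bdry_subr_neq0.
  by apply: ccontD; [exact: cvg_id|exact: ccont_cst].
have [g1 g2 g3 g4] := bdry_ccont N1 N1 gc.
suff: 0 < complex.Im (rint_sq g) by apply: contraTneq => ->; rewrite ltxx.
rewrite /rectint.
have := le_lt_trans (Re_le_cmod z) z1; have := le_lt_trans (Im_le_cmod z) z1.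
rewrite !ltr_norml => /andP[q1 q2] /andP[p1 p2].
(* Both coordinates of w - z are at most 2 in absolute value, so |w - z|^2 <= 8. *)
have inv_lb (u v : R) : 0 < v -> v <= 2 -> `|u| <= 2 -> v / 8 <= v / (u ^+ 2 + v ^+ 2).
  move=> v0 v2 u2; have s0 : 0 < u ^+ 2 + v ^+ 2 by rewrite ltr_wpDl ?sqr_ge0 ?exprn_gt0.
  rewrite ler_pM2l// lef_pV2 ?posrE//.
  by move: u2; rewrite ler_norml => /andP[? ?]; nra.
have E (w : C) : complex.Re w^-1 = complex.Re w / (complex.Re w ^+ 2 + complex.Im w ^+ 2) /\
    complex.Im w^-1 = - (complex.Im w / (complex.Re w ^+ 2 + complex.Im w ^+ 2)) by case: w.
have lb (h : R -> C) (k : C) (v : R) : ccont_on h (-1) 1 -> 0 < v -> v <= 2 -> (k = 1 \/ k = -1 \/ k = 'i%C \/ k = - 'i%C) ->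
   (forall x : R, -1 <= x <= 1 -> exists2 u : R, `|u| <= 2 & complex.Im (k * h x) = v / (u ^+ 2 + v ^+ 2)) ->
   0 < complex.Im (k * cint h (-1) 1).
  move=> hc v0 v2 hk H; rewrite -cintZ//.
  have kc : ccont_on (fun x => k * h x) (-1) 1.
    by move=> x xb; apply: ccont_atZ; exact: hc.
  have kb x : -1 <= x <= 1 -> v / 8 <= complex.Im (k * h x).
    by move=> /H [u u2 ->]; exact: inv_lb.
  by apply: lt_le_trans (Im_cint_ge N1 kc kb); lra.
have bnd (x t : R) : -1 <= x <= 1 -> -1 < t -> t < 1 -> `|x - t| <= 2.
  by move=> /andP[? ?] ? ?; rewrite ler_norml; lra.
have -> : cint (fun x => g (hpt (-1) x)) (-1) 1 - cint (fun x => g (hpt 1 x)) (-1) 1 +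
    'i%C * (cint (fun y => g (vpt 1 y)) (-1) 1 - cint (fun y => g (vpt (-1) y)) (-1) 1)
  = (1 * cint (fun x => g (hpt (-1) x)) (-1) 1 + -1 * cint (fun x => g (hpt 1 x)) (-1) 1) +
    ('i%C * cint (fun y => g (vpt 1 y)) (-1) 1 + (- 'i%C) * cint (fun y => g (vpt (-1) y)) (-1) 1).
  by ring.
have ImD (u v : C) : complex.Im (u + v) = complex.Im u + complex.Im v by rewrite raddfD.
have RN (u : C) : complex.Im (- u) = - complex.Im u by rewrite raddfN.
have Ii (u : C) : complex.Im ('i%C * u) = complex.Re u by rewrite mulrC ImiRe.
rewrite !ImD; apply: addr_gt0; apply: addr_gt0.
- apply: (lb (fun x => g (hpt (-1) x)) 1 (1 + complex.Im z) g1); [lra|lra|by left|].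
  move=> x xb; exists (x - complex.Re z); first exact: bnd.
  rewrite mul1r /g (E _).2 raddfB raddfB /= -mulNr; congr (_ / _); first ring.
  by congr (_ + _); ring.
- apply: (lb (fun x => g (hpt 1 x)) (-1) (1 - complex.Im z) g2); [lra|lra|by right; left|].
  move=> x xb; exists (x - complex.Re z); first exact: bnd.
  by rewrite mulN1r RN /g (E _).2 raddfB raddfB /= opprK.
- apply: (lb (fun x => g (vpt 1 x)) 'i%C (1 - complex.Re z) g3); [lra|lra|by right; right; left|].
  move=> x xb; exists (x - complex.Im z); first exact: bnd.
  rewrite Ii /g (E _).1 raddfB raddfB /=; congr (_ / _).
  by rewrite addrC.
- apply: (lb (fun x => g (vpt (-1) x)) (- 'i%C) (1 + complex.Re z) g4); [lra|lra|by right; right; right|].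
  move=> x xb; exists (x - complex.Im z); first exact: bnd.
  rewrite mulNr RN Ii /g (E _).1 raddfB raddfB /= -mulNr; congr (_ / _); first ring.
  by rewrite addrC; congr (_ + _); ring.
Qed.

(* W z is the integral of dw / (w - z); nothing more than W z != 0 is needed. *)
Lemma cauchy_expansion f : (forall w, cmod w < 2 -> cdiff f w) ->
  exists (c : nat -> C) (W : C -> C) (M : R), forall z, cmod z < 1 ->
    W z != 0 /\ forall m, cmod (f z * W z - \sum_(k < m) c k * z ^+ k)
                        <= M / (1 - cmod z) * cmod z ^+ m.
Proof.
move=> fd.
(* The corners of the square are at distance sqrt 2 < 2 from 0. *)
have fdQ w : in_rect (-1) 1 (-1) 1 w -> cdiff f w.
  move=> [/andP[r1 r2] /andP[r3 r4]]; apply: fd.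
  rewrite -(@ltr_pXn2r _ 2)// ?nnegrE ?cmod_ge0// sqr_cmod; nra.
have N1 : (-1 : R) <= 1 by lra.
have [M0 fM] := rect_bounded N1 N1 (fun w wr => cdiff_cont (fdQ w wr)).
have fc : bdry_cont f (-1) 1 (-1) 1.
  by move=> w /(on_bdry_rect N1 N1) /fdQ /cdiff_cont.
have idc m : bdry_cont (fun w => (w ^+ m)^-1) (-1) 1 (-1) 1.
  move=> w wb; apply: ccontV; first by rewrite expf_neq0// bdry_neq0.
  by apply: ccontX; exact: cvg_id.
exists (fun k => rint_sq (fun w => f w * (w ^+ k.+1)^-1)).
exists (fun z => rint_sq (fun w => (w - z)^-1)), (16 * M0) => z z1.
split; first exact: winding_neq0.
have zc : bdry_cont (fun w => (w - z)^-1) (-1) 1 (-1) 1.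
  move=> w wb; apply: ccontV; first exact: bdry_subr_neq0.
  by apply: ccontD; [exact: cvg_id|exact: ccont_cst].
(* The remainder of order m: f(z) W(z) is the sum of c_k z^k over k < m plus z^m E(m), by iterating
   1 / (w - z) = 1 / w + z / (w (w - z)). *)
pose E m := rint_sq (fun w => f w * (w ^+ m)^-1 * (w - z)^-1).
have kc m : bdry_cont (fun w => f w * (w ^+ m)^-1) (-1) 1 (-1) 1.
  by move=> w wb; apply: ccontM; [exact: fc|exact: idc].
have Ec m : bdry_cont (fun w => f w * (w ^+ m)^-1 * (w - z)^-1) (-1) 1 (-1) 1.
  by move=> w wb; apply: ccontM; [exact: kc|exact: zc].
have E0 : f z * rint_sq (fun w => (w - z)^-1) = E 0%N.
  have := cauchy_quotient fdQ z1.
  rewrite (@eq_rectint _ _ (fun w => f w * (w ^+ 0)^-1 * (w - z)^-1 + (- f z) * (w - z)^-1))//.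
    rewrite (rectintD N1 N1 (Ec 0%N)); last first.
      by move=> w wb; apply: ccontM; [exact: ccont_cst|exact: zc].
    rewrite (rectintZ (- f z) N1 N1 zc).
    by move=> /eqP; rewrite mulNr subr_eq0 eq_sym => /eqP.
  by move=> w _; rewrite expr0 invr1 mulr1 -mulrDl.
have ES m : E m = rint_sq (fun w => f w * (w ^+ m.+1)^-1) + z * E m.+1.
  have zE : bdry_cont (fun w => z * (f w * (w ^+ m.+1)^-1 * (w - z)^-1)) (-1) 1 (-1) 1.
    by move=> w wb; apply: ccontM; [exact: ccont_cst|exact: Ec].
  rewrite /E -(rectintZ z N1 N1 (Ec m.+1)) -(rectintD N1 N1 (kc m.+1) zE).
  apply: eq_rectint => // w wb.
  have w0 := bdry_neq0 wb; have wz := bdry_subr_neq0 z1 wb.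
  by rewrite exprS; field; rewrite w0 wz expf_neq0.
move=> m; rewrite E0.
pose c k := rint_sq (fun w => f w * (w ^+ k.+1)^-1).
have {}ES k : E k = c k + z * E k.+1 by exact: ES.
rewrite [X in _ - X](_ : _ = \sum_(k < m) c k * z ^+ k)//.
have -> : E 0%N = \sum_(k < m) c k * z ^+ k + z ^+ m * E m.
  elim: m => [|m ->]; first by rewrite big_ord0 add0r mul1r.
  by rewrite big_ord_recr /= [E m]ES exprSr; ring.
rewrite addrC addKr cmodM cmodX mulrC ler_wpM2r ?exprn_ge0 ?cmod_ge0//.
have z1' : 0 < 1 - cmod z by rewrite subr_gt0.
apply: le_trans (rectint_bound (M := M0 / (1 - cmod z)) N1 N1 (Ec m) _) _; last first.
  by rewrite le_eqVlt; apply/orP; left; apply/eqP; field; rewrite gt_eqF.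
move=> w wb; have w1 := bdry_ge1 wb.
have {}fM := fM _ (on_bdry_rect N1 N1 wb).
rewrite !cmodM !cmodV cmodX.
have wz : 1 - cmod z <= cmod (w - z).
  by rewrite -(cmodN z); apply: le_trans (cmod_lbD _ _); rewrite cmodN lerB.
have h1 : (cmod w ^+ m)^-1 <= 1 by rewrite invf_le1 ?exprn_ege1// (lt_le_trans ltr01)// exprn_ege1.
have h2 : (cmod (w - z))^-1 <= (1 - cmod z)^-1 by rewrite lef_pV2// posrE// (lt_le_trans z1').
rewrite ler_pM// ?mulr_ge0 ?invr_ge0 ?exprn_ge0 ?cmod_ge0//.
rewrite -[M0]mulr1 ler_pM ?invr_ge0 ?exprn_ge0 ?cmod_ge0//.
Qed.

(** If all c_k vanish, the remainder tends to 0 and f W = 0 with W nonzero. Otherwise let c_k be the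
    first nonzero coefficient: at a zero z other than 0, the estimate of order k + 1 gives |c_k| <=
    M |z| / (1 - |z|), which fails for small z. *)
Lemma power_expansion_vanish f : (forall w, cmod w < 2 -> cdiff f w) ->
  (forall z, cmod z <= 2^-1 -> f z = 0) \/
  (exists2 e : R, 0 < e & forall z, z != 0 -> cmod z < e -> f z != 0).
Proof.
move=> /cauchy_expansion[c [W [M H]]].
have [c0|/existsNP[k0 /eqP c0]] := pselect (forall k, c k = 0).
  left=> z z2; have z1 : cmod z < 1 by rewrite (le_lt_trans z2)// invf_lt1// ltr1n.
  have [W0 Hz] := H z z1.
  have {}Hz m : cmod (f z * W z) <= M / (1 - cmod z) * cmod z ^+ m.
    by have := Hz m; rewrite big1 ?subr0// => i _; rewrite c0 mul0r.
  apply/eqP; rewrite -(mulIr_eq0 _ (mulIf W0)) -cmod_eq0 eq_le cmod_ge0 andbT leNgt.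
  apply/negP => r0; set r := cmod _ in r0 Hz.
  have K0 : 0 <= M / (1 - cmod z) by have := Hz 0%N; rewrite expr0 mulr1; apply: le_trans; exact: ltW.
  have [m mr] := half_pow_lt K0 r0.
  move: mr; rewrite ltNge => /negP; apply; apply: le_trans (Hz m) _.
  by rewrite -exprVn ler_wpM2l// lerXn2r ?nnegrE ?cmod_ge0 ?invr_ge0.
right.
have ex : exists k, c k != 0 by exists k0.
case: (ex_minnP ex) => k ck kmin.
have ck0 : 0 < cmod (c k) by rewrite cmod_gt0.
have M0 : 0 < 2 * `|M| + 1 by rewrite ltr_wpDl// mulr_ge0.
exists (Num.min 2^-1 (cmod (c k) / (2 * `|M| + 1))); first by rewrite lt_min invr_gt0 ltr0n divr_gt0.
move=> z z0; rewrite lt_min => /andP[z2]; rewrite ltr_pdivlMr// => zc.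
have zp : 0 < cmod z by rewrite cmod_gt0.
have z1 : cmod z < 1 by rewrite (lt_trans z2)// invf_lt1// ltr1n.
have [W0 Hz] := H z z1.
apply/eqP => fz0; have := Hz k.+1; rewrite fz0 mul0r sub0r cmodN big_ord_recr /= big1 ?add0r; last first.
  move=> i _; have [->|] := eqVneq (c i) 0; first by rewrite mul0r.
  by move=> /kmin; rewrite leqNgt ltn_ord.
rewrite cmodM cmodX exprS mulrA ler_pM2r ?exprn_gt0// leNgt => /negP; apply.
apply: le_lt_trans zc; rewrite mulrC ler_pM2l//.
rewrite ler_pdivrMr ?subr_gt0//.
have := ler_norm M; have : 0 <= `|M| by [].
have : cmod z * 2 <= 1 by rewrite -ler_pdivlMr// mul1r ltW.
nra.
Qed.

End Cauchy.

(** * Holomorphic functions on a normed module *)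

Section RealNorm.
Context {R : realType} {V : normedModType R[i]}.
Local Notation C := R[i].
Implicit Types (x y v : V) (D A : set V).

(** The norm itself takes values in C; a real-valued one suits real estimates and their decision
    procedures. *)
Definition rnorm v : R := complex.Re `|v|.

Lemma rnormE v : `|v| = (rnorm v)%:C%C.
Proof. by rewrite RRe_real// ger0_real. Qed.

Lemma rnormZ (t : C) v : rnorm (t *: v) = cmod t * rnorm v.
Proof. by apply: (@complexI R); rewrite -rnormE normrZ rnormE normE rmorphM. Qed.

Lemma rnormD v w : rnorm (v + w) <= rnorm v + rnorm w.
Proof. by rewrite -lecR rmorphD/= -!rnormE ler_normD. Qed.

Lemma rnormB v w : rnorm (v - w) = rnorm (w - v).
Proof. by rewrite /rnorm distrC. Qed.

Lemma rnorm_ge0 v : 0 <= rnorm v.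
Proof. by rewrite -lecR -rnormE normr_ge0. Qed.

Lemma nbhs_rnormP x (P : set V) :
  nbhs x P <-> exists2 r : R, 0 < r & forall y, rnorm (y - x) < r -> P y.
Proof.
split=> [/nbhs_ballP[e /= e0 eP]|[r r0 rP]].
  have eE : e = (complex.Re e)%:C%C by rewrite RRe_real// ger0_real// ltW.
  exists (complex.Re e) => [|y yr]; first by rewrite -ltcR -eE.
  by apply: eP; rewrite -ball_normE /= eE distrC rnormE ltcR.
apply/nbhs_ballP; exists r%:C%C; first by rewrite /= ltcR.
by move=> y; rewrite -ball_normE /= distrC rnormE ltcR; exact: rP.
Qed.

Lemma near_ball_rnorm (a b : V) (r : R) : rnorm (b - a) < r -> \forall y \near b, rnorm (y - a) < r.
Proof.
move=> br; apply/nbhs_rnormP; exists (r - rnorm (b - a)); first by rewrite subr_gt0.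
move=> y yb; rewrite (_ : y - a = (y - b) + (b - a)); last by rewrite addrA subrK.
by rewrite (le_lt_trans (rnormD _ _))// -ltrBrDr.
Qed.

End RealNorm.

Section Holomorphic.
Context {R : realType} {V : normedModType R[i]}.
Local Notation C := R[i].
Implicit Types (f g h : V -> C) (x y v a : V) (D A : set V).

Lemma holomorphic_atP f a : holomorphic_at f a -> exists2 r : R, 0 < r &
  forall y, rnorm (y - a) < r -> differentiable (f : V -> C^o) y.
Proof. by move=> /nbhs_rnormP. Qed.

Lemma holomorphic_cont f a : holomorphic_at f a -> {for a, continuous (f : V -> C^o)}.
Proof. by move=> /nbhs_singleton; exact: differentiable_continuous. Qed.

Lemma near_neq0 f a : {for a, continuous (f : V -> C^o)} -> f a != 0 ->
  \forall x \near a, f x != 0.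
Proof.
move=> /cvgrPdist_lt fa fa0; have fp : 0 < `|f a| by rewrite normr_gt0.
by apply: filterS (fa _ fp) => x; apply: contraTneq => ->; rewrite subr0 ltxx.
Qed.

Lemma near_continuous f g a : (\forall x \near a, g x = f x) ->
  {for a, continuous (g : V -> C^o)} -> {for a, continuous (f : V -> C^o)}.
Proof.
move=> gf /cvgrPdist_lt ga; apply/cvgrPdist_lt => e e0.
by rewrite -(nbhs_singleton gf); apply: filterS2 gf (ga e e0) => x ->.
Qed.

Lemma holomorphic_cst (c : C) a : holomorphic_at (fun=> c) a.
Proof. by apply: nearW => x; exact: differentiable_cst. Qed.

Lemma holomorphicM f g a : holomorphic_at f a -> holomorphic_at g a ->
  holomorphic_at (fun x => f x * g x) a.
Proof.
move=> fa ga; apply: filterS2 fa ga => x fx gx.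
exact: (@differentiableM _ _ (f : V -> C^o) g).
Qed.

Lemma holomorphicD f g a : holomorphic_at f a -> holomorphic_at g a ->
  holomorphic_at (fun x => f x + g x) a.
Proof.
move=> fa ga; apply: filterS2 fa ga => x fx gx.
exact: (@differentiableD _ _ _ (f : V -> C^o) g).
Qed.

Lemma holomorphicV f a : holomorphic_at f a -> f a != 0 ->
  holomorphic_at (fun x => (f x)^-1) a.
Proof.
move=> fa fa0.
have fn : \forall x \near a, f x != 0.
  by apply: near_neq0 => //; exact: holomorphic_cont.
apply: filterS2 fa fn => x fx f0.
exact: (@differentiableV _ _ (f : V -> C^o)).
Qed.

Lemma holomorphic_comp {W : normedModType C} (p : V -> W) (f : W -> C) a :
  (\forall x \near a, differentiable p x) -> holomorphic_at f (p a) ->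
  holomorphic_at (f \o p) a.
Proof.
move=> pa fpa; have pc : {for a, continuous p}.
  by apply: differentiable_continuous; exact: nbhs_singleton pa.
apply: filterS2 pa (pc _ fpa) => x px fx.
exact: (@differentiable_comp _ _ _ _ p (f : W -> C^o)).
Qed.

(** On the complex line from b to y, f becomes a function g of one variable that vanishes near 0,
    hence on |t| <= 1/2; the line is parametrised so that y is t = 1/2. The radius does not depend
    on b: this uniformity is what the connectedness argument needs. *)
Lemma holomorphic_vanish f x : holomorphic_at f x -> exists2 r : R, 0 < r &
  forall b, rnorm (b - x) < r -> (\forall y \near b, f y = 0) ->
  forall y, rnorm (y - x) < r -> f y = 0.
Proof.
(* With 1/16, the vector 2 (y - b) has norm below r / 4, so the points of the line with |t| < 2 stay
   within r / 16 + r / 2 of x. *)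
move=> /holomorphic_atP[r r0 fd]; exists (r / 16); first by rewrite divr_gt0.
move=> b br /nbhs_rnormP[e e0 fe] y yr.
pose g (t : C) := f (b + t *: (2 *: (y - b))).
have yb : rnorm (2 *: (y - b)) < r / 4.
  rewrite rnormZ (_ : y - b = (y - x) + (x - b)); last by rewrite addrA subrK.
  have -> : cmod (2 : C) = 2.
    by rewrite -(rmorph_nat (real_complex R) 2) cmodR ger0_norm.
  have := rnormD (y - x) (x - b); rewrite (rnormB x b); lra.
have gd t : cmod t < 2 -> cdiff g t.
  move=> t2; apply: (@differentiable_comp _ C^o _ _ (fun t : C^o => b + t *: (2 *: (y - b))) (f : V -> C^o)).
    by apply: differentiableD => //; apply: differentiableZl.
  apply: fd; rewrite addrAC (le_lt_trans (rnormD _ _))// (rnormZ t).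
  have := rnorm_ge0 (2 *: (y - b)); have := cmod_ge0 t; nra.
have [g0|[d d0 gn]] := power_expansion_vanish gd.
  have := g0 2^-1; rewrite /g scalerA mulVf ?pnatr_eq0// scale1r addrC subrK; apply.
  by rewrite -(rmorph_nat (real_complex R) 2) -fmorphV cmodR ger0_norm ?invr_ge0.
(* A nonzero parameter below d whose point is within e of b, where f vanishes, against the second
   alternative. *)
pose s := Num.min (d / 2) (e / r).
have s0 : 0 < s by rewrite lt_min !divr_gt0.
have := gn (s%:C%C); rewrite cmodR gtr0_norm// => /(_ _ _)/eqP H; exfalso; apply: H.
- by rewrite -cmod_gt0 cmodR gtr0_norm.
- have : s <= d / 2 by rewrite ge_min lexx.
  lra.
rewrite /g; apply: fe; rewrite addrC addKr rnormZ cmodR gtr0_norm//.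
have /= : s * rnorm (2 *: (y - b)) <= e / r * (r / 4).
  by rewrite ler_pM ?(ltW s0) ?rnorm_ge0 ?(ltW yb)// ge_min lexx orbT.
move=> /le_lt_trans; apply; rewrite -mulrA (mulrA r^-1) mulVf ?gt_eqF// mul1r; lra.
Qed.

(** Germs of holomorphic functions form an integral domain, so products of denominators are again
    denominators. If f is nonzero at some b close to a, then g vanishes near b, and near a by the
    uniform radius of [holomorphic_vanish]. *)
Lemma holomorphic_domain f g a : holomorphic_at f a -> holomorphic_at g a ->
  (\forall x \near a, f x * g x = 0) ->
  (\forall x \near a, f x = 0) \/ (\forall x \near a, g x = 0).
Proof.
move=> fa ga /nbhs_rnormP[e e0 fg0].
have [r r0 gv] := holomorphic_vanish ga.
have [d d0 fd] := holomorphic_atP fa.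
pose s := Num.min e (Num.min r d).
have s0 : 0 < s by rewrite !lt_min e0 r0.
have [f0|/existsNP[b /not_implyP[br /eqP fb]]] := pselect (forall b, rnorm (b - a) < s -> f b = 0).
  by left; apply/nbhs_rnormP; exists s.
right; move: br; rewrite !lt_min => /and3P[be brr bd].
apply/nbhs_rnormP; exists r => //; apply: (gv b) => //.
have fc : {for b, continuous (f : V -> C^o)} by apply: differentiable_continuous; exact: fd.
have fn : \forall x \near b, f x != 0.
  exact: near_neq0.
have eb : \forall x \near b, f x * g x = 0.
  by apply: filterS (near_ball_rnorm be) => y /fg0.
apply: filterS2 fn eb => y fy /eqP; rewrite mulf_eq0 (negbTE fy) /=; exact/eqP.
Qed.

End Holomorphic.

(** * Analytic subsets and generic points *)

Lemma exists_notin {T : Type} (D A : set T) : A `<=` D -> A <> D -> exists2 x, D x & ~ A x.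
Proof.
move=> AD nA; apply: contrapT => H; apply: nA; apply/seteqP; split=> // x Dx.
by apply: contrapT => nAx; apply: H; exists x.
Qed.

Section Generic.
Context {R : realType} {V : normedModType R[i]}.
Local Notation C := R[i].
Implicit Types (f g h : V -> C) (x y v a : V) (D A B : set V) (P Q : V -> Prop).

Lemma analytic_closed D A x : analytic_subset D A -> D x ->
  (forall U, nbhs x U -> exists2 y, U y & A y) -> A x.
Proof.
move=> [_ /(_ x) AD] Dx cl; have [k [F [Fh FA]]] := AD Dx.
apply/(nbhs_singleton FA) => i; apply: contrapT => /eqP Fx.
have fn : \forall y \near x, F i y != 0.
  by apply: near_neq0 => //; exact: holomorphic_cont.
have [y [yn [H _]] Ay] := cl _ (filterI fn FA).
by have /eqP := H Ay i; rewrite (negbTE yn).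
Qed.

(* The closure in D of the interior of A adds nothing to it, by the identity theorem. *)
Lemma analytic_interior D A : connected D -> open D ->
  analytic_subset D A -> A <> D -> forall x, D x -> ~ (\forall y \near x, A y).
Proof.
move=> cD oD [AD anA] nAD x Dx Ax; apply: nAD; apply/seteqP; split => // y Dy.
have key : D `&` closure (interior A) `<=` interior A.
  move=> z [Dz clz]; have [k [F [Fh FA]]] := anA _ Dz.
  have Fv i := holomorphic_vanish (Fh i).
  have [r r0 rP] : exists2 r : R, 0 < r & forall i b, rnorm (b - z) < r ->
      (\forall y \near b, F i y = 0) -> forall y, rnorm (y - z) < r -> F i y = 0.
    have /choice[rr rrP] : forall i, exists r : R, 0 < r /\ forall b, rnorm (b - z) < r ->
      (\forall y \near b, F i y = 0) -> forall y, rnorm (y - z) < r -> F i y = 0.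
      by move=> i; have [r r0 H] := Fv i; exists r.
    (* The minimum over the finitely many equations; the initial value 1 covers the case of none. *)
    exists (\big[Num.min/1]_i rr i).
      apply: (big_ind (fun r : R => 0 < r)) => [|u v u0 v0|i _]; first exact: ltr01.
        by rewrite lt_min u0.
      by have [] := rrP i.
    move=> i b br bv u ur; have [_ H] := rrP i; apply: (H b) => //.
      by rewrite (lt_le_trans br)// bigmin_le_cond.
    by rewrite (lt_le_trans ur)// bigmin_le_cond.
  have /nbhs_rnormP[e e0 eP] := FA.
  pose s := Num.min e r; have s0 : 0 < s by rewrite lt_min e0.
  have /clz[b [bA bs]] : nbhs z [set y | rnorm (y - z) < s].
    by apply/nbhs_rnormP; exists s.
  move: (bs) => /=; rewrite lt_min => /andP[be br].
  apply/nbhs_rnormP; exists s => // u; rewrite lt_min => /andP[ue ur].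
  apply/(eP _ ue) => i; apply: (rP i b) => //.
  have eb : \forall y \near b, A y <-> forall i, F i y = 0.
    by apply: filterS (near_ball_rnorm be) => t /eP.
  by apply: filterS2 eb bA => t [h _] /h.
have E : D `&` interior A = D.
  apply: cD; first by exists x.
    by exists (interior A) => //; exact: open_interior.
  exists (closure (interior A)); first exact: closed_closure.
  apply/seteqP; split => z [Dz Az]; split => //; first exact: subset_closure.
  exact: key.
have : (D `&` interior A) y by rewrite E.
by move=> [_ /nbhs_singleton].
Qed.

(** The empty set has no proper subset, so nothing would be generic in it; nonemptiness makes true
    statements generic. *)
Record domain D : Prop := Domain {
  domain_open : open D; domain_connected : connected D; domain_nonempty : exists x, D x }.

Lemma analyticU D A B : analytic_subset D A -> analytic_subset D B ->
  analytic_subset D (A `|` B).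
Proof.
move=> [AD anA] [BD anB]; split; first by move=> x [/AD|/BD].
move=> a Da; have [k [F [Fh FA]]] := anA _ Da; have [l [G [Gh GB]]] := anB _ Da.
exists #|{: 'I_k * 'I_l}|, (fun i x => F (enum_val i).1 x * G (enum_val i).2 x).
split=> [i|]; first exact: holomorphicM.
apply: filterS2 FA GB => x Fx Gx; split.
  by move=> [/Fx F0|/Gx G0] i; [rewrite F0 mul0r|rewrite G0 mulr0].
move=> FG; have [F0|/existsNP[i /eqP Fi]] := pselect (forall i, F i x = 0).
  by left; apply/Fx.
right; apply/Gx => j; have := FG (enum_rank (i, j)); rewrite enum_rankK /= => /eqP.
by rewrite mulf_eq0 (negbTE Fi) => /eqP.
Qed.

(** If the union were D, a point of D with a neighbourhood missing B would be interior to A, which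
    has no interior. So B is dense in D, and equal to D since it is closed there. *)
Lemma analyticU_proper D A B : domain D -> analytic_subset D A -> analytic_subset D B ->
  A <> D -> B <> D -> A `|` B <> D.
Proof.
move=> [oD cD _] anA anB nA nB ABD; apply: nB; apply/seteqP; split; first exact: anB.1.
move=> x Dx; apply: (analytic_closed anB Dx) => U Ux.
apply: contrapT => nUB; apply: (analytic_interior cD oD anA nA Dx).
have Dn : \forall y \near x, D y by exact: open_nbhs_nbhs.
apply: filterS2 Ux Dn => y Uy; rewrite -{1}ABD => -[//|By].
by exfalso; apply: nUB; exists y.
Qed.

Lemma genericI D P Q : domain D -> generically D P -> generically D Q ->
  generically D (fun x => P x /\ Q x).
Proof.
move=> dD [A [anA nA AP]] [B [anB nB BQ]]; exists (A `|` B); split.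
- exact: analyticU.
- exact: analyticU_proper.
- by move=> x Dx nAB; split; [apply: AP|apply: BQ] => // ?; apply: nAB; [left|right].
Qed.

Lemma genericS D P Q : (forall x, D x -> P x -> Q x) -> generically D P -> generically D Q.
Proof. by move=> PQ [A [anA nA AP]]; exists A; split => // x Dx /AP; move=> /(_ Dx); exact: PQ. Qed.

Lemma genericW D P : domain D -> (forall x, D x -> P x) -> generically D P.
Proof.
move=> [_ _ [x0 Dx0]] DP; exists set0; split; last by move=> x /DP.
  split=> // a Da; exists 1%N, (fun _ _ => 1); split; first by move=> _; exact: holomorphic_cst.
  by apply: nearW => x; split=> // /(_ ord0)/eqP; rewrite oner_eq0.
by move=> E; have := Dx0; rewrite -E.
Qed.

Lemma generic_all D (I : finType) (Q : I -> V -> Prop) : domain D ->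
  (forall i, generically D (Q i)) -> generically D (fun x => forall i, Q i x).
Proof.
move=> dD QD; have : generically D (fun x => forall i, i \in enum I -> Q i x).
  elim: (enum I) => [|i s IH]; first exact: genericW.
  apply: genericS (genericI dD (QD i) IH) => x _ [Qi Qs] j; rewrite inE => /predU1P[->//|].
  exact: Qs.
by apply: genericS => x _ H i; apply: H; rewrite mem_enum.
Qed.

Lemma generic_false D : domain D -> ~ generically D (fun=> False).
Proof.
move=> [_ _ _] [A [[AD _] nA H]]; apply: nA; apply/seteqP; split => // x Dx.
by apply: contrapT => /(H _ Dx).
Qed.

Lemma generic_dense D P x U : domain D -> generically D P -> D x -> nbhs x U ->
  exists y, [/\ D y, U y & P y].
Proof.
move=> [oD cD _] [A [anA nA H]] Dx Ux; apply: contrapT => nex.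
apply: (analytic_interior cD oD anA nA Dx).
have Dn : \forall y \near x, D y by exact: open_nbhs_nbhs.
apply: filterS2 Ux Dn => y Uy Dy; apply: contrapT => /(H _ Dy) Py.
by apply: nex; exists y.
Qed.

End Generic.

Section Pullback.
Context {R : realType} {V W : normedModType R[i]}.
Local Notation C := R[i].

(** The last hypothesis takes the place of surjectivity, which implies it: the inclusion of C^x in C
    is not onto but satisfies it. *)
Lemma generic_pullback (D : set V) (E : set W) (p : V -> W) (P : W -> Prop) :
  open D -> (forall x, D x -> E (p x)) ->
  (forall x, D x -> \forall y \near x, differentiable p y) ->
  (forall A, analytic_subset E A -> A <> E -> exists2 x, D x & ~ A (p x)) ->
  generically E P -> generically D (fun x => P (p x)).
Proof.
move=> oD DE pd nE [A [anA nA AP]].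
exists (D `&` p @^-1` A); split; last first.
- by move=> x Dx nAx; apply: AP; [exact: DE|move=> Ax; apply: nAx].
- by have [x Dx nAx] := nE _ anA nA => DA; move: (Dx); rewrite -DA => -[].
split; first by move=> x [].
move=> a Da; have [k [F [Fh FA]]] := anA.2 _ (DE _ Da).
exists k, (fun i => F i \o p); split; first by move=> i; apply: holomorphic_comp (Fh i); exact: pd.
have pc : {for a, continuous p}.
  by apply: differentiable_continuous; exact: nbhs_singleton (pd _ Da).
have Dn : \forall y \near a, D y by exact: open_nbhs_nbhs.
apply: filterS2 Dn (pc _ FA) => x Dx [Fx1 Fx2]; split; first by move=> [_ /Fx1].
by move=> /Fx2.
Qed.

End Pullback.

(** * Isolated zeros and meromorphic functions of one variable *)

Section OneVariable.
Context {R : realType}.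
Local Notation C := R[i].
Implicit Types (f g h : C^o -> C) (a z : C^o) (D : set C^o) (P : C^o -> Prop).

Lemma rnorm_cmod (z : C^o) : rnorm z = cmod z. Proof. by []. Qed.

Lemma dnbhs_cmodP a P : (\forall z \near a^', P z) <->
  exists2 r : R, 0 < r & forall z, z != a -> cmod (z - a) < r -> P z.
Proof.
rewrite near_withinE; split=> [/nbhs_rnormP[r r0 H]|[r r0 H]].
  by exists r => // z za zr; apply: H.
by apply/nbhs_rnormP; exists r => // z zr za; apply: H.
Qed.

Lemma near_punctured a z (r : R) : z != a -> cmod (z - a) < r ->
  \forall x \near z, x != a /\ cmod (x - a) < r.
Proof.
move=> za zr; have H := near_ball_rnorm (zr : rnorm (z - a : C^o) < r).
have H' : \forall x \near z, x != a.
  apply/nbhs_rnormP; exists (cmod (z - a)); first by rewrite cmod_gt0 subr_eq0.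
  by move=> x; apply: contraTneq => ->; rewrite rnorm_cmod cmod_distC ltxx.
exact: filterI H' H.
Qed.

Lemma isolated_zeros f a : holomorphic_at f a ->
  (\forall z \near a, f z = 0) \/ (\forall z \near a^', f z != 0).
Proof.
move=> /holomorphic_atP[r r0 fd].
(* Rescales the disc of radius r around a to the disc of radius 2. *)
pose s : C := (r / 2)%:C%C.
have sE : cmod s = r / 2 by rewrite cmodR gtr0_norm ?divr_gt0.
have s0 : s != 0 by rewrite -cmod_gt0 sE divr_gt0.
pose g (t : C) := f (a + s * t).
have gd t : cmod t < 2 -> cdiff g t.
  move=> t2; apply: (@differentiable_comp _ C^o C^o C^o (fun t : C^o => a + s *: t : C^o) f).
    by apply: differentiableD => //; apply: differentiableZ.
  apply: fd; rewrite addrAC subrr add0r rnorm_cmod cmodM sE.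
  have := cmod_ge0 t; nra.
have E z : z = a + s * (s^-1 * (z - a)) :> C by rewrite mulVKf// addrC subrK.
have E2 z : cmod (s^-1 * (z - a)) = cmod (z - a) * 2 / r.
  by rewrite cmodM cmodV sE; field; rewrite gt_eqF.
have [g0|[d d0 gn]] := power_expansion_vanish gd.
  left; apply/nbhs_rnormP; exists (r / 4); first by rewrite divr_gt0.
  move=> z; rewrite rnorm_cmod => zr; rewrite [z]E; apply: g0.
  by rewrite E2 ler_pdivrMr//; lra.
right; apply/dnbhs_cmodP; exists (d * r / 2); first by rewrite divr_gt0 ?mulr_gt0.
move=> z za zr; rewrite [z]E; apply: gn.
  by rewrite mulf_neq0 ?invr_eq0// subr_eq0.
by rewrite E2 ltr_pdivrMr//; lra.
Qed.

Lemma holomorphic_id a : holomorphic_at (fun z : C^o => z : C) a.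
Proof. by rewrite /holomorphic_at; near=> x; exact: ex_diff.
Unshelve. all: by end_near. Qed.

Lemma dnbhs_point a (U : set C^o) : (\forall z \near a^', U z) -> exists z, U z.
Proof.
move=> /dnbhs_cmodP[r r0 H]; exists (a + (r / 2)%:C%C); apply: H.
  by rewrite -subr_eq0 addrAC subrr add0r -cmod_gt0 cmodR gtr0_norm divr_gt0.
by rewrite addrAC subrr add0r cmodR gtr0_norm ?divr_gt0//; lra.
Qed.

(** The exceptional points do not accumulate in D, so their set is cut out by z - a near one of them
    and is locally empty elsewhere. *)
Lemma discrete_generic D P : domain D ->
  (forall a, D a -> \forall z \near a^', P z) -> generically D P.
Proof.
move=> [oD _ [x0 Dx0]] HP; exists [set x | D x /\ ~ P x]; split; last first.
- by move=> x Dx nA; apply: contrapT => nP; apply: nA.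
- move=> E; have Dn : \forall z \near x0^', D z.
    by apply: nbhs_dnbhs; exact: open_nbhs_nbhs.
  have [z [Pz Dz]] := dnbhs_point (filterI (HP _ Dx0) Dn).
  by move: Dz; rewrite -E => -[].
split=> [x []//|a Da].
have Dn : \forall z \near a, D z by exact: open_nbhs_nbhs.
have := HP _ Da; rewrite near_withinE => Pn.
have [Pa|nPa] := pselect (P a).
  exists 1%N, (fun _ _ => 1); split; first by move=> _; exact: holomorphic_cst.
  apply: filterS Pn => z Pz; split => [[_ nPz]|/(_ ord0)/eqP]; last by rewrite oner_eq0.
  exfalso; apply: nPz; have [->//|] := eqVneq z a; exact: Pz.
exists 1%N, (fun _ z => z - a); split.
  by move=> _; exact: holomorphicD (holomorphic_id _) (holomorphic_cst _ _).
apply: filterS2 Dn Pn => z Dz Pz; split => [[_ nPz] _|/(_ ord0) /eqP].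
  by apply/eqP; rewrite subr_eq0; apply: contrapT => /negP /Pz.
by rewrite subr_eq0 => /eqP ->.
Qed.

(** In one variable the zeros of the denominator are isolated, so the quotient represents f on a
    full punctured neighbourhood. *)
Lemma meromorphic_dnbhs f a : meromorphic_at f a -> exists g h,
  [/\ holomorphic_at g a, holomorphic_at h a, \forall z \near a^', h z != 0
    & \forall z \near a^', f z = g z / h z].
Proof.
move=> [g [h [ga ha h0 fgh]]]; exists g, h; split=> //.
  by have [//|] := isolated_zeros ha.
have [//|hn] := isolated_zeros ha.
by move: hn; apply: filterS2 (nbhs_dnbhs fgh) => z H /H.
Qed.

(** The value of f at a may be arbitrary, but f equals g / h around each nearby point other than a
    and is continuous there. *)
Lemma meromorphic_generic_cont D f : domain D -> meromorphic_on D f ->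
  generically D (fun z => {for z, continuous (f : C^o -> C^o)}).
Proof.
move=> dD fD; apply: discrete_generic => // a /fD /meromorphic_dnbhs[g [h [ga ha hn fgh]]].
have [r1 r10 gd] := holomorphic_atP ga; have [r2 r20 hd] := holomorphic_atP ha.
have /dnbhs_cmodP[r r0 H] : \forall z \near a^', h z != 0 /\ f z = g z / h z.
  exact: filterI.
apply/dnbhs_cmodP; exists (Num.min r (Num.min r1 r2)); first by rewrite !lt_min r0 r10.
move=> z za; rewrite !lt_min => /and3P[zr z1 z2].
have gz : {for z, continuous (g : C^o -> C^o)} by apply: differentiable_continuous; exact: gd.
have hz : {for z, continuous (h : C^o -> C^o)} by apply: differentiable_continuous; exact: hd.
have [hz0 fz] := H z za zr.
have qz : {for z, continuous (fun x : C^o => g x / h x : C^o)}.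
  exact: ccontM gz (ccontV hz0 hz).
have nz : \forall x \near z, g x / h x = f x.
  by apply: filterS (near_punctured za zr) => x [xa /(H x xa)[]].
exact: (@near_continuous _ C^o f (fun x => g x / h x)).
Qed.

(** Around each point, f vanishes on a punctured neighbourhood or is nonzero on one. The points of
    the first kind form an open and closed subset of D; by connectedness it is empty or everything.
    This strengthens the nonvanishing found in [propto_generically]. *)
Lemma meromorphic_generic_neq0 D f : domain D -> meromorphic_on D f ->
  ~ generically D (fun z => f z = 0) -> generically D (fun z => f z != 0).
Proof.
move=> dD fD nf0; apply: discrete_generic => // a Da.
have dich z : D z -> (\forall x \near z^', f x = 0) \/ (\forall x \near z^', f x != 0).
  move=> /fD /meromorphic_dnbhs[g [h [gz hz hn fgh]]].
  have [g0|gn] := isolated_zeros gz; [left|right].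
    by move: fgh; apply: filterS2 (nbhs_dnbhs g0) => x -> ->; rewrite mul0r.
  by move: gn hn fgh; apply: filterS3 => x g0 h0 ->; rewrite mulf_neq0 ?invr_eq0.
case: (dich a Da) => [a0|an]; last exact: an.
exfalso; apply: nf0; apply: (discrete_generic dD) => b Db.
pose U := [set x | \forall z \near x^', f z = 0].
have [oD cD _] := dD.
have Uo : open U.
  rewrite openE => x /dnbhs_cmodP[r r0 H].
  change (nbhs x U); apply/nbhs_rnormP; exists r; first exact: r0.
  move=> y; rewrite rnorm_cmod => yr; apply/dnbhs_cmodP.
  have [->|yx] := eqVneq y x; first by exists r.
  have /nbhs_rnormP[d d0 dP] := near_punctured yx yr.
  by exists d => // z _ zy; have [zx zr] := dP z zy; exact: H.
have DU0 : (D `&` U) !=set0 by exists a; split; [exact: Da|exact: a0].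
suff cl : D `&` U = D `&` closure U.
  have E : D `&` U = D.
    apply: (cD (D `&` U) DU0); first by exists U; [exact: Uo|].
    by exists (closure U); [exact: closed_closure|exact: cl].
  by move: Db; rewrite -{1}E => -[_ Ub]; exact: Ub.
apply/seteqP; split=> z [Dz Uz]; (split; first exact: Dz); first exact: subset_closure.
case: (dich z Dz) => [z0|nz]; first exact: z0.
exfalso.
have /dnbhs_cmodP[r r0 H] := nz.
have /Uz[y [Uy yr]] : nbhs z [set y | cmod (y - z) < r] by apply/nbhs_rnormP; exists r.
suff ny : \forall x \near y^', f x != 0.
  by have [x [-> /eqP]] := dnbhs_point (filterI Uy ny).
have [->//|yz] := eqVneq y z.
by apply: nbhs_dnbhs; apply: filterS (near_punctured yz yr) => x [xz xr]; exact: H.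
Qed.

End OneVariable.

(** * Meromorphic functions on the torus *)

Section Meromorphic.
Context {R : realType} {V : normedModType R[i]}.
Local Notation C := R[i].
Implicit Types (f g h : V -> C) (a : V) (D : set V).

Lemma holomorphic_meromorphic f a : holomorphic_at f a -> meromorphic_at f a.
Proof.
move=> fa; exists f, (fun=> 1); split=> //; first exact: holomorphic_cst.
  by move=> /nbhs_singleton/eqP; rewrite oner_eq0.
by apply: nearW => x _; rewrite divr1.
Qed.

Lemma meromorphic_cst c D : meromorphic_on D (fun=> c).
Proof. by move=> a _; apply: holomorphic_meromorphic; exact: holomorphic_cst. Qed.

Lemma meromorphicM f1 f2 D : meromorphic_on D f1 -> meromorphic_on D f2 ->
  meromorphic_on D (fun x => f1 x * f2 x).
Proof.
move=> m1 m2 a Da; have [g1 [h1 [ga1 ha1 n1 E1]]] := m1 _ Da.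
have [g2 [h2 [ga2 ha2 n2 E2]]] := m2 _ Da.
exists (fun x => g1 x * g2 x), (fun x => h1 x * h2 x); split.
- exact: holomorphicM.
- exact: holomorphicM.
- by move=> /(holomorphic_domain ha1 ha2)[].
- apply: filterS2 E1 E2 => x F1 F2; rewrite mulf_eq0 negb_or => /andP[x1 x2].
  by rewrite F1// F2// mulf_div.
Qed.

Lemma meromorphicD f1 f2 D : meromorphic_on D f1 -> meromorphic_on D f2 ->
  meromorphic_on D (fun x => f1 x + f2 x).
Proof.
move=> m1 m2 a Da; have [g1 [h1 [ga1 ha1 n1 E1]]] := m1 _ Da.
have [g2 [h2 [ga2 ha2 n2 E2]]] := m2 _ Da.
exists (fun x => g1 x * h2 x + g2 x * h1 x), (fun x => h1 x * h2 x); split.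
- by apply: holomorphicD; apply: holomorphicM.
- exact: holomorphicM.
- by move=> /(holomorphic_domain ha1 ha2)[].
- apply: filterS2 E1 E2 => x F1 F2; rewrite mulf_eq0 negb_or => /andP[x1 x2].
  by rewrite F1// F2// addf_div.
Qed.

Lemma meromorphic_sum (I : Type) (r : seq I) (P : pred I) (F : I -> V -> C) D :
  (forall i, P i -> meromorphic_on D (F i)) -> meromorphic_on D (fun x => \sum_(i <- r | P i) F i x).
Proof.
move=> FD; elim: r => [|i r IH].
  have -> : (fun x => \sum_(i <- [::] | P i) F i x) = fun=> 0 by apply/funext => x; rewrite big_nil.
  exact: meromorphic_cst.
have -> : (fun x => \sum_(j <- i :: r | P j) F j x) =
    fun x => (if P i then F i x else 0) + \sum_(j <- r | P j) F j x.
  by apply/funext => x; rewrite big_cons; case: (P i); rewrite ?add0r.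
apply: meromorphicD IH; case Pi: (P i); [exact: FD|exact: meromorphic_cst].
Qed.

Lemma meromorphic_prod (I : Type) (r : seq I) (P : pred I) (F : I -> V -> C) D :
  (forall i, P i -> meromorphic_on D (F i)) -> meromorphic_on D (fun x => \prod_(i <- r | P i) F i x).
Proof.
move=> FD; elim: r => [|i r IH].
  have -> : (fun x => \prod_(i <- [::] | P i) F i x) = fun=> 1 by apply/funext => x; rewrite big_nil.
  exact: meromorphic_cst.
have -> : (fun x => \prod_(j <- i :: r | P j) F j x) =
    fun x => (if P i then F i x else 1) * \prod_(j <- r | P j) F j x.
  by apply/funext => x; rewrite big_cons; case: (P i); rewrite ?mul1r.
apply: meromorphicM IH; case Pi: (P i); [exact: FD|exact: meromorphic_cst].
Qed.

Lemma meromorphic_prod_in (I : eqType) (s : seq I) (F : I -> V -> C) D :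
  (forall i, i \in s -> meromorphic_on D (F i)) -> meromorphic_on D (fun x => \prod_(i <- s) F i x).
Proof.
move=> FD; rewrite (_ : (fun x => _) = (fun x => \prod_(i <- s | i \in s) F i x)).
  exact: meromorphic_prod.
by apply/funext => x; rewrite big_seq.
Qed.

(** The numerator g of f has a nonzero germ: were it 0 near a, then f = g / h would vanish around
    any nearby b with h(b) nonzero, against the density of generic points. *)
Lemma meromorphicV f D : domain D -> meromorphic_on D f ->
  generically D (fun x => f x != 0) -> meromorphic_on D (fun x => (f x)^-1).
Proof.
move=> dD mf fn a Da; have [g [h [ga ha hn E]]] := mf _ Da.
have gn : ~ \forall x \near a, g x = 0.
  move=> g0; apply: hn.
  have Dn : \forall x \near a, D x by apply: open_nbhs_nbhs; split=> //; exact: domain_open dD.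
  have /nbhs_rnormP[r r0 H] : \forall x \near a, g x = 0 /\ ((h x != 0 -> f x = g x / h x) /\
      (differentiable (h : V -> C^o) x /\ D x)).
    exact: (filterI g0 (filterI E (filterI ha Dn))).
  apply/nbhs_rnormP; exists r => // b br; apply: contrapT => /eqP hb.
  have [gb [_ [hdb Db]]] := H b br.
  have hb' : \forall x \near b, h x != 0.
    by apply: near_neq0 => //; exact: differentiable_continuous.
  have br' := near_ball_rnorm br.
  have [y [Dy [hy yr]] /eqP] := generic_dense dD fn Db (filterI hb' br').
  by apply; have [gy [Ey _]] := H y yr; rewrite Ey// gy mul0r.
(* h / g is written with an extra factor h: where this denominator is nonzero, the equation f = g /
   h is available. *)
exists (fun x => h x * h x), (fun x => g x * h x); split.
- exact: holomorphicM.
- exact: holomorphicM.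
- by move=> /(holomorphic_domain ga ha)[].
- apply: filterS E => x Ex; rewrite mulf_eq0 negb_or => /andP[gx hx].
  by rewrite Ex//; field; rewrite gx hx.
Qed.

(** Were the denominator h(p) zero near a, every p(y) near p(a) would be a zero of h; these are
    isolated, so p would be constant near a. *)
Lemma meromorphic_comp (p : V -> C^o) (E : set C^o) (f : C^o -> C) D :
  (forall x, D x -> E (p x)) -> (forall x, D x -> holomorphic_at (p : V -> C) x) ->
  (forall x, D x -> ~ \forall y \near x, p y = p x) ->
  meromorphic_on E f -> meromorphic_on D (fun x => f (p x)).
Proof.
move=> DE ph pn fE a Da; have [g [h [ga ha hn Ef]]] := fE _ (DE _ Da).
have pc := holomorphic_cont (ph _ Da).
exists (fun x => g (p x)), (fun x => h (p x)); split.
- exact: (@holomorphic_comp _ V C^o p g a (ph _ Da) ga).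
- exact: (@holomorphic_comp _ V C^o p h a (ph _ Da) ha).
- have [//|] := isolated_zeros ha; rewrite near_withinE => hz h0; apply: (pn _ Da).
  have hz' : \forall x \near a, p x != p a -> h (p x) != 0 by exact: (pc _ hz).
  apply: filterS2 hz' h0 => x Hx h0x; apply/eqP; apply: contrapT => /negP /Hx.
  by rewrite h0x eqxx.
- exact: (pc _ Ef).
Qed.

End Meromorphic.

Lemma ord2P (c : 'I_2) : c = ord0 \/ c = ord_max.
Proof. by case: c => [[|[|//]] hi]; [left|right]; exact: val_inj. Qed.

(* (i, true) stands for z_i and (i, false) for its inverse: every argument of R in
   the transfer and transport matrices is a quotient of two such values. *)
Definition spectral {C : numFieldType} {N : nat} (z : 'rV[C]_N) (j : 'I_N * bool) : C :=
  if j.2 then z 0 j.1 else (z 0 j.1)^-1.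

Lemma spectral_neq0 {C : numFieldType} {N : nat} (z : 'rV[C]_N) j :
  torus C N z -> spectral z j != 0.
Proof. by rewrite /spectral => Dz; case: j.2; rewrite ?invr_eq0; exact: Dz. Qed.

(** * The torus and quotients of spectral values *)

Section Torus.
Context {R : realType}.
Local Notation C := R[i].

Definition seg_in {V : normedModType C} (D : set V) (a b : V) :=
  forall t : R, 0 <= t <= 1 -> D (a + t%:C%C *: (b - a)).

Lemma seg_domain {V : normedModType C} (D : set V) x0 : open D -> D x0 ->
  (forall x, D x -> exists2 v, seg_in D x0 v & seg_in D v x) -> domain D.
Proof.
move=> oD Dx0 H; split=> //; last by exists x0.
pose seg (a b : V) : set V := (fun t : R => a + t%:C%C *: (b - a)) @` `[0, 1].
have segc a b : connected (seg a b).
  apply: connected_continuous_connected; first exact: segment_connected.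
  apply: continuous_subspaceT => t; apply: cvgD; first exact: cvg_cst.
  by apply: cvgZl; exact: hpt_cont.
have seg0 a b : seg a b a.
  by exists 0; rewrite /= ?in_itv/= ?lexx ?ler01// scale0r addr0.
have seg1 a b : seg a b b.
  by exists 1; rewrite /= ?in_itv/= ?lexx ?ler01// scale1r addrC subrK.
have -> : D = \bigcup_(A in [set A | exists v x, [/\ seg_in D x0 v, seg_in D v x
   & A = seg x0 v `|` seg v x]]) A.
  apply/seteqP; split=> [x Dx|x [_ [v [y [h1 h2 ->]]]] []].
  - have [v h1 h2] := H _ Dx; exists (seg x0 v `|` seg v x); first by exists v, x.
    by right.
  - by move=> [t /=]; rewrite in_itv/= => /h1 ? <-.
  - by move=> [t /=]; rewrite in_itv/= => /h2 ? <-.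
apply: bigcup_connected.
  by exists x0 => _ [v [y [h1 h2 ->]]]; left.
move=> _ [v [y [h1 h2 ->]]]; apply: connectedU => //.
by exists v; split.
Qed.

(* A path from 1 to x in two segments: the first one has to leave the real line when
   x is a negative real. *)
Lemma seg_avoid0 (x : C) : x != 0 -> exists2 v : C,
  (forall t : R, 0 <= t <= 1 -> 1 + t%:C%C * (v - 1) != 0) &
  (forall t : R, 0 <= t <= 1 -> v + t%:C%C * (x - v) != 0).
Proof.
case: x => a b; rewrite eq_complex /= => ab0.
have [/andP[/eqP -> a0]|nb] := boolP ((b == 0) && (a < 0)).
  exists 'i%C => t /andP[t0 t1]; apply/eqP => -[]; simpc => E1 E2; nra.
exists (Complex a b) => t /andP[t0 t1]; apply/eqP.
  move=> []; simpc => E1 E2.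
  have [t00|tn0] := eqVneq t 0; first by move: E1; rewrite t00; lra.
  have b0 : b = 0 by move/eqP: E2; rewrite mulf_eq0 (negbTE tn0) /= => /eqP.
  move: ab0 nb; rewrite b0 !eqxx /= andbT -leNgt => a0 a1.
  have : 0 < a by rewrite lt_def a0.
  nra.
by rewrite subrr mulr0 addr0 => -[E1 E2]; move: ab0; rewrite E1 E2 !eqxx.
Qed.

Lemma punctured_domain : domain [set x : C^o | x != 0].
Proof.
apply: (@seg_domain C^o _ (1 : C^o)); last 1 first.
- by move=> x /seg_avoid0[v h1 h2]; exists v => t tt; [exact: h1|exact: h2].
- rewrite openE => x x0; apply: (@near_neq0 _ C^o (fun z => z)) => //; exact: cvg_id.
- exact: oner_neq0.
Qed.

Lemma full_domain : domain (setT : set C^o).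
Proof.
apply: (@seg_domain C^o _ (0 : C^o)); [exact: openT|by []|].
by move=> x _; exists x.
Qed.

Variable N : nat.
Implicit Types z : 'rV[C]_N.

Lemma holomorphic_coord i z : holomorphic_at (fun z : 'rV[C]_N => z 0 i) z.
Proof.
rewrite /holomorphic_at; near=> x.
have dx := @differentiable_coord C 1 N x 0 i.
exact: dx.
Unshelve. all: by end_near. Qed.

Lemma torus_domain : domain (torus C N).
Proof.
apply: (seg_domain (x0 := const_mx 1)) => /=.
- rewrite openE => z Dz.
  have Dn (i : 'I_N) : \forall x \near z, (x : 'rV[C]_N) 0 i != 0.
    apply: (@near_neq0 _ _ (fun x : 'rV[C]_N => x 0 i)); last exact: Dz.
    exact: holomorphic_cont (holomorphic_coord i z).
  have : \forall x \near z, forall i, (x : 'rV[C]_N) 0 i != 0.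
    exact: (@filter_forall _ _ (fun i (x : 'rV[C]_N) => x 0 i != 0) _ _ Dn).
  exact.
- by move=> i; rewrite mxE oner_neq0.
- move=> z Dz; have /choice[v vP] : forall i, exists v : C,
    (forall t : R, 0 <= t <= 1 -> 1 + t%:C%C * (v - 1) != 0) /\
    (forall t : R, 0 <= t <= 1 -> v + t%:C%C * (z 0 i - v) != 0).
    by move=> i; have [v h1 h2] := seg_avoid0 (Dz i); exists v.
  (* The broken lines of the coordinates are run in parallel. *)
  exists (\row_i v i) => t tt i; rewrite !mxE; have [h1 h2] := vP i.
    exact: h1.
  exact: h2.
Qed.

Lemma holomorphic_spectral j z : torus C N z -> holomorphic_at (fun z => spectral z j) z.
Proof.
rewrite /spectral => Dz; case: j.2; first exact: holomorphic_coord.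
by apply: holomorphicV; [exact: holomorphic_coord|exact: Dz].
Qed.

Lemma holomorphic_spectral_div j k z : torus C N z -> holomorphic_at (fun z => spectral z j / spectral z k) z.
Proof.
move=> Dz; apply: holomorphicM; first exact: holomorphic_spectral.
by apply: holomorphicV; [exact: holomorphic_spectral|exact: spectral_neq0].
Qed.

Definition spow (s : bool) (x : C) : C := if s then x else x^-1.
Lemma spowK s : involutive (spow s). Proof. by case: s => // x; rewrite /spow invrK. Qed.
Lemma spow_neq0 s x : x != 0 -> spow s x != 0. Proof. by case: s; rewrite /spow ?invr_eq0. Qed.
Lemma spectralE z j : spectral z j = spow j.2 (z 0 j.1). Proof. by []. Qed.

Lemma generic_spectral (P : C -> Prop) j : generically [set x : C^o | x != 0] P ->
  generically (torus C N) (fun z => P (spectral z j)).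
Proof.
apply: (@generic_pullback _ _ _ _ _ (fun z => spectral z j : C^o)).
- exact: domain_open torus_domain.
- by move=> z; exact: spectral_neq0.
- by move=> z; exact: holomorphic_spectral.
- move=> A [AE _] nA.
  have [x /= x0 nAx] := exists_notin AE nA.
  exists (\row_i spow j.2 x); first by move=> i; rewrite mxE spow_neq0.
  by rewrite spectralE mxE spowK.
Qed.

Lemma spectral_index_opp (j k : 'I_N * bool) : j != k -> j.1 = k.1 -> k.2 = ~~ j.2.
Proof.
by case: j k => [j s] [k t] /= + jk; rewrite jk xpair_eqE eqxx /=; case: s t => [] [].
Qed.

(** Two distinct values with the same index are inverse to each other, and their quotient is a
    square up to inversion, whence the square root. *)
Lemma spectral_div_surj j k (u : C) : j != k -> u != 0 ->
  exists2 z, torus C N z & spectral z j / spectral z k = u.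
Proof.
move=> jk u0; have [jk1|njk1] := eqVneq j.1 k.1; last first.
  exists (\row_i (if i == j.1 then spow j.2 u else 1)).
    by move=> i; rewrite mxE; case: ifP => _; rewrite ?spow_neq0 ?oner_neq0.
  rewrite !spectralE !mxE eqxx eq_sym (negbTE njk1) spowK.
  by rewrite /spow; case: k.2; rewrite !invr1 mulr1.
pose x := sqrtC u; have x0 : x != 0 by rewrite sqrtC_eq0.
have jk2 := spectral_index_opp jk jk1.
exists (\row_i spow j.2 x); first by move=> i; rewrite mxE spow_neq0.
rewrite !spectralE !mxE spowK jk2 /spow; case: j.2 => /=; rewrite ?invrK.
  by rewrite -expr2 sqrtCK.
by rewrite -expr2 sqrtCK.
Qed.

Lemma generic_spectral_div (P : C -> Prop) j k : j != k ->
  generically [set x : C^o | x != 0] P ->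
  generically (torus C N) (fun z => P (spectral z j / spectral z k)).
Proof.
move=> jk; apply: (@generic_pullback _ _ _ _ _ (fun z => spectral z j / spectral z k : C^o)).
- exact: domain_open torus_domain.
- by move=> z Dz; rewrite /= mulf_neq0 ?invr_eq0 ?spectral_neq0.
- by move=> z; exact: holomorphic_spectral_div.
- move=> A [AE _] nA.
  have [x /= x0 nAx] := exists_notin AE nA.
  by have [z Dz zx] := spectral_div_surj jk x0; exists z => //; rewrite zx.
Qed.

Lemma generic2_pullback (P : C -> C -> Prop) (p q : 'rV[C]_N -> C) :
  (forall z, torus C N z -> p z != 0) -> (forall z, torus C N z -> q z != 0) ->
  (forall z, torus C N z -> holomorphic_at p z) ->
  (forall z, torus C N z -> holomorphic_at q z) ->
  (forall u v, u != 0 -> v != 0 -> exists2 z, torus C N z & p z = u /\ q z = v) ->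
  generically2 P -> generically (torus C N) (fun z => P (p z) (q z)).
Proof.
move=> p0 q0 ph qh surj gP.
pose pq z : 'rV[C]_2 := p z *: delta_mx 0 ord0 + q z *: delta_mx 0 ord_max.
have pq0 z : pq z 0 ord0 = p z by rewrite !mxE /= mulr1 mulr0 addr0.
have pq1 z : pq z 0 ord_max = q z by rewrite !mxE /= mulr1 mulr0 add0r.
have := @generic_pullback _ _ _ (torus C N) (torus C 2) pq (fun w => P (w 0 ord0) (w 0 ord_max)).
move=> /(_ (domain_open torus_domain) _ _ _ gP) H.
have {H} : generically (torus C N) (fun z => P (pq z 0 ord0) (pq z 0 ord_max)).
  apply: H.
  - by move=> z Dz i; have [->|->] := ord2P i; rewrite ?pq0 ?pq1; [exact: p0|exact: q0].
  - move=> z Dz; have := qh _ Dz; apply: filterS2 (ph _ Dz) => x px qx.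
    by apply: differentiableD; apply: (@differentiableZl _ _ _ (_ : 'rV[C]_N -> C)).
  - move=> A [AE _] nA.
    have [w w0 nAw] := exists_notin AE nA.
    have [z Dz [pz qz]] := surj _ _ (w0 ord0) (w0 ord_max).
    exists z => //; suff -> : pq z = w by [].
    by apply/rowP => i; have [->|->] := ord2P i; rewrite ?pq0 ?pq1.
by apply: genericS => z _; rewrite pq0 pq1.
Qed.

Lemma generic2_coord (P : C -> C -> Prop) (i j : 'I_N) : i != j ->
  generically2 P -> generically (torus C N) (fun z => P (z 0 i) (z 0 j)).
Proof.
move=> ij; apply: generic2_pullback => //; try by move=> z Dz; [exact: Dz|exact: holomorphic_coord].
- by move=> z _; exact: holomorphic_coord.
- by move=> z _; exact: holomorphic_coord.
move=> u v u0 v0; exists (\row_k (if k == i then u else v)).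
  by move=> k; rewrite mxE; case: ifP.
by rewrite !mxE eqxx eq_sym (negbTE ij).
Qed.

(** The pair of quotients covers (C^x)^2. The delicate case is that of j and k inverse to each
    other, as in the Yang-Baxter equation at 1/z_i, z_i, z_j. *)
Lemma generic2_spectral (P : C -> C -> Prop) (j k l : 'I_N * bool) :
  j != k -> j.1 != l.1 -> k.1 != l.1 -> generically2 P ->
  generically (torus C N) (fun z => P (spectral z j / spectral z l) (spectral z k / spectral z l)).
Proof.
move=> jk jl kl; apply: generic2_pullback.
- by move=> z Dz; rewrite /= mulf_neq0 ?invr_eq0 ?spectral_neq0.
- by move=> z Dz; rewrite /= mulf_neq0 ?invr_eq0 ?spectral_neq0.
- by move=> z; exact: holomorphic_spectral_div.
- by move=> z; exact: holomorphic_spectral_div.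
move=> u v u0 v0; have [jk1|njk1] := eqVneq j.1 k.1; last first.
  exists (\row_i (if i == j.1 then spow j.2 u else if i == k.1 then spow k.2 v else 1)).
    by move=> i; rewrite mxE; case: ifP => _; [|case: ifP => _]; rewrite ?spow_neq0 ?oner_neq0.
  have [jl' kl'] := (negbTE jl, negbTE kl).
  rewrite !spectralE !mxE eqxx (eq_sym k.1) (negbTE njk1) eqxx (eq_sym l.1 j.1) (eq_sym l.1 k.1) jl' kl' !spowK.
  by rewrite /spow; case: l.2; rewrite !invr1 !mulr1.
have jk2 := spectral_index_opp jk jk1.
(* Solves a / c = u and a^-1 / c = v: the ratio gives a^2 = u / v, then c = a / u. *)
pose x := sqrtC (u / v); have x0 : x != 0 by rewrite sqrtC_eq0 mulf_neq0 ?invr_eq0.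
have xx : x * x = u / v by rewrite -expr2 sqrtCK.
pose w : 'rV[C]_N := \row_i (if i == j.1 then spow j.2 x else spow l.2 (x / u)); exists w.
  by move=> i; rewrite mxE; case: ifP => _; rewrite spow_neq0// mulf_neq0 ?invr_eq0.
have xj : spectral w j = x.
  by rewrite spectralE mxE eqxx spowK.
have xk : spectral w k = x^-1.
  by rewrite spectralE mxE jk1 eqxx jk2 /spow; case: j.2 => /=; rewrite ?invrK.
have xl : spectral w l = x / u.
  by rewrite spectralE mxE eq_sym (negbTE jl) spowK.
rewrite xj xk xl; split; first by field; rewrite x0 u0.
rewrite invfM invrK mulrA -invfM xx; field.
by rewrite u0 v0.
Qed.

(** Nonconstancy of p, as required for composing with a meromorphic function: multiplying the
    coordinate i by s, slightly larger than 1, multiplies p by s^k or s^-k. The exponent 2 serves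
    for quotients of inverse values. *)
Lemma pow_not_near1 (p : 'rV[C]_N -> C) (i : 'I_N) (k : nat)
    (z : ('rV[C]_N : normedModType C)) : (0 < k)%N ->
  torus C N z -> p z != 0 ->
  (forall s : C, s != 0 ->
    p (\row_l (if l == i then s * z 0 l else z 0 l)) = s ^+ k * p z \/
    p (\row_l (if l == i then s * z 0 l else z 0 l)) = s ^- k * p z) ->
  ~ \forall y \near z, p y = p z.
Proof.
move=> k0 Dz pz hp /nbhs_rnormP[r r0 H].
pose v : 'rV[C]_N := \row_l (if l == i then z 0 l else 0).
have d0 : 0 < rnorm v + 1 by rewrite ltr_wpDl ?rnorm_ge0.
(* The scaled point is z + e v, and e |v| < r; the added 1 makes the denominator visibly
   positive. *)
pose e : R := r / (rnorm v + 1) / 2; have e0 : 0 < e by rewrite !divr_gt0.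
pose s : C := (1 + e)%:C%C.
have s1 : 1 < s by rewrite -(rmorph1 (real_complex R)) ltcR; lra.
have s0 : s != 0 by rewrite gt_eqF// (lt_trans ltr01).
have sk : s ^+ k != 1 by rewrite gt_eqF// exprn_egt1// -lt0n.
have : p (\row_l (if l == i then s * z 0 l else z 0 l)) = p z.
  apply: H.
  rewrite (_ : _ - _ = e%:C%C *: v); last first.
    apply/rowP => l; rewrite !mxE; case: ifP => _; last by rewrite subrr mulr0.
    by rewrite /s rmorphD rmorph1/= mulrDl mul1r addrAC subrr add0r.
  rewrite rnormZ cmodR gtr0_norm// /e.
  apply: le_lt_trans (_ : r / 2 < r); last lra.
  move: d0; set n := rnorm v => d0.
  have -> : r / (n + 1) / 2 * n = r / 2 * (n / (n + 1)) by field; rewrite gt_eqF.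
  by rewrite ler_piMr ?divr_ge0 ?(ltW r0)// ler_pdivrMr// mul1r lerDl ler01.
case: (hp s s0) => -> /eqP; rewrite -subr_eq0 -{2}[p z]mul1r -mulrBl mulf_eq0 (negbTE pz) orbF subr_eq0.
  exact/negP.
by rewrite invr_eq1; exact/negP.
Qed.

Lemma meromorphic_spectral_div (f : C -> C) j k : j != k ->
  meromorphic_on [set x : C^o | x != 0] (f : C^o -> C) ->
  meromorphic_on (torus C N) (fun z => f (spectral z j / spectral z k)).
Proof.
move=> jk; apply: (@meromorphic_comp _ _ (fun z => spectral z j / spectral z k : C^o)).
- by move=> z Dz; rewrite /= mulf_neq0 ?invr_eq0 ?spectral_neq0.
- by move=> z; exact: holomorphic_spectral_div.
move=> z Dz; have [jk1|njk1] := eqVneq j.1 k.1.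
  have jk2 := spectral_index_opp jk jk1.
  apply: (@pow_not_near1 _ j.1 2) => //; first by rewrite mulf_neq0 ?invr_eq0 ?spectral_neq0.
  move=> s s0; have z0 := Dz k.1; rewrite !spectralE jk1 !mxE eqxx jk2 /spow; case: j.2 => /=; [left|right].
    by field; rewrite ?s0 ?z0.
  by field; rewrite ?s0 ?z0.
apply: (@pow_not_near1 _ j.1 1) => //; first by rewrite mulf_neq0 ?invr_eq0 ?spectral_neq0.
move=> s s0; rewrite !spectralE !mxE eqxx eq_sym (negbTE njk1) /spow.
have zj := Dz j.1; have zk := Dz k.1.
by case: j.2; case: k.2; [left|left|right|right]; field; rewrite ?s0 ?zj ?zk.
Qed.

Lemma meromorphic_spectral (f : C -> C) j :
  meromorphic_on [set x : C^o | x != 0] (f : C^o -> C) ->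
  meromorphic_on (torus C N) (fun z => f (spectral z j)).
Proof.
apply: (@meromorphic_comp _ _ (fun z => spectral z j : C^o)).
- by move=> z Dz; exact: spectral_neq0.
- by move=> z; exact: holomorphic_spectral.
move=> z Dz; apply: (@pow_not_near1 _ j.1 1) => //; first exact: spectral_neq0.
move=> s s0; rewrite !spectralE !mxE eqxx /spow; have zj := Dz j.1.
by case: j.2; [left|right]; field; rewrite ?s0 ?zj.
Qed.

End Torus.

(** * Operators on tensor factors *)

Section Legs.
Context {C : numFieldType} {n : nat}.
Local Notation tens k := (tensEnd C n k).
Local Notation midx k := (multiindex n k).

Definition restr k m (s : 'I_k -> 'I_m) (f : midx m) : midx k := [ffun a => f (s a)].
Definition agree k m (s : 'I_k -> 'I_m) (f g : midx m) :=
  [forall c, (c \in codom s) || (f c == g c)].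

Lemma tcoef_tmx k (F : midx k -> midx k -> C) f g : tcoef (tmx F) f g = F f g.
Proof. by rewrite /tcoef mxE !enum_rankK. Qed.

Lemma tcoefP k (X Y : tens k) : (forall f g, tcoef X f g = tcoef Y f g) -> X = Y.
Proof.
move=> XY; apply/matrixP => i j.
by have := XY (enum_val i) (enum_val j); rewrite /tcoef !enum_valK.
Qed.

Lemma tcoefM k (X Y : tens k) f g :
  tcoef (X *m Y) f g = \sum_h tcoef X f h * tcoef Y h g.
Proof.
rewrite /tcoef mxE (reindex (@enum_rank (midx k))) //=.
by apply: onW_bij; exists enum_val; [exact: enum_rankK|exact: enum_valK].
Qed.

Lemma tcoef1 k f g : tcoef (1%:M : tens k) f g = (f == g)%:R.
Proof. by rewrite /tcoef mxE (inj_eq enum_rank_inj). Qed.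

Lemma tcoefZ k (c : C) (X : tens k) f g : tcoef (c *: X) f g = c * tcoef X f g.
Proof. by rewrite /tcoef mxE. Qed.

Lemma tcoef_legs k m (s : 'I_k -> 'I_m) (X : tens k) f g :
  tcoef (legs s X) f g = if agree s f g then tcoef X (restr s f) (restr s g) else 0.
Proof. by rewrite tcoef_tmx. Qed.

Lemma agreeP k m (s : 'I_k -> 'I_m) (f g : midx m) :
  reflect (forall c, c \notin codom s -> f c = g c) (agree s f g).
Proof.
apply: (iffP forallP) => H c; first by move=> cs; have := H c; rewrite (negbTE cs) => /eqP.
by case: (boolP (c \in codom s)) => //= cs; rewrite H.
Qed.

(** A section of [restr], to sum over the multiindices that agree with f off the legs. *)
Definition merge k m (s : 'I_k -> 'I_m) (f : midx m) (h : midx k) : midx m :=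
  [ffun c => if [pick a | s a == c] is Some a then h a else f c].

Lemma restr_merge k m (s : 'I_k -> 'I_m) f h : injective s -> restr s (merge s f h) = h.
Proof.
move=> si; apply/ffunP => a; rewrite !ffunE; case: pickP => [b /eqP/si ->//|/(_ a)].
by rewrite eqxx.
Qed.

Lemma agree_merge k m (s : 'I_k -> 'I_m) f h : agree s f (merge s f h).
Proof.
apply/agreeP => c cs; rewrite ffunE; case: pickP => // a /eqP sa.
by move: cs; rewrite -sa codom_f.
Qed.

Lemma merge_restr k m (s : 'I_k -> 'I_m) f h : agree s f h -> merge s f (restr s h) = h.
Proof.
move=> /agreeP fh; apply/ffunP => c; rewrite ffunE; case: pickP => [a /eqP <-|cs].
  by rewrite ffunE.
apply: fh; apply/negP => /codomP[a ca]; by have := cs a; rewrite ca eqxx.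
Qed.

Lemma agree_trans k m (s : 'I_k -> 'I_m) f g h : agree s f g -> agree s g h -> agree s f h.
Proof. by move=> /agreeP fg /agreeP gh; apply/agreeP => c cs; rewrite fg ?gh. Qed.

Lemma agree_sym k m (s : 'I_k -> 'I_m) f g : agree s f g = agree s g f.
Proof. by apply/agreeP/agreeP => fg c cs; rewrite fg. Qed.

(** Only intermediate multiindices equal to f off the legs contribute, and these are the
    [merge s f h]. *)
Lemma legsM k m (s : 'I_k -> 'I_m) (X Y : tens k) : injective s ->
  legs s (X *m Y) = legs s X *m legs s Y.
Proof.
move=> si; apply: tcoefP => f g; rewrite tcoef_legs !tcoefM.
case: ifP => [fg|nfg]; last first.
  rewrite big1// => h _; rewrite !tcoef_legs; case: ifP => fh; last by rewrite mul0r.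
  by case: ifP => hg; rewrite ?mulr0//; move: nfg; rewrite (agree_trans fh hg).
rewrite [RHS](bigID (agree s f)) /= [X in _ + X]big1 ?addr0; last first.
  by move=> h nfh; rewrite tcoef_legs (negbTE nfh) mul0r.
rewrite (reindex_onto (merge s f) (restr s)) /=; last by move=> h; exact: merge_restr.
apply: eq_big => [h|h _]; first by rewrite agree_merge restr_merge ?eqxx.
rewrite !tcoef_legs agree_merge restr_merge//.
by rewrite (agree_trans _ fg)// agree_sym agree_merge.
Qed.

Lemma legs1 k m (s : 'I_k -> 'I_m) : legs s (1%:M : tens k) = 1%:M.
Proof.
apply: tcoefP => f g; rewrite tcoef_legs !tcoef1.
have [->|fg] := eqVneq f g.
  by rewrite eqxx; case: agreeP => // H; exfalso; apply: H.
case: agreeP => // H; case: eqVneq => // E; case/eqP: fg; apply/ffunP => c.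
case: (boolP (c \in codom s)) => [/codomP[a ->]|/H//].
by have /ffunP/(_ a) := E; rewrite !ffunE.
Qed.

Lemma legsZ k m (s : 'I_k -> 'I_m) (c : C) (X : tens k) : legs s (c *: X) = c *: legs s X.
Proof.
by apply: tcoefP => f g; rewrite tcoefZ !tcoef_legs tcoefZ; case: ifP; rewrite ?mulr0.
Qed.

Lemma legs_unit k m (s : 'I_k -> 'I_m) (X : tens k) : injective s ->
  X \in unitmx -> legs s X \in unitmx.
Proof.
move=> si Xu; have : legs s X *m legs s (invmx X) = 1%:M by rewrite -legsM// mulmxV// legs1.
by move=> /mulmx1_unit[].
Qed.

Lemma legsV k m (s : 'I_k -> 'I_m) (X : tens k) : injective s ->
  X \in unitmx -> legs s (invmx X) = invmx (legs s X).
Proof.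
move=> si Xu; apply: (can_inj (mulKmx (legs_unit si Xu))).
by rewrite -legsM// (mulmxV Xu) legs1 (mulmxV (legs_unit si Xu)).
Qed.

Lemma legs_comp k l m (s : 'I_l -> 'I_m) (t : 'I_k -> 'I_l) (X : tens k) :
  injective s -> legs s (legs t X) = legs (s \o t) X.
Proof.
move=> si; apply: tcoefP => f g; rewrite !tcoef_legs.
have E (h : midx m) : restr t (restr s h) = restr (s \o t) h.
  by apply/ffunP => a; rewrite !ffunE.
rewrite !E; have [fg|nfg] := boolP (agree s f g); last first.
  case: ifP => // /agreeP fg; case/agreeP: nfg => c cs; apply: fg.
  by apply: contra cs => /codomP[a ->]; exact: codom_f.
congr (if _ then _ else _); apply/agreeP/agreeP => H c ct; last first.
  rewrite !ffunE; apply: H; apply: contra ct => /codomP[a /si ->]; exact: codom_f.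
have [/codomP[d cd]|cs] := boolP (c \in codom s); last by move/agreeP: fg; apply.
have := H d; rewrite !ffunE -cd; apply; apply: contra ct => /codomP[a da].
by rewrite cd da; exact: (codom_f (s \o t)).
Qed.

(** On disjoint legs a single intermediate multiindex contributes, equal to g on the legs s and to f
    elsewhere. The result is symmetric in the two operators, hence their commutation. *)
Lemma tcoef_legs2 k l m (s : 'I_k -> 'I_m) (t : 'I_l -> 'I_m) (X : tens k) (Y : tens l) f g :
  (forall a b, s a != t b) ->
  tcoef (legs s X *m legs t Y) f g =
  if [forall c, (c \in codom s) || (c \in codom t) || (f c == g c)]
  then tcoef X (restr s f) (restr s g) * tcoef Y (restr t f) (restr t g) else 0.
Proof.
move=> st; rewrite tcoefM.
pose h0 : midx m := [ffun c => if c \in codom s then g c else f c].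
have h0P h : agree s f h -> agree t h g -> h = h0.
  move=> /agreeP fh /agreeP hg; apply/ffunP => c; rewrite ffunE; case: ifP => cs.
    apply: hg; case/codomP: cs => a ->; apply/negP => /codomP[b /eqP]; exact/negP.
  by rewrite fh ?cs.
rewrite (bigD1 h0) //= big1 ?addr0 => [|h hh0]; last first.
  rewrite !tcoef_legs; case: ifP => fh; last by rewrite mul0r.
  by case: ifP => hg; rewrite ?mulr0//; move: hh0; rewrite (h0P h) ?eqxx.
rewrite !tcoef_legs.
have -> : agree s f h0 by apply/agreeP => c cs; rewrite ffunE (negbTE cs).
have -> : restr s h0 = restr s g by apply/ffunP => a; rewrite !ffunE codom_f.
have -> : restr t h0 = restr t f.
  apply/ffunP => b; rewrite !ffunE; case: ifP => // /codomP[a /eqP].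
  by rewrite eq_sym (negbTE (st _ _)).
have -> : agree t h0 g = [forall c, (c \in codom s) || (c \in codom t) || (f c == g c)].
  apply/agreeP/forallP => [H c|H c ct].
    case: (boolP (c \in codom s)) => //= cs; case: (boolP (c \in codom t)) => //= ct.
    by rewrite -H// ffunE (negbTE cs).
  rewrite ffunE; case: ifP => // cs; have := H c; rewrite cs (negbTE ct) => /eqP //.
by case: ifP; rewrite ?mulr0.
Qed.

Lemma legs_comm k l m (s : 'I_k -> 'I_m) (t : 'I_l -> 'I_m) (X : tens k) (Y : tens l) :
  (forall a b, s a != t b) -> legs s X *m legs t Y = legs t Y *m legs s X.
Proof.
move=> st; apply: tcoefP => f g; rewrite !tcoef_legs2//; last by move=> a b; rewrite eq_sym.
rewrite mulrC; congr (if _ then _ else _).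
by apply: eq_forallb => c; congr (_ || _); exact: orbC.
Qed.

Lemma ord3_neq : [/\ (inord 1 == inord 0 :> 'I_3) = false,
  (inord 2 == inord 0 :> 'I_3) = false & (inord 2 == inord 1 :> 'I_3) = false].
Proof. by split; rewrite -val_eqE /= !inordK. Qed.

Lemma ord3P (e : 'I_3) : [\/ e = inord 0, e = inord 1 | e = inord 2].
Proof.
by case: e => [[|[|[|//]]] i]; [constructor 1|constructor 2|constructor 3];
  apply: val_inj; rewrite /= inordK.
Qed.

(** The permutation of basis vectors realised by the flip of the factors a and b. *)
Definition twist m (a b : 'I_m) (f : midx m) : midx m := [ffun c => f (tperm a b c)].

Lemma twistK m (a b : 'I_m) : involutive (@twist m a b).
Proof. by move=> f; apply/ffunP => c; rewrite !ffunE tpermK. Qed.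

Lemma leg2_inj m (a b : 'I_m) : a != b ->
  injective (fun c : 'I_2 => if c == ord0 then a else b).
Proof.
by move=> /eqP ab c d; have [->|->] := ord2P c; have [->|->] := ord2P d => //= /esym.
Qed.

Lemma codom_leg2 m (a b c : 'I_m) :
  (c \in codom (fun c : 'I_2 => if c == ord0 then a else b)) = (c == a) || (c == b).
Proof.
apply/codomP/orP => [[d ->]|[]/eqP ->]; first by case: ifP; [left|right].
  by exists ord0.
by exists ord_max.
Qed.

Lemma tcoef_flip m (a b : 'I_m) f h : a != b ->
  tcoef (leg2 a b flip : tens m) f h = (h == twist a b f)%:R.
Proof.
move=> ab; rewrite tcoef_legs tcoef_tmx !ffunE /=.
have [->|hn] := eqVneq h (twist a b f).
  rewrite !ffunE tpermL tpermR !eqxx.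
  case: agreeP => // H; exfalso; apply: H => c; rewrite codom_leg2 negb_or => /andP[ca cb].
  by rewrite ffunE tpermD // eq_sym.
case: agreeP => // H; case: eqP => // E1; case: eqP => // E2; case/eqP: hn.
apply/ffunP => c; rewrite ffunE; case: tpermP => [->|->|ca cb] //.
by rewrite H// codom_leg2 negb_or; apply/andP; split; apply/eqP.
Qed.

Lemma tcoef_flipMl m (a b : 'I_m) (Z : tens m) f g : a != b ->
  tcoef (leg2 a b flip *m Z) f g = tcoef Z (twist a b f) g.
Proof.
move=> ab; rewrite tcoefM (bigD1 (twist a b f)) //= tcoef_flip// eqxx mul1r big1 ?addr0//.
by move=> h hf; rewrite tcoef_flip// (negbTE hf) mul0r.
Qed.

Lemma tcoef_flipMr m (a b : 'I_m) (Z : tens m) f g : a != b ->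
  tcoef (Z *m leg2 a b flip) f g = tcoef Z f (twist a b g).
Proof.
move=> ab; rewrite tcoefM (bigD1 (twist a b g)) //= tcoef_flip// twistK eqxx mulr1 big1 ?addr0//.
move=> h hg; rewrite tcoef_flip//; case: eqP => [E|_]; last by rewrite mulr0.
by move: hg; rewrite E twistK eqxx.
Qed.

Lemma flip_flip m (a b : 'I_m) : a != b ->
  (leg2 a b flip : tens m) *m leg2 a b flip = 1%:M.
Proof.
move=> ab; apply: tcoefP => f g; rewrite tcoef_flipMl// tcoef_flip// twistK tcoef1 eq_sym//.
Qed.

Lemma flip_legs k m (a b : 'I_m) (s : 'I_k -> 'I_m) (X : tens k) : a != b ->
  leg2 a b flip *m legs s X = legs (tperm a b \o s) X *m leg2 a b flip.
Proof.
move=> ab; apply: tcoefP => f g; rewrite tcoef_flipMl// tcoef_flipMr// !tcoef_legs.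
have -> : restr s (twist a b f) = restr (tperm a b \o s) f.
  by apply/ffunP => c; rewrite !ffunE.
have -> : restr (tperm a b \o s) (twist a b g) = restr s g.
  by apply/ffunP => c; rewrite !ffunE /= tpermK.
congr (if _ then _ else _); apply/agreeP/agreeP => H c cs.
  rewrite ffunE; have := H (tperm a b c); rewrite ffunE tpermK; apply.
  by apply: contra cs => /codomP[d cd]; apply/codomP; exists d; rewrite /= -cd tpermK.
have := H (tperm a b c); rewrite !ffunE tpermK; apply.
by apply: contra cs => /codomP[d /= /perm_inj ->]; exact: codom_f.
Qed.

Lemma flip_leg2 m (a b c d : 'I_m) (X : tens 2) : a != b ->
  leg2 a b flip *m leg2 c d X = leg2 (tperm a b c) (tperm a b d) X *m leg2 a b flip.
Proof.
move=> ab; rewrite /leg2 flip_legs//; congr (legs _ _ *m _).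
by apply/funext => e /=; case: ifP.
Qed.

Lemma flip_leg1 m (a b c : 'I_m) (X : tens 1) : a != b ->
  leg2 a b flip *m leg1 c X = leg1 (tperm a b c) X *m leg2 a b flip.
Proof. by move=> ab; rewrite /leg1 flip_legs. Qed.

Lemma legs_leg2 k m (s : 'I_k -> 'I_m) (a b : 'I_k) (X : tens 2) : injective s ->
  legs s (leg2 a b X) = leg2 (s a) (s b) X.
Proof.
move=> si; rewrite /leg2 legs_comp//; congr legs.
by apply/funext => e /=; case: ifP.
Qed.

Lemma legs_leg1 k m (s : 'I_k -> 'I_m) (a : 'I_k) (X : tens 1) : injective s ->
  legs s (leg1 a X) = leg1 (s a) X.
Proof. by move=> si; rewrite /leg1 legs_comp. Qed.

Lemma leg2_id (X : tens 2) : leg2 ord0 ord_max X = X.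
Proof.
apply: tcoefP => f g; rewrite tcoef_legs.
have E (h : midx 2) : restr (fun c : 'I_2 => if c == ord0 then ord0 else ord_max) h = h.
  by apply/ffunP => c; rewrite ffunE; have [->|->] := ord2P c.
rewrite !E; case: agreeP => // H; exfalso; apply: H => c; rewrite codom_leg2.
by have [->|->] := ord2P c; rewrite eqxx ?orbT.
Qed.

Lemma tcoef_ptrace0 k (X : tens k.+1) f g :
  tcoef (ptrace0 X) f g = \sum_a tcoef X (considx a f) (considx a g).
Proof. by rewrite tcoef_tmx. Qed.

Lemma considx0 k a (f : midx k) : considx a f ord0 = a.
Proof. by rewrite ffunE unlift_none. Qed.

Lemma considxS k a (f : midx k) c : considx a f (lift ord0 c) = f c.
Proof. by rewrite ffunE liftK. Qed.

Lemma sum_considx k (F : midx k.+1 -> C) :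
  \sum_h F h = \sum_(a < n) \sum_(h : midx k) F (considx a h).
Proof.
rewrite pair_big /= (reindex (fun p : 'I_n * midx k => considx p.1 p.2)) //=.
apply: onW_bij; exists (fun h : midx k.+1 => (h ord0, restr (lift ord0) h)).
  move=> [a h] /=; rewrite considx0; congr (_, _).
  by apply/ffunP => c; rewrite ffunE considxS.
move=> h /=; apply/ffunP => c; have [d ->|->] := unliftP ord0 c; last by rewrite considx0.
by rewrite considxS ffunE.
Qed.

Lemma tcoef_legs_lift k (X : tens k) a b f g :
  tcoef (legs (lift ord0) X) (considx a f) (considx b g) = (a == b)%:R * tcoef X f g.
Proof.
have E c (h : midx k) : restr (lift ord0) (considx c h) = h.
  by apply/ffunP => d; rewrite ffunE considxS.
rewrite tcoef_legs !E; have [->|ab] := eqVneq a b; last first.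
  case: agreeP => [H|]; rewrite ?mul0r//; have := H ord0; rewrite !considx0 => E0.
  by case/eqP: ab; apply: E0; apply/codomP => -[d /eqP]; rewrite (negbTE (neq_lift _ _)).
rewrite mul1r; case: agreeP => // H; exfalso; apply: H => c.
have [d ->|->] := unliftP ord0 c; last by rewrite !considx0.
by rewrite codom_f.
Qed.

Lemma ptrace0_legsl k (X : tens k) (Y : tens k.+1) :
  ptrace0 (legs (lift ord0) X *m Y) = X *m ptrace0 Y.
Proof.
apply: tcoefP => f g; rewrite tcoef_ptrace0 tcoefM.
under eq_bigr => a _ do rewrite tcoefM sum_considx.
under [RHS]eq_bigr => h _ do rewrite tcoef_ptrace0 mulr_sumr.
rewrite [RHS]exchange_big /=; apply: eq_bigr => a _.
rewrite (bigD1 a) //= [X in _ + X]big1 ?addr0 => [|b ba].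
  by apply: eq_bigr => h _; rewrite tcoef_legs_lift eqxx mul1r.
by rewrite big1// => h _; rewrite tcoef_legs_lift eq_sym (negbTE ba) !mul0r.
Qed.

Lemma ptrace0_legsr k (X : tens k) (Y : tens k.+1) :
  ptrace0 (Y *m legs (lift ord0) X) = ptrace0 Y *m X.
Proof.
apply: tcoefP => f g; rewrite tcoef_ptrace0 tcoefM.
under eq_bigr => a _ do rewrite tcoefM sum_considx.
under [RHS]eq_bigr => h _ do rewrite tcoef_ptrace0 mulr_suml.
rewrite [RHS]exchange_big /=; apply: eq_bigr => a _.
rewrite (bigD1 a) //= [X in _ + X]big1 ?addr0 => [|b ba].
  by apply: eq_bigr => h _; rewrite tcoef_legs_lift eqxx mul1r.
by rewrite big1// => h _; rewrite tcoef_legs_lift (negbTE ba) mul0r mulr0.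
Qed.

Lemma ptrace0Z k (c : C) (X : tens k.+1) : ptrace0 (c *: X) = c *: ptrace0 X.
Proof.
apply: tcoefP => f g; rewrite tcoefZ !tcoef_ptrace0 mulr_sumr.
by apply: eq_bigr => a _; rewrite tcoefZ.
Qed.

Lemma ptrace0_leg2 k (i : 'I_k) (Z : tens 2) :
  ptrace0 (leg2 ord0 (lift ord0 i) Z) = leg1 i (ptrace0 Z).
Proof.
apply: tcoefP => f g; rewrite tcoef_ptrace0 tcoef_legs.
have E a (h : midx k) : restr (fun c : 'I_2 => if c == ord0 then ord0 else lift ord0 i) (considx a h)
    = considx a (restr (fun _ : 'I_1 => i) h).
  apply/ffunP => c; rewrite ffunE; have [->|->] := ord2P c; first by rewrite eqxx !considx0.
  rewrite /= considxS (_ : ord_max = lift ord0 ord0) ?considxS ?ffunE//; exact: val_inj.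
case: agreeP => [H|nH].
  rewrite tcoef_ptrace0; apply: eq_bigr => a _; rewrite tcoef_legs !E.
  case: agreeP => // H'; exfalso; apply: H' => c; rewrite codom_leg2.
  have [d ->|->] := unliftP ord0 c; last by rewrite eqxx.
  rewrite negb_or => /andP[_ di]; rewrite !considxS; apply: H.
  by apply: contra di => /codomP[_ ->].
rewrite big1// => a _; rewrite tcoef_legs; case: agreeP => // H; exfalso; apply: nH => c ci.
have := H (lift ord0 c); rewrite !considxS; apply; rewrite codom_leg2 (inj_eq (@lift_inj _ _)).
rewrite eq_sym (negbTE (neq_lift _ _)) /=; apply: contra ci => /eqP ->.
exact: (codom_f (fun _ : 'I_1 => i) ord0).
Qed.

Lemma ptransposeK k (i : 'I_k) : involutive (@ptranspose C n k i).
Proof.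
move=> X; apply: tcoefP => f g; rewrite !tcoef_tmx; congr tcoef;
by apply/ffunP => c; rewrite !ffunE; case: (c == i).
Qed.

Definition cst1 (a : 'I_n) : midx 1 := [ffun=> a].

Lemma cst1K (h : midx 1) : cst1 (h ord0) = h.
Proof. by apply/ffunP => c; rewrite ffunE (ord1 c). Qed.

Lemma considx_max a (h : midx 1) : considx a h ord_max = h ord0.
Proof. by rewrite -(considxS a h); congr (considx a h _); exact: val_inj. Qed.

(** With an element of End(V) read as a row vector over pairs of indices, phi_Q at x is
    multiplication by the matrix of Q(x^2)^{t_1}. *)
Lemma tcoef_phi (Q : C -> tens 2) (Y : C -> tens 1) x f g :
  tcoef (phi Q Y x) f g = \sum_(p : midx 2)
    tcoef (Y x) (cst1 (p ord0)) (cst1 (p ord_max)) *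
    tcoef (ptranspose ord0 (Q (x ^+ 2))) p (considx (f ord0) g).
Proof.
have m0 : ord0 != ord_max :> 'I_2 by [].
rewrite tcoef_ptrace0 sum_considx; apply: eq_bigr => a _.
rewrite -{1}(leg2_id flip) -mulmxA.
have -> : leg1 ord0 (Y x) *m (leg2 ord0 ord_max flip *m Q (x ^+ 2)) =
   leg2 ord0 ord_max flip *m (leg1 ord_max (Y x) *m Q (x ^+ 2)).
  by rewrite !mulmxA flip_leg1// tpermR.
rewrite tcoef_flipMl// tcoefM sum_considx (bigD1 (f ord0)) //= [X in _ + X]big1 ?addr0.
  apply: eq_bigr => h _; rewrite tcoef_legs.
  have -> : agree (fun _ : 'I_1 => ord_max) (twist ord0 ord_max (considx a f)) (considx (f ord0) h).
    apply/agreeP => c; have [->|->] := ord2P c.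
      by move=> _; rewrite ffunE tpermL considx0 considx_max.
    by rewrite (codom_f (fun _ : 'I_1 => ord_max) ord0).
  congr (tcoef _ _ _ * _).
  - by apply/ffunP => c; rewrite [LHS]ffunE [LHS]ffunE tpermR considx0 [RHS]ffunE considx0.
  - by apply/ffunP => c; rewrite [LHS]ffunE [RHS]ffunE !considx_max.
  - rewrite tcoef_tmx; congr tcoef; apply/ffunP => c; rewrite [RHS]ffunE;
      have [->|->] := ord2P c; by rewrite /= ?considx0 ?considx_max.
move=> c cf; apply: big1 => h _; rewrite tcoef_legs; case: agreeP => [H|]; last by rewrite mul0r.
have := H ord0; rewrite ffunE tpermL considx0 considx_max => E.
by case/eqP: cf; rewrite E//; apply/codomP => -[].
Qed.

(** In the vector form of [tcoef_phi], the two maps are multiplication by R^{t_1} and by its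
    inverse, both at x^2. *)
Lemma phi_phi_tilde (Rm : C -> tens 2) (Y : C -> tens 1) x :
  ptranspose ord0 (Rm (x ^+ 2)) \in unitmx ->
  phi Rm (phi (tildeR Rm) Y) x = Y x.
Proof.
move=> Ru; apply: tcoefP => f g; rewrite tcoef_phi.
under eq_bigr => p _.
  rewrite tcoef_phi ptransposeK mulr_suml.
  over.
rewrite exchange_big /=.
under eq_bigr => q _.
  under eq_bigr => p _ do rewrite -mulrA.
  rewrite -mulr_sumr.
  over.
have E q : \sum_(p : midx 2) tcoef (invmx (ptranspose ord0 (Rm (x ^+ 2)))) q
     (considx (cst1 (p ord0) ord0) (cst1 (p ord_max))) *
     tcoef (ptranspose ord0 (Rm (x ^+ 2))) p (considx (f ord0) g) = (q == considx (f ord0) g)%:R.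
  rewrite -(@tcoef1 2) -(mulVmx Ru) tcoefM; apply: eq_bigr => p _; congr (tcoef _ _ _ * _).
  apply/ffunP => c; have [->|->] := ord2P c; first by rewrite considx0 ffunE.
  by rewrite considx_max ffunE.
under eq_bigr => q _ do rewrite E.
rewrite (bigD1 (considx (f ord0) g)) //= eqxx mulr1 big1 ?addr0 => [|q /negbTE ->]; last by rewrite mulr0.
by rewrite considx0 considx_max !cst1K.
Qed.

End Legs.

(** * The transfer matrix at z_i and at its inverse *)

Section Words.
Context {M : pzRingType} {I : eqType}.
Implicit Types (F G : I -> M) (s t : seq I) (X Y : M).

Lemma comm_prod X s F : (forall j, j \in s -> GRing.comm X (F j)) ->
  GRing.comm X (\prod_(j <- s) F j).
Proof. by move=> XF; rewrite big_seq; apply: commr_prod. Qed.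

Lemma comm_prods s t F G : (forall j k, j \in s -> k \in t -> GRing.comm (F j) (G k)) ->
  GRing.comm (\prod_(j <- s) F j) (\prod_(k <- t) G k).
Proof.
move=> FG; apply: comm_prod => k kt; apply/commr_sym/comm_prod => j js.
exact/commr_sym/FG.
Qed.

Lemma prod_rev_cons j s F : \prod_(k <- rev (j :: s)) F k = (\prod_(k <- rev s) F k) * F j.
Proof. by rewrite rev_cons -cats1 big_cat big_seq1. Qed.

(** Induction from the outermost pair: the inner word is exchanged, F_j and G_j commute past the
    primed factors it has produced and meet at Q, where they are exchanged in turn. *)
Lemma prod_through s F G F' G' Q : uniq s ->
  (forall j, j \in s -> F j * Q * G j = G' j * Q * F' j) ->
  (forall j k, j \in s -> k \in s -> j != k ->
     GRing.comm (F j) (G' k) /\ GRing.comm (G j) (F' k)) ->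
  (\prod_(j <- s) F j) * Q * (\prod_(j <- rev s) G j) =
  (\prod_(j <- rev s) G' j) * Q * (\prod_(j <- s) F' j).
Proof.
elim: s => [|j s IH] /=; first by rewrite !big_nil.
move=> /andP[js us] B cFG; rewrite !prod_rev_cons !big_cons.
have {}IH : \prod_(j <- s) F j * Q * \prod_(j <- rev s) G j =
    \prod_(j <- rev s) G' j * Q * \prod_(j <- s) F' j.
  apply: IH => // [k ks|k l ks ls]; first by apply: B; rewrite inE ks orbT.
  by apply: cFG; rewrite inE ?ks ?ls orbT.
have jk k : k \in s -> j != k by apply: contraTneq => <-.
have c1 : GRing.comm (F j) (\prod_(k <- rev s) G' k).
  apply: comm_prod => k; rewrite mem_rev => ks.
  by have [] := cFG j k (mem_head _ _) _ (jk _ ks); rewrite ?inE ?ks ?orbT.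
have c2 : GRing.comm (G j) (\prod_(k <- s) F' k).
  apply: comm_prod => k ks.
  by have [] := cFG j k (mem_head _ _) _ (jk _ ks); rewrite ?inE ?ks ?orbT.
rewrite -!mulrA (mulrA (\prod_(j <- s) F j)) (mulrA (_ * Q)) IH.
rewrite -!mulrA -c2 !mulrA c1 -(mulrA _ (F j)) -(mulrA _ (F j * Q)) B ?mem_head//.
by rewrite !mulrA.
Qed.

Lemma prod_conj s F F' X : (forall j, j \in s -> X * F j = F' j * X) ->
  X * (\prod_(j <- s) F j) = (\prod_(j <- s) F' j) * X.
Proof.
elim: s => [|j s IH] XF; first by rewrite !big_nil mulr1 mul1r.
rewrite !big_cons mulrA XF ?mem_head// -mulrA IH ?mulrA// => k ks.
by apply: XF; rewrite inE ks orbT.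
Qed.

End Words.

Section ScalarWords.
Context {C : numFieldType} {d : nat} {I : eqType}.
Local Notation M := 'M[C]_d.

Lemma scale_mulr (c : C) (X Y : M) : X * (c *: Y) = c *: (X * Y).
Proof. by rewrite -mulmxE scalemxAr. Qed.
Lemma scale_mull (c : C) (X Y : M) : (c *: X) * Y = c *: (X * Y).
Proof. by rewrite -mulmxE scalemxAl. Qed.

Lemma prodZ (s : seq I) (c : I -> C) (F : I -> M) :
  \prod_(j <- s) (c j *: F j) = (\prod_(j <- s) c j) *: \prod_(j <- s) F j.
Proof.
elim: s => [|j s IH]; first by rewrite !big_nil scale1r.
by rewrite !big_cons IH scale_mulr scale_mull scalerA mulrC.
Qed.

Lemma prod_cancel (s : seq I) (c : I -> C) (F G : I -> M) :
  (forall j, j \in s -> F j * G j = c j *: 1%:M) ->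
  (\prod_(j <- rev s) F j) * (\prod_(j <- s) G j) = (\prod_(j <- s) c j) *: 1%:M.
Proof.
elim: s => [|j s IH] FG; first by rewrite !big_nil mulr1 scale1r.
rewrite prod_rev_cons !big_cons -mulrA (mulrA (F j)) FG ?mem_head//.
rewrite scale_mull (mul1r (\prod_(k <- s) G k)) scale_mulr IH ?scalerA// => k ks.
by apply: FG; rewrite inE ks orbT.
Qed.

End ScalarWords.

Section Spectral.
Context {C : numFieldType} {n : nat} (Rm : C -> tensEnd C n 2) (rho : C -> C).
Local Notation tens k := (tensEnd C n k).

Definition Rleg m (a b : 'I_m) u : tens m := leg2 a b (Rm u).

(** The body of [yang_baxter] at one pair of arguments, so that the generic statement yields it by
    conversion. *)
Definition yang_baxter_at (u v : C) :=
  let o1 : 'I_3 := inord 0 in let o2 : 'I_3 := inord 1 in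
  let o3 : 'I_3 := inord 2 in
    leg2 o1 o2 (Rm (u / v)) *m leg2 o1 o3 (Rm u) *m leg2 o2 o3 (Rm v) =
    leg2 o2 o3 (Rm v) *m leg2 o1 o3 (Rm u) *m leg2 o1 o2 (Rm (u / v)).

(** All that is used of R at one argument u, apart from Yang-Baxter. The invertible partial
    transpose serves to undo phi; rho is a parameter here and receives its value later. *)
Record unitary_at (u : C) : Prop := {
  UN_unit : Rm u \in unitmx;
  UN_tunit : ptranspose ord0 (Rm u) \in unitmx;
  UN_rho : rho u != 0;
  UN_eq : (leg2 ord0 ord_max (Rm u) : tens 2) *m leg2 ord_max ord0 (Rm u^-1) = rho u *: 1%:M }.

(** One value is attached to each leg: with u = p / r and v = q / r, the remaining argument u / v is
    p / q. *)
Lemma Rleg_braid m (a b c : 'I_m) p q r : a != b -> a != c -> b != c -> r != 0 ->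
  yang_baxter_at (p / r) (q / r) ->
  Rleg a b (p / q) * Rleg a c (p / r) * Rleg b c (q / r) =
  Rleg b c (q / r) * Rleg a c (p / r) * Rleg a b (p / q).
Proof.
move=> ab ac bc r0; rewrite /yang_baxter_at invf_div mulrA divfK//.
pose s (e : 'I_3) : 'I_m := if e == inord 0 then a else if e == inord 1 then b else c.
have [n10 n20 n21] := ord3_neq.
have E1 : s (inord 0) = a by rewrite /s eqxx.
have E2 : s (inord 1) = b by rewrite /s n10 eqxx.
have E3 : s (inord 2) = c by rewrite /s n20 n21.
have si : injective s.
  move=> e f; have [->|->|->] := ord3P e; have [->|->|->] := ord3P f; rewrite ?E1 ?E2 ?E3 // => E;
    by exfalso; move: ab ac bc; rewrite E ?eqxx.
move=> /(congr1 (legs s)); rewrite !legsM// !legs_leg2//.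
by rewrite E1 E2 E3.
Qed.

Lemma Rleg_unitarity m (a b : 'I_m) p q : a != b -> unitary_at (p / q) ->
  Rleg a b (p / q) * Rleg b a (q / p) = rho (p / q) *: 1%:M.
Proof.
move=> ab [_ _ _]; rewrite invf_div.
move=> /(congr1 (legs (fun e : 'I_2 => if e == ord0 then a else b))).
have si := leg2_inj ab.
by rewrite legsM// !legs_leg2// legsZ legs1.
Qed.

Lemma Rleg_unit m (a b : 'I_m) u : a != b -> unitary_at u -> Rleg a b u \in unitmx.
Proof. by move=> ab [Ru _ _ _]; apply: legs_unit => //; exact: leg2_inj. Qed.

Lemma RlegV m (a b : 'I_m) p q : a != b -> unitary_at (p / q) ->
  invmx (Rleg a b (p / q)) = (rho (p / q))^-1 *: Rleg b a (q / p).
Proof.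
move=> ab U; have H := Rleg_unitarity ab U; have r0 := UN_rho U.
apply: (can_inj (mulKmx (Rleg_unit ab U))); rewrite mulmxV ?Rleg_unit//.
by rewrite -scalemxAr mulmxE H scalerA mulVf// scale1r.
Qed.

Lemma legs_prod k m (s : 'I_k -> 'I_m) (I : Type) (t : seq I) (F : I -> tens k) : injective s ->
  legs s (\prod_(j <- t) F j) = \prod_(j <- t) legs s (F j).
Proof.
move=> si; elim: t => [|j t IH]; first by rewrite !big_nil; exact: legs1.
by rewrite !big_cons -IH; exact: legsM.
Qed.

Lemma comm_legs k l m (s : 'I_k -> 'I_m) (t : 'I_l -> 'I_m) (X : tens k) (Y : tens l) :
  (forall a b, s a != t b) -> GRing.comm (legs s X) (legs t Y).
Proof. exact: legs_comm. Qed.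

Lemma Rleg_comm m (a b c d : 'I_m) u v : a != c -> a != d -> b != c -> b != d ->
  GRing.comm (Rleg a b u) (Rleg c d v).
Proof.
move=> ac ad bc bd; apply: comm_legs => e f; by case: ifP => _; case: ifP.
Qed.

Lemma leg1_Rleg_comm m (a c d : 'I_m) (K : tens 1) v : a != c -> a != d ->
  GRing.comm (leg1 a K) (Rleg c d v).
Proof. by move=> ac ad; apply: comm_legs => e f; case: ifP. Qed.

Lemma comm_invmx m (X Y : 'M[C]_m) : GRing.comm X Y -> GRing.comm X (invmx Y).
Proof.
(* For a singular Y, [invmx Y] is Y by convention. *)
move=> XY; have [Yu|nY] := boolP (Y \in unitmx); last by rewrite /invmx (negbTE nY).
have V : Y * invmx Y = 1 by exact: mulmxV.
have V' : invmx Y * Y = 1 by exact: mulVmx.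
by rewrite /GRing.comm -[X * _]mul1r -V' -!mulrA (mulrA Y) -XY -mulrA V mulr1.
Qed.

End Spectral.

(** The rearrangement behind [ptrace0_flip_right], and below it that of [ptrace0_flip_left], in an
    abstract ring: p is the permutation, b0 and b1 are K^- dressed on the auxiliary and on the i-th
    factor. *)
Lemma word_assoc1 (M : pzRingType) (k FL Fi b0 p b1 GL q r : M) :
  p * b1 = b0 * p -> Fi * p = q -> b1 * GL = GL * b1 -> k * (FL * q * GL) = r ->
  k * FL * Fi * (b0 * p) * GL = r * b1.
Proof. by move=> <- <- c <-; rewrite -!mulrA c. Qed.

Lemma word_assoc2 (M : pzRingType) (k FL Gi b0 p b1 GL q r : M) :
  p * b0 = b1 * p -> p * Gi = q -> b1 * (k * FL) = k * FL * b1 -> k * (FL * q * GL) = r ->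
  k * FL * (p * b0) * Gi * GL = b1 * r.
Proof. by move=> -> <- c <-; rewrite -!mulrA; rewrite !mulrA in c *; rewrite c. Qed.

(** * Partial traces of words containing a permutation *)

Section TransferWord.
Context {C : numFieldType} {n N : nat}.
Local Notation tens k := (tensEnd C n k).
(** L and S hold the factors below and above i, f and g the operators in the products to the left
    and to the right of K^-; q is the operator at i multiplied by the permutation. *)
Variables (i : 'I_N) (L S : seq 'I_N) (f g : 'I_N -> tens 2) (q : tens 2) (K' K : tens 1).
Hypothesis uLS : uniq (L ++ i :: S).

Let o : 'I_N.+1 := ord0.
Let l (j : 'I_N) : 'I_N.+1 := lift ord0 j.
Let F j : tens N.+1 := leg2 o (l j) (f j).
Let G j : tens N.+1 := leg2 o (l j) (g j).
Let F' j : tens N.+1 := leg2 (l i) (l j) (f j).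
Let G' j : tens N.+1 := leg2 (l i) (l j) (g j).
Let P : tens N.+1 := leg2 o (l i) flip.
Let Q : tens N.+1 := leg2 o (l i) q.
Let FF j : tens N := leg2 i j (f j).
Let GG j : tens N := leg2 i j (g j).

Hypothesis braid : forall j, j \in L -> F j * Q * G j = G' j * Q * F' j.

Let ol j : o != l j. Proof. exact: neq_lift. Qed.
Let lo j : l j != o. Proof. by rewrite eq_sym ol. Qed.
Let ll j k : (l j == l k) = (j == k). Proof. exact: (inj_eq lift_inj). Qed.
Let iL j : j \in L -> i != j.
Proof.
move=> jL; apply: contraTneq uLS => ij; rewrite cat_uniq /= -ij in jL *.
by rewrite jL /= andbF.
Qed.
Let iS j : j \in S -> i != j.
Proof.
move=> jS; apply: contraTneq uLS => ij; rewrite cat_uniq /= -ij in jS *.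
by rewrite jS /= !andbF.
Qed.
Let LS j k : j \in L -> k \in S -> j != k.
Proof.
move=> jL kS; apply: contraTneq uLS => jk; rewrite cat_uniq.
have -> : has (in_mem^~ (mem L)) (i :: S) by apply/hasP; exists k; rewrite ?inE ?kS ?orbT// -jk.
by rewrite /= andbF.
Qed.

Let leg2_comm (a b c d : 'I_N.+1) (X Y : tens 2) : a != c -> a != d -> b != c -> b != d ->
  GRing.comm (leg2 a b X) (leg2 c d Y).
Proof. by move=> ac ad bc bd; apply: comm_legs => e e'; case: ifP => _; case: ifP. Qed.
Let leg12_comm (a c d : 'I_N.+1) (X : tens 1) (Y : tens 2) : a != c -> a != d ->
  GRing.comm (leg1 a X) (leg2 c d Y).
Proof. by move=> ac ad; apply: comm_legs => e f'; case: ifP. Qed.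
Let leg1_comm (a c : 'I_N.+1) (X Y : tens 1) : a != c -> GRing.comm (leg1 a X) (leg1 c Y).
Proof. by move=> ac; apply: comm_legs. Qed.

Let B0 := (\prod_(j <- S) F j) * leg1 o K * (\prod_(j <- rev S) G j).
Let B1 := (\prod_(j <- S) F' j) * leg1 (l i) K * (\prod_(j <- rev S) G' j).

Let PX (X : tens 2) j : j != i -> P * leg2 o (l j) X = leg2 (l i) (l j) X * P.
Proof.
move=> ji; have := flip_leg2 o (l j) X (ol i); rewrite tpermL tpermD ?ol//.
by rewrite ll eq_sym.
Qed.
Let PB : P * B0 = B1 * P.
Proof.
have PK : P * leg1 o K = leg1 (l i) K * P.
  by have := flip_leg1 o K (ol i); rewrite tpermL.
rewrite /B0 /B1 !mulrA (@prod_conj _ _ S F F' P); last first.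
  by move=> j jS; apply: (PX (f j)); rewrite eq_sym iS.
rewrite -!mulrA (mulrA P) PK -mulrA (@prod_conj _ _ (rev S) G G' P) ?mulrA//.
by move=> j; rewrite mem_rev => jS; apply: (PX (g j)); rewrite eq_sym iS.
Qed.

Let PB1 : P * B1 = B0 * P.
Proof.
have PP : P * P = 1 by exact: flip_flip (ol i).
by rewrite -[P * B1]mulr1 -PP mulrA -(mulrA P B1) -PB !mulrA PP mul1r.
Qed.

Let through : (\prod_(j <- L) F j) * Q * (\prod_(j <- rev L) G j) =
  (\prod_(j <- rev L) G' j) * Q * (\prod_(j <- L) F' j).
Proof.
apply: prod_through => //.
  by move: uLS; rewrite cat_uniq => /and3P[].
move=> j k jL kL jk; split; apply: leg2_comm; rewrite ?ol ?ll// ?(eq_sym j i) ?iL//.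
Qed.

Let B1L (H : 'I_N -> tens 2) (s : seq 'I_N) : {subset s <= L} ->
  GRing.comm B1 (\prod_(j <- s) leg2 o (l j) (H j)).
Proof.
move=> sL; apply/commr_sym/commrM; last first.
  apply: comm_prods => j k /sL jL; rewrite mem_rev => kS.
  by apply: leg2_comm; rewrite ?ol ?ll ?(LS jL kS)// eq_sym iL.
apply: commrM.
  by apply: comm_prods => j k /sL jL kS; apply: leg2_comm; rewrite ?ol ?ll ?(LS jL kS)// eq_sym iL.
by apply/commr_sym/comm_prod => j /sL jL; apply: leg12_comm; rewrite ?lo// ll iL.
Qed.

Let B1K : GRing.comm B1 (leg1 o K').
Proof.
apply/commr_sym; apply: commrM; [apply: commrM|].
- by apply: comm_prod => j _; apply: leg12_comm; rewrite ol.
- by apply: leg1_comm.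
- by apply: comm_prod => j _; apply: leg12_comm; rewrite ol.
Qed.

Let KG : GRing.comm (leg1 o K') (\prod_(j <- rev L) G' j).
Proof. by apply: comm_prod => j _; apply: leg12_comm; rewrite ol. Qed.

Definition mid := leg1 i (ptrace0 (leg1 ord0 K' *m q)).

Let KQ : leg1 o K' * Q = leg2 o (l i) (leg1 ord0 K' *m q).
Proof.
rewrite /leg2 legsM; last exact: leg2_inj.
by rewrite legs_leg1//; exact: leg2_inj.
Qed.

Let liftL (s : seq 'I_N) (H : 'I_N -> tens 2) :
  \prod_(j <- s) leg2 (l i) (l j) (H j) = legs (lift ord0) (\prod_(j <- s) leg2 i j (H j)).
Proof.
rewrite legs_prod; last exact: lift_inj.
by apply: eq_bigr => j _; rewrite legs_leg2//; exact: lift_inj.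
Qed.

Let W1 := (\prod_(j <- rev L) GG j) * mid * (\prod_(j <- L) FF j).
Let W2 := (\prod_(j <- S) FF j) * leg1 i K * (\prod_(j <- rev S) GG j).

Let B1E : B1 = legs (lift ord0) W2.
Proof.
rewrite /B1 /W2 !liftL -!mulmxE !legsM//; try exact: lift_inj.
by rewrite legs_leg1//; exact: lift_inj.
Qed.

Let trE (X Y : tens N) (Z : tens N.+1) :
  ptrace0 (legs (lift ord0) X * Z * legs (lift ord0) Y) = X * ptrace0 Z * Y.
Proof. by rewrite -!mulmxE ptrace0_legsr ptrace0_legsl. Qed.

(** After the exchange, only K' and Q touch the auxiliary factor; all other operators can leave the
    trace. *)
Let core : leg1 o K' * ((\prod_(j <- L) F j) * Q * (\prod_(j <- rev L) G j)) =
   legs (lift ord0) (\prod_(j <- rev L) GG j) * leg2 o (l i) (leg1 ord0 K' *m q) *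
   legs (lift ord0) (\prod_(j <- L) FF j).
Proof. by rewrite through -KQ !mulrA KG /G' /F' !liftL. Qed.

(** The permutation, in the right product, moves left across the dressed K^-, which lands on the
    factor i, and meets F_i to form Q. The dressed K^- then leaves to the right of the word. *)
Lemma ptrace0_flip_right : F i * P = Q ->
  ptrace0 (leg1 o K' * ((\prod_(j <- L) F j) * F i * (\prod_(j <- S) F j)) * leg1 o K *
    ((\prod_(j <- rev S) G j) * P * (\prod_(j <- rev L) G j))) = W1 * W2.
Proof.
move=> FQ.
have -> : leg1 o K' * ((\prod_(j <- L) F j) * F i * (\prod_(j <- S) F j)) * leg1 o K *
    ((\prod_(j <- rev S) G j) * P * (\prod_(j <- rev L) G j)) =
  leg1 o K' * (\prod_(j <- L) F j) * F i * (B0 * P) * (\prod_(j <- rev L) G j).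
  by rewrite /B0 !mulrA.
have c : B1 * (\prod_(j <- rev L) G j) = (\prod_(j <- rev L) G j) * B1.
  by apply: (B1L g) => j; rewrite mem_rev.
rewrite (word_assoc1 PB1 FQ c core) B1E.
rewrite -(mulrA _ (legs _ (\prod_(j <- L) _))) -!mulmxE -(legsM _ _ lift_inj) !mulmxE trE.
by rewrite ptrace0_leg2 /W1 /mid !mulrA.
Qed.

(** The mirror case: the permutation, in the left product, moves right to meet G_i, and the dressed
    K^- leaves to the left. Hence the opposite order of the two words. *)
Lemma ptrace0_flip_left : P * G i = Q ->
  ptrace0 (leg1 o K' * ((\prod_(j <- L) F j) * P * (\prod_(j <- S) F j)) * leg1 o K *
    ((\prod_(j <- rev S) G j) * G i * (\prod_(j <- rev L) G j))) = W2 * W1.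
Proof.
move=> GQ.
have -> : leg1 o K' * ((\prod_(j <- L) F j) * P * (\prod_(j <- S) F j)) * leg1 o K *
    ((\prod_(j <- rev S) G j) * G i * (\prod_(j <- rev L) G j)) =
  leg1 o K' * (\prod_(j <- L) F j) * (P * B0) * G i * (\prod_(j <- rev L) G j).
  by rewrite /B0 !mulrA.
have c : GRing.comm B1 (leg1 o K' * (\prod_(j <- L) F j)).
  by apply: commrM; [exact: B1K|apply: B1L].
rewrite (word_assoc2 PB GQ c core) B1E.
rewrite !mulrA -!mulmxE -(legsM _ _ lift_inj) !mulmxE trE.
by rewrite ptrace0_leg2.
Qed.

End TransferWord.

(** * Ordered products over the factors below and above i *)

Section OrdLists.
Context {N : nat}.
Implicit Types (i j : 'I_N).

Definition below i := [seq j : 'I_N <- enum 'I_N | (j < i)%N].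
Definition above i := [seq j : 'I_N <- enum 'I_N | (i < j)%N].

Lemma below_neq i j : j \in below i -> i != j.
Proof. by rewrite mem_filter => /andP[ji _]; rewrite neq_ltn ji orbT. Qed.

Lemma above_neq i j : j \in above i -> i != j.
Proof. by rewrite mem_filter => /andP[ji _]; rewrite neq_ltn ji. Qed.

Lemma enum_split i : enum 'I_N = below i ++ i :: above i.
Proof.
have iN := ltn_ord i.
have sE : enum 'I_N = take i (enum 'I_N) ++ i :: drop i.+1 (enum 'I_N).
  by rewrite -[LHS](cat_take_drop i) (drop_nth i) ?size_enum_ord// nth_ord_enum.
have tE : {in take i (enum 'I_N), forall j, (j < i)%N}.
  move=> j jt; have : (j : nat) \in take i (iota 0 N).
    by rewrite -val_enum_ord -map_take map_f.
  by rewrite take_iota mem_iota => /andP[_]; rewrite add0n leq_min => /andP[].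
have dE : {in drop i.+1 (enum 'I_N), forall j, (i < j)%N}.
  move=> j jt; have : (j : nat) \in drop i.+1 (iota 0 N).
    by rewrite -val_enum_ord -map_drop map_f.
  by rewrite drop_iota mem_iota add0n => /andP[].
have bE : below i = take i (enum 'I_N).
  rewrite /below {1}sE filter_cat /= ltnn (all_filterP _) ?(introT allP tE)//.
  rewrite (eq_in_filter (a2 := pred0)) ?filter_pred0 ?cats0// => j /dE ij.
  by rewrite /= ltnNge (ltnW ij).
have aE : above i = drop i.+1 (enum 'I_N).
  rewrite /above {1}sE filter_cat /= ltnn.
  rewrite (eq_in_filter (a2 := pred0)) ?filter_pred0 ?cat0s; last first.
    by move=> j /tE ij; rewrite /= ltnNge (ltnW ij).
  by rewrite (all_filterP _) ?(introT allP dE).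
by rewrite bE aE.
Qed.

Lemma rev_enum_ord : map (@rev_ord N) (enum 'I_N) = rev (enum 'I_N).
Proof.
case: N => [|M]; first by rewrite enum_ord0.
apply: (@eq_from_nth _ ord0); first by rewrite size_map size_rev.
move=> k; rewrite size_map size_enum_ord => kM.
rewrite (nth_map ord0) ?size_enum_ord// nth_rev ?size_enum_ord//.
apply: val_inj; rewrite /= !nth_enum_ord//.
by rewrite ltn_subrL.
Qed.

Lemma index_enum_ord : index_enum 'I_N = enum 'I_N.
Proof. by rewrite enumT; unlock index_enum. Qed.

Lemma prod_rev_ord (M : pzRingType) (P : pred 'I_N) (F : 'I_N -> M) :
  \prod_(j < N | P (rev_ord j)) F (rev_ord j) = \prod_(j <- rev (enum 'I_N) | P j) F j.
Proof. by rewrite -rev_enum_ord big_map index_enum_ord. Qed.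

Lemma prod_enum (M : pzRingType) i (F : 'I_N -> M) :
  \prod_(j <- enum 'I_N) F j = (\prod_(j <- below i) F j) * F i * (\prod_(j <- above i) F j).
Proof. by rewrite (enum_split i) big_cat big_cons /= mulrA. Qed.

Lemma prod_rev_enum (M : pzRingType) i (F : 'I_N -> M) :
  \prod_(j <- rev (enum 'I_N)) F j =
  (\prod_(j <- rev (above i)) F j) * F i * (\prod_(j <- rev (below i)) F j).
Proof. by rewrite (enum_split i) rev_cat rev_cons -cats1 !big_cat big_seq1 /=. Qed.

End OrdLists.

(** * Both specialisations at a fixed z *)

Section Pointwise.
Context {C : numFieldType} {n N : nat}.
Local Notation tens k := (tensEnd C n k).
Variables (Rm : C -> tens 2) (rho : C -> C) (kappa : C) (Kp Km : C -> tens 1) (z : 'rV[C]_N).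

Local Notation sp := (spectral z).
Local Notation pp j := (sp (j, true)).
Local Notation mm j := (sp (j, false)).
Local Notation up j := (lift ord0 j).

Hypothesis z0 : forall i, z 0 i != 0.
Hypothesis kappa0 : kappa != 0.
Hypothesis R1 : Rm 1 = kappa *: flip.
Hypothesis HU : forall j k, j != k -> unitary_at Rm rho (sp j / sp k).
Hypothesis HY : forall j k l, j != k -> j.1 != l.1 -> k.1 != l.1 ->
  yang_baxter_at Rm (sp j / sp l) (sp k / sp l).

Notation Rleg := (Rleg Rm).

(** The transport matrix with its arguments of R written as quotients of spectral values, the form
    in which the hypotheses are stated: z_j z_i is z_j over the inverse of z_i. *)
Definition qKZ_word i : tens N :=
  (\prod_(j <- rev (below i)) Rleg i j (pp i / pp j)) * leg1 i (Kp (z 0 i)) *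
  (\prod_(j <- below i) Rleg j i (pp j / mm i)) * (\prod_(j <- above i) Rleg j i (pp j / mm i)) *
  leg1 i (Km (z 0 i)) * (\prod_(j <- rev (above i)) invmx (Rleg j i (pp j / pp i))).

Lemma qKZ_transportE i : qKZ_transport Rm Kp Km i z = qKZ_word i.
Proof.
rewrite /qKZ_transport /qKZ_word !mulmxE.
rewrite (_ : \big[mulmx/1%:M]_(j < N | (rev_ord j < i)%N) _ =
   \prod_(j <- rev (below i)) Rleg i j (pp i / pp j)); last first.
  by rewrite /below -filter_rev big_filter -(prod_rev_ord (fun j => (j < i)%N)).
rewrite (_ : \big[mulmx/1%:M]_(j < N | (i < rev_ord j)%N) _ =
   \prod_(j <- rev (above i)) invmx (Rleg j i (pp j / pp i))); last first.
  rewrite /above -filter_rev big_filter.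
  exact: (prod_rev_ord (fun j => (i < j)%N) (fun j => invmx (Rleg j i (pp j / pp i)))).
rewrite (_ : \big[mulmx/1%:M]_(j < N | (j < i)%N) _ =
   \prod_(j <- below i) Rleg j i (pp j / mm i)); last first.
  rewrite /below big_filter -index_enum_ord; apply: eq_bigr => j _.
  by rewrite /Rleg /spectral /= invrK.
rewrite (_ : \big[mulmx/1%:M]_(j < N | (i < j)%N) _ =
   \prod_(j <- above i) Rleg j i (pp j / mm i)); first by [].
rewrite /above big_filter -index_enum_ord; apply: eq_bigr => j _.
by rewrite /Rleg /spectral /= invrK.
Qed.

Lemma transferE x : transfer Rm Kp Km x z =
  ptrace0 (leg1 ord0 (phi (tildeR Rm) Kp x) *
    (\prod_(j <- enum 'I_N) invmx (Rleg ord0 (up j) (x * z 0 j)^-1)) *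
    leg1 ord0 (Km x) *
    (\prod_(j <- rev (enum 'I_N)) Rleg ord0 (up j) (x / z 0 j))).
Proof.
rewrite /transfer !mulmxE; congr (ptrace0 (_ * _ * _ * _)).
  by rewrite -index_enum_ord.
by rewrite -(prod_rev_ord predT).
Qed.

Let neqj (i j : 'I_N) : i != j -> forall s t : bool, (i, s) != (j, t).
Proof. by move=> ij s t; rewrite xpair_eqE (negbTE ij). Qed.

Let mp (i j : 'I_N) : (i, false) != (j, true).
Proof. by rewrite xpair_eqE andbF. Qed.
Let pm (i j : 'I_N) : (i, true) != (j, false).
Proof. by rewrite xpair_eqE andbF. Qed.

Let o (j : 'I_N) : (ord0 : 'I_N.+1) != up j. Proof. exact: neq_lift. Qed.
Let l_neq (i j : 'I_N) : i != j -> up i != up j.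
Proof. by move=> ij; rewrite (inj_eq lift_inj). Qed.
Let flip0 (i j : 'I_N) (X : tens 2) : i != j ->
  leg2 ord0 (up i) flip * leg2 ord0 (up j) X =
  leg2 (up i) (up j) X * leg2 ord0 (up i) flip :> tens N.+1.
Proof.
move=> ij; have := flip_leg2 ord0 (up j) X (o i).
by rewrite tpermL (tpermD (o j) (l_neq ij)).
Qed.
Let flipi (i j : 'I_N) (X : tens 2) : i != j ->
  leg2 ord0 (up i) flip * leg2 (up i) (up j) X =
  leg2 ord0 (up j) X * leg2 ord0 (up i) flip :> tens N.+1.
Proof.
move=> ij; have := flip_leg2 (up i) (up j) X (o i).
by rewrite tpermR (tpermD (o j) (l_neq ij)).
Qed.
Let uniqLS (i : 'I_N) : uniq (below i ++ i :: above i).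
Proof. by rewrite -enum_split enum_uniq. Qed.

(** kappa comes from R(1); the inverses of rho from inverting the R_0j at 1/(z_i z_j), that for j =
    i appearing when the trace closes on K'; the last product from writing R_ij as the inverse of
    R_ji above i. *)
Definition transfer_scalar i : C := kappa * (\prod_(j < N) (rho (mm i / pp j))^-1) *
  (\prod_(j <- above i) rho (pp j / pp i)).

Lemma invmx_flip m (a b : 'I_m) : a != b -> invmx (leg2 a b flip : tens m) = leg2 a b flip.
Proof.
move=> ab; have F := @flip_flip C n _ _ _ ab; have [u _] := mulmx1_unit F.
by apply: (can_inj (mulKmx u)); rewrite mulmxV// F.
Qed.

Lemma invmx_scale (c : C) m (X : tens m) : c != 0 -> X \in unitmx ->
  invmx (c *: X) = c^-1 *: invmx X.
Proof. by move=> c0 Xu; rewrite invmxZ// unitmxZ// unitfE. Qed.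

(* At x = z_i regularity turns R_0i(x / z_i) into the permutation P_0i, which carries
   the auxiliary factor to the i-th one; Yang-Baxter moves the factors below i through. *)
Lemma transfer_at i : transfer Rm Kp Km (z 0 i) z = transfer_scalar i *: qKZ_word i.
Proof.
have i_pm := mp i i.
have U := HU i_pm.
pose f j := invmx (Rm (mm i / pp j)); pose g j := Rm (pp i / pp j).
have fu j : Rm (mm i / pp j) \in unitmx by exact: UN_unit (HU (mp i j)).
have FE m (a b : 'I_m) j : a != b -> leg2 a b (f j) = invmx (Rleg a b (mm i / pp j)).
  by move=> ab; rewrite /leg2 legsV//; exact: leg2_inj.
pose q := invmx (Rm (mm i / pp i)) *m flip.
have FQ : leg2 ord0 (up i) (f i) * leg2 ord0 (up i) flip = leg2 ord0 (up i) q.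
  by rewrite /leg2 legsM//; exact: leg2_inj.
have braid j : j \in below i ->
   leg2 ord0 (up j) (f j) * leg2 ord0 (up i) q * leg2 ord0 (up j) (g j) =
   leg2 (up i) (up j) (g j) * leg2 ord0 (up i) q *
     leg2 (up i) (up j) (f j).
  move=> /below_neq ij; rewrite -FQ (FE _ _ _ _ (o j)) (FE _ _ _ _ (o i)) (FE _ _ _ _ (l_neq ij)).
  (* Yang-Baxter on the legs 0, i, j with the values 1/z_i, z_i, z_j; the exchange relation is its
     form with two factors inverted. *)
  have Y : Rleg ord0 (up i) (mm i / pp i) * Rleg ord0 (up j) (mm i / pp j) *
      leg2 (up i) (up j) (g j) = leg2 (up i) (up j) (g j) *
      Rleg ord0 (up j) (mm i / pp j) * Rleg ord0 (up i) (mm i / pp i).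
    exact: (Rleg_braid (o i) (o j) (l_neq ij) (spectral_neq0 (j, true) z0) (@HY (i, false) (i, true) (j, true) i_pm ij ij)).
  have P1 := flip0 (g j) ij.
  have P2 : leg2 ord0 (up i) flip * invmx (Rleg (up i) (up j) (mm i / pp j)) =
      invmx (Rleg ord0 (up j) (mm i / pp j)) * leg2 ord0 (up i) flip.
    rewrite -(FE _ _ _ _ (o j)) -(FE _ _ _ _ (l_neq ij)); exact: flipi.
  have Uj : Rleg ord0 (up j) (mm i / pp j) \in unitmx by apply: legs_unit => //; exact: leg2_inj.
  have Ui : Rleg ord0 (up i) (mm i / pp i) \in unitmx by apply: legs_unit => //; exact: leg2_inj.
  move: P1 P2 Y; set P := leg2 _ _ flip; set A := Rleg ord0 (up j) (mm i / pp j) in Uj *.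
  set B := Rleg ord0 (up i) (mm i / pp i) in Ui *.
  set D := leg2 (up i) (up j) (g j); set Gj := leg2 _ _ (g j).
  set E := invmx (Rleg _ _ _).
  move=> P1 P2 Y.
  have AV : invmx A * A = 1 by exact: mulVmx.
  have VA : A * invmx A = 1 by exact: mulmxV.
  have BV : invmx B * B = 1 by exact: mulVmx.
  have VB : B * invmx B = 1 by exact: mulmxV.
  rewrite -!mulrA P1 P2 !mulrA; congr (_ * P).
  have -> : invmx A * invmx B * D = invmx A * invmx B * (D * A * B) * invmx B * invmx A.
    by rewrite -!mulrA (mulrA B) VB mul1r VA mulr1.
  by rewrite -Y -!mulrA (mulrA (invmx B)) BV mul1r (mulrA (invmx A)) AV mul1r.
have Gi : leg2 ord0 (up i) (g i) = kappa *: leg2 ord0 (up i) flip.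
  by rewrite /g divff ?spectral_neq0// R1 /leg2 legsZ.
rewrite transferE.
have -> : \prod_(j <- enum 'I_N) invmx (Rleg ord0 (up j) (z 0 i * z 0 j)^-1) =
  \prod_(j <- enum 'I_N) leg2 ord0 (up j) (f j).
  by apply: eq_bigr => j _; rewrite FE// invfM.
have -> : \prod_(j <- rev (enum 'I_N)) Rleg ord0 (up j) (z 0 i / z 0 j) =
  \prod_(j <- rev (enum 'I_N)) leg2 ord0 (up j) (g j) by [].
rewrite (prod_enum i) (prod_rev_enum i) Gi scale_mulr scale_mull scale_mulr ptrace0Z.
have tw := ptrace0_flip_right (phi (tildeR Rm) Kp (z 0 i)) (Km (z 0 i)) (uniqLS i) braid FQ.
cbv beta in tw; rewrite tw {tw}.
(* By unitarity the inverse of R(z_i^-2) times P is P R(z_i^2) up to rho, so the trace against K' is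
   phi of R applied to K', that is K^+. *)
have qE : ptrace0 (leg1 ord0 (phi (tildeR Rm) Kp (z 0 i)) *m q) =
    (rho (mm i / pp i))^-1 *: Kp (z 0 i).
  have n01 : ord0 != ord_max :> 'I_2 by [].
  have -> : q = (rho (mm i / pp i))^-1 *: (flip *m Rm (z 0 i ^+ 2)).
    have := RlegV n01 U; rewrite /Rleg leg2_id /q => ->.
    rewrite -scalemxAl; congr (_ *: _); rewrite -(leg2_id flip).
    have := flip_leg2 ord0 ord_max (Rm (pp i / mm i)) n01; rewrite tpermL tpermR => <-.
    by rewrite !leg2_id /spectral /= invrK expr2.
  by rewrite -scalemxAr ptrace0Z mulmxA -/(phi Rm (phi (tildeR Rm) Kp) (z 0 i)) phi_phi_tilde//;
    move: (UN_tunit (HU (pm i i))); rewrite /spectral /= invrK expr2.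
rewrite /mid qE.
(* Unitarity brings both kinds of factors to the form they have in the transport matrix. *)
have FFE j : i != j -> leg2 i j (f j) = (rho (mm i / pp j))^-1 *: Rleg j i (pp j / mm i).
  by move=> ij; rewrite (FE _ _ _ _ ij) (RlegV ij (HU (mp i j))).
have GGE j : i != j -> leg2 i j (g j) = rho (pp j / pp i) *: invmx (Rleg j i (pp j / pp i)).
  move=> ij; have ji : j != i by rewrite eq_sym.
  have Uj := HU (neqj ji true true).
  by rewrite (RlegV ji Uj) scalerA divff ?scale1r// (UN_rho Uj).
have EL (s : seq 'I_N) (H H' : 'I_N -> tens N) : {in s, forall j, i != j} ->
    (forall j, i != j -> H j = H' j) -> \prod_(j <- s) H j = \prod_(j <- s) H' j.
  by move=> si HH; apply: eq_big_seq => j js; apply: HH; apply: si.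
rewrite (EL (below i) _ _ _ FFE); last by move=> j /below_neq.
rewrite (EL (above i) _ _ _ FFE); last by move=> j /above_neq.
rewrite (EL (rev (above i)) _ _ _ GGE); last by move=> j; rewrite mem_rev => /above_neq.
rewrite !prodZ /leg1 legsZ -!/(leg1 _ _).
rewrite !(scale_mulr, scale_mull, scalerA) /qKZ_word.
rewrite -[\prod_(j <- rev (below i)) leg2 i j (g j)]/(\prod_(j <- rev (below i)) Rleg i j (pp i / pp j)).
rewrite !mulrA; congr (_ *: _).
rewrite /transfer_scalar index_enum_ord (prod_enum i).
have -> : \prod_(j <- rev (above i)) rho (pp j / pp i) = \prod_(j <- above i) rho (pp j / pp i).
  by apply: perm_big; rewrite perm_rev.
by ring.
Qed.

(** [mup] and [mum] are the boundary scalars at z_i. The first two products come from cancelling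
    R_ji against R_ij, the last one from the inverses of R_ij above i. *)
Definition transfer_inv_scalar (mup mum : C) i : C := kappa^-1 * mup * mum *
  (\prod_(j <- below i) rho (pp j / mm i)) * (\prod_(j <- above i) rho (pp j / mm i)) *
  (\prod_(j <- above i) (rho (pp i / pp j))^-1).

(** Here the factor R_0i(1/(x z_i)) is R(1), and it occurs inverted, hence the inverse of kappa. The
    operator q is P R(z_i^-2) as it stands, and the trace gives K^+(1/z_i) with no further
    scalar. *)
Lemma transfer_at_inv i : transfer Rm Kp Km (z 0 i)^-1 z = kappa^-1 *:
  ((\prod_(j <- above i) invmx (Rleg i j (pp i / pp j))) * leg1 i (Km (z 0 i)^-1) *
   (\prod_(j <- rev (above i)) Rleg i j (mm i / pp j)) *
   ((\prod_(j <- rev (below i)) Rleg i j (mm i / pp j)) * leg1 i (Kp (z 0 i)^-1) *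
    (\prod_(j <- below i) invmx (Rleg i j (pp i / pp j))))).
Proof.
have i_pm := mp i i.
pose f j := invmx (Rm (pp i / pp j)); pose g j := Rm (mm i / pp j).
have fu j : i != j -> Rm (pp i / pp j) \in unitmx by move=> ij; exact: UN_unit (HU (neqj ij true true)).
have FE m (a b : 'I_m) j : a != b -> i != j -> leg2 a b (f j) = invmx (Rleg a b (pp i / pp j)).
  by move=> ab ij; rewrite /leg2 legsV//; [exact: leg2_inj|exact: fu].
pose q := flip *m Rm (mm i / pp i).
have GQ : leg2 ord0 (up i) flip * leg2 ord0 (up i) (g i) = leg2 ord0 (up i) q.
  by rewrite /leg2 legsM//; exact: leg2_inj.
have braid j : j \in below i ->
   leg2 ord0 (up j) (f j) * leg2 ord0 (up i) q * leg2 ord0 (up j) (g j) =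
   leg2 (up i) (up j) (g j) * leg2 ord0 (up i) q *
     leg2 (up i) (up j) (f j).
  move=> /below_neq ij; rewrite -GQ (FE _ _ _ _ (o j) ij) (FE _ _ _ _ (l_neq ij) ij).
  have io : up i != ord0 by rewrite eq_sym.
  (* Yang-Baxter again for 1/z_i, z_i, z_j, with the first two legs exchanged: i, 0, j. *)
  have Y : Rleg (up i) ord0 (mm i / pp i) * leg2 (up i) (up j) (g j) *
      Rleg ord0 (up j) (pp i / pp j) = Rleg ord0 (up j) (pp i / pp j) *
      leg2 (up i) (up j) (g j) * Rleg (up i) ord0 (mm i / pp i).
    exact: (Rleg_braid io (l_neq ij) (o j) (spectral_neq0 (j, true) z0) (@HY (i, false) (i, true) (j, true) i_pm ij ij)).
  have P1 := flip0 (g j) ij.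
  have P2 : leg2 ord0 (up i) flip * invmx (Rleg (up i) (up j) (pp i / pp j)) =
      invmx (Rleg ord0 (up j) (pp i / pp j)) * leg2 ord0 (up i) flip.
    rewrite -(FE _ _ _ _ (o j) ij) -(FE _ _ _ _ (l_neq ij) ij); exact: flipi.
  have P3 : leg2 ord0 (up i) flip * leg2 ord0 (up i) (g i) =
      Rleg (up i) ord0 (mm i / pp i) * leg2 ord0 (up i) flip.
    by have := flip_leg2 ord0 (up i) (g i) (o i); rewrite tpermL tpermR.
  have Uj : Rleg ord0 (up j) (pp i / pp j) \in unitmx.
    by apply: legs_unit; [exact: leg2_inj|exact: fu].
  move: P1 P2 P3 Y; set P := leg2 _ _ flip; set A := Rleg ord0 (up j) (pp i / pp j) in Uj *.
  set B := Rleg (up i) ord0 (mm i / pp i).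
  set D := leg2 (up i) (up j) (g j); set Gj := leg2 ord0 (up j) (g j).
  set Gi := leg2 ord0 (up i) (g i).
  set E := invmx (Rleg _ _ _).
  move=> P1 P2 P3 Y.
  have AV : invmx A * A = 1 by exact: mulVmx.
  have VA : A * invmx A = 1 by exact: mulmxV.
  have BD : invmx A * B * D = D * B * invmx A.
    have -> : invmx A * B * D = invmx A * (B * D * A) * invmx A by rewrite -!mulrA VA mulr1.
    by rewrite Y !mulrA AV mul1r.
  by rewrite P3 !mulrA -(mulrA _ P Gj) P1 !mulrA BD -!mulrA -P2.
have Fi : leg2 ord0 (up i) (invmx (Rm 1)) = kappa^-1 *: leg2 ord0 (up i) flip.
  have n01 : ord0 != ord_max :> 'I_2 by [].
  have fl : (flip : tens 2) \in unitmx.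
    by have := @flip_flip C n _ _ _ n01; rewrite leg2_id => /mulmx1_unit[].
  rewrite R1 invmx_scale//; rewrite -{1}(leg2_id flip) invmx_flip// leg2_id.
  by rewrite /leg2 legsZ.
rewrite transferE.
have -> : \prod_(j <- enum 'I_N) invmx (Rleg ord0 (up j) ((z 0 i)^-1 * z 0 j)^-1) =
  (\prod_(j <- below i) leg2 ord0 (up j) (f j)) *
   (kappa^-1 *: leg2 ord0 (up i) flip) *
  (\prod_(j <- above i) leg2 ord0 (up j) (f j)).
  have E j : invmx (Rleg ord0 (up j) ((z 0 i)^-1 * z 0 j)^-1) =
     invmx (Rleg ord0 (up j) (pp i / pp j)) by rewrite invfM invrK.
  rewrite (eq_bigr (fun j => invmx (Rleg ord0 (up j) (pp i / pp j)))); last by move=> j _; exact: E.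
  rewrite (prod_enum i); congr (_ * _ * _).
  - by apply: eq_big_seq => j /below_neq ij; rewrite (FE _ _ _ _ (o j) ij).
  - rewrite divff ?spectral_neq0// -Fi /Rleg /leg2 legsV//; first exact: leg2_inj.
    rewrite R1 unitmxZ ?unitfE//.
    have n01 : ord0 != ord_max :> 'I_2 by [].
    by have := @flip_flip C n _ _ _ n01; rewrite leg2_id => /mulmx1_unit[].
  - by apply: eq_big_seq => j /above_neq ij; rewrite (FE _ _ _ _ (o j) ij).
have -> : \prod_(j <- rev (enum 'I_N)) Rleg ord0 (up j) ((z 0 i)^-1 / z 0 j) =
  \prod_(j <- rev (enum 'I_N)) leg2 ord0 (up j) (g j) by [].
rewrite (prod_rev_enum i) !(scale_mulr, scale_mull) ptrace0Z.
have tw := ptrace0_flip_left (phi (tildeR Rm) Kp (z 0 i)^-1) (Km (z 0 i)^-1) (uniqLS i) braid GQ.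
cbv beta in tw; rewrite tw {tw}; congr (_ *: _).
have -> : mid i q (phi (tildeR Rm) Kp (z 0 i)^-1) = leg1 i (Kp (z 0 i)^-1).
  rewrite /mid; congr (leg1 i _).
  have sq : mm i / pp i = (z 0 i)^-1 ^+ 2 by rewrite /spectral expr2.
  rewrite /q sq mulmxA -/(phi Rm (phi (tildeR Rm) Kp) (z 0 i)^-1) phi_phi_tilde//.
  by rewrite -sq; exact: UN_tunit (HU (mp i i)).
have EL (s : seq 'I_N) : {in s, forall j, i != j} ->
    \prod_(j <- s) leg2 i j (f j) = \prod_(j <- s) invmx (Rleg i j (pp i / pp j)).
  by move=> si; apply: eq_big_seq => j js; rewrite FE// si.
rewrite (EL (below i)); last by move=> j /below_neq.
by rewrite (EL (above i)) // => j /above_neq.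
Qed.

(** The second word mirrors the first, so the cancellation proceeds from the middle outwards, each
    scalar leaving at once. *)
Lemma word_cancel m (a kp b c km d a' kp' b' c' km' d' : 'M[C]_m) (s1 s2 s3 s4 s5 s6 : C) :
  d * d' = s1 *: 1%:M -> km * km' = s2 *: 1%:M -> c * c' = s3 *: 1%:M ->
  b * b' = s4 *: 1%:M -> kp * kp' = s5 *: 1%:M -> a * a' = s6 *: 1%:M ->
  a * kp * b * c * km * d * (d' * km' * c' * (b' * kp' * a')) =
  (s1 * s2 * s3 * s4 * s5 * s6) *: 1%:M.
Proof.
move=> h1 h2 h3 h4 h5 h6; rewrite -!mulrA.
rewrite (mulrA d) h1 scale_mull mul1r scale_mulr (mulrA km) h2 scale_mull mul1r.
rewrite !scale_mulr (mulrA c) h3 scale_mull mul1r !scale_mulr (mulrA b) h4 scale_mull mul1r.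
rewrite !scale_mulr (mulrA kp) h5 scale_mull mul1r !scale_mulr h6 !scalerA.
by congr (_ *: _); ring.
Qed.

Lemma qKZ_word_transfer_inv mup mum i :
  Kp (z 0 i) *m Kp (z 0 i)^-1 = mup *: 1%:M -> Km (z 0 i) *m Km (z 0 i)^-1 = mum *: 1%:M ->
  qKZ_word i *m transfer Rm Kp Km (z 0 i)^-1 z = transfer_inv_scalar mup mum i *: 1%:M.
Proof.
move=> kp km; rewrite transfer_at_inv mulmxE scale_mulr.
have LM (K K' : tens 1) (c : C) : K *m K' = c *: 1%:M -> leg1 i K * leg1 i K' = c *: 1%:M.
  by move=> KK; rewrite /leg1 -mulmxE -legsM ?KK ?legsZ ?legs1// => a b _; rewrite (ord1 a) (ord1 b).
have cd j : j \in above i -> invmx (Rleg j i (pp j / pp i)) * invmx (Rleg i j (pp i / pp j)) =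
    (rho (pp i / pp j))^-1 *: 1%:M.
  move=> /above_neq ij; have ji : j != i by rewrite eq_sym.
  have U := HU (neqj ij true true); have U' := HU (neqj ji true true).
  rewrite (RlegV ij U) scale_mulr; congr (_ *: _).
  by apply: mulVmx; exact: Rleg_unit ji U'.
have cc j : i != j -> Rleg j i (pp j / mm i) * Rleg i j (mm i / pp j) = rho (pp j / mm i) *: 1%:M.
  by move=> ij; apply: Rleg_unitarity; [rewrite eq_sym|exact: HU (pm j i)].
have ca j : j \in below i -> Rleg i j (pp i / pp j) * invmx (Rleg i j (pp i / pp j)) = 1 *: 1%:M.
  by move=> /below_neq ij; rewrite scale1r; apply: mulmxV; exact: Rleg_unit ij (HU (neqj ij true true)).
have ccs s : {in s, forall j, i != j} -> (\prod_(j <- s) Rleg j i (pp j / mm i)) *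
    (\prod_(j <- rev s) Rleg i j (mm i / pp j)) = (\prod_(j <- rev s) rho (pp j / mm i)) *: 1%:M.
  move=> si; rewrite -{1}(revK s); apply: prod_cancel => j; rewrite mem_rev => js.
  exact/cc/si.
have ha := ccs _ (@above_neq _ i); have hb := ccs _ (@below_neq _ i).
rewrite (word_cancel (prod_cancel cd) (LM _ _ _ km) ha hb (LM _ _ _ kp) (prod_cancel ca)).
rewrite scalerA; congr (_ *: _); rewrite /transfer_inv_scalar.
have E (s : seq 'I_N) (F : 'I_N -> C) : \prod_(j <- rev s) F j = \prod_(j <- s) F j.
  by apply: perm_big; rewrite perm_rev.
by rewrite !E big1_eq; ring.
Qed.

End Pointwise.

(** * Commutation of the transport matrices *)

(* A solution A, B of the reflection equation dressed with p, q is again a solution. *)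
Lemma dress_reflection (M : pzRingType) (X X' Y Y' A B p p' q q' : M) :
  X * A * Y * B = B * Y' * A * X' ->
  p' * Y * q = q * Y * p' -> X * p * q = q * p * X ->
  q' * Y' * p = p * Y' * q' -> X' * p' * q' = q' * p' * X' ->
  GRing.comm A q -> GRing.comm A q' -> GRing.comm B p -> GRing.comm B p' ->
  X * (p * A * p') * Y * (q * B * q') = (q * B * q') * Y' * (p * A * p') * X'.
Proof.
move=> re r1 r2 r3 r4 Aq Aq' Bp Bp'.
have -> : X * (p * A * p') * Y * (q * B * q') = X * p * A * (p' * Y * q) * B * q'.
  by rewrite !mulrA.
have -> : (q * B * q') * Y' * (p * A * p') * X' = q * B * (q' * Y' * p) * A * p' * X'.
  by rewrite !mulrA.
rewrite r1 r3.
have -> : X * p * A * (q * Y * p') * B * q' = (X * p * q) * A * Y * B * p' * q'.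
  by rewrite -!mulrA (mulrA A q) Aq (mulrA p' B) -Bp' !mulrA.
have -> : q * B * (p * Y' * q') * A * p' * X' = q * p * B * Y' * A * (q' * p' * X').
  by rewrite -!mulrA (mulrA B p) Bp (mulrA q' A) -Aq' !mulrA.
rewrite r2 -r4.
have -> : q * p * X * A * Y * B * p' * q' = q * p * (X * A * Y * B) * p' * q' by rewrite !mulrA.
by rewrite re !mulrA.
Qed.

(** Gives the Yang-Baxter relations in which one of the R-matrices is inverted. *)
Lemma swap_inv (M : pzRingType) (q q' p Y : M) : q' * q = 1 -> q * q' = 1 ->
  q * p * Y = Y * p * q -> q' * Y * p = p * Y * q'.
Proof.
move=> V V' H; have -> : q' * Y * p = q' * (Y * p * q) * q' by rewrite -!mulrA V' mulr1.
by rewrite -H !mulrA V mul1r.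
Qed.

(** The case of adjacent factors: A and B are dressed K^+ at i and j, U and W dressed K^-. The
    hypotheses [l1] and [l2] are their left and right reflection equations, joined by R_ji and its
    inverse. *)
Lemma commute_dressed (M : pzRingType) (A B U W pj pj0 pj' r X' : M) :
  pj' * pj0 = 1 -> pj0 * pj' = 1 -> GRing.comm U B -> GRing.comm W A ->
  pj0 * B * r * A = A * pj * B * X' ->
  X' * W * pj * U = U * r * W * pj0 ->
  (A * pj * U * pj') * (pj0 * B * r * W) = (pj0 * B * r * W) * (A * pj * U * pj').
Proof.
move=> V V' UB WA l1 l2.
have -> : (A * pj * U * pj') * (pj0 * B * r * W) = A * pj * U * (pj' * pj0) * B * r * W.
  by rewrite !mulrA.
rewrite V mulr1.
have -> : (pj0 * B * r * W) * (A * pj * U * pj') = pj0 * B * r * A * W * pj * U * pj'.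
  by rewrite -!mulrA (mulrA W A) WA !mulrA.
rewrite l1.
have -> : A * pj * B * X' * W * pj * U * pj' = A * pj * B * (X' * W * pj * U) * pj'.
  by rewrite !mulrA.
by rewrite l2 -!mulrA V' mulr1 (mulrA U B) UB !mulrA.
Qed.

(** With T the product of the R_jk and PM, PM0 those of the R_ki over the k between i and j,
    Yang-Baxter exchanges the dressing by R_ji with that by the intermediate factors, at the price
    of a conjugation by T. *)
Lemma conj_dress (M : pzRingType) (T T' pj pj0 pj' PM PM0 PM' D : M) :
  T * T' = 1 -> T' * T = 1 -> pj0 * pj' = 1 -> pj' * pj0 = 1 -> PM0 * PM' = 1 -> PM' * PM0 = 1 ->
  PM * pj * T = T * pj * PM -> PM0 * pj0 * T = T * pj0 * PM0 -> GRing.comm D T ->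
  PM * (pj * D * pj') * PM' = T * (pj * (PM * D * PM') * pj') * T'.
Proof.
move=> TT' T'T p1 p2 q1 q2 E1 E2 DT.
have F1 : PM * pj = T * pj * PM * T' by rewrite -E1 -!mulrA TT' mulr1.
have F2 : pj' * PM' * T = T * PM' * pj'.
  have -> : pj' * PM' * T = pj' * PM' * (T * pj0 * PM0) * PM' * pj'.
    by rewrite -!mulrA (mulrA PM0) q1 mul1r p1 mulr1.
  by rewrite -E2 -!mulrA (mulrA PM') q2 mul1r (mulrA pj') p2 mul1r.
have F3 : pj' * PM' = T * PM' * pj' * T' by rewrite -F2 -!mulrA TT' mulr1.
have -> : PM * (pj * D * pj') * PM' = (PM * pj) * D * (pj' * PM') by rewrite !mulrA.
rewrite F1 F3 -!mulrA (mulrA D T) DT -(mulrA T D) (mulrA T' T) T'T mul1r.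
by rewrite !mulrA.
Qed.

Lemma conj_mull (M : pzRingType) (A T T' x y w : M) : A * T = T * A ->
  A * (T * (x * y * w) * T') = T * (A * x * y * w) * T'.
Proof. by move=> AT; rewrite !mulrA AT. Qed.

Lemma prod_unitmx (C : fieldType) (d : nat) (I : eqType) (s : seq I) (F : I -> 'M[C]_d) :
  (forall k, k \in s -> F k \in unitmx) -> \prod_(k <- s) F k \in unitmx.
Proof.
move=> Fu; rewrite big_seq; apply: (big_ind (fun X : 'M[C]_d => X \in unitmx)) => //.
  exact: unitmx1.
by move=> X Y Xu Yu; rewrite -mulmxE unitmx_mul Xu.
Qed.

Section Commute.
Context {C : numFieldType} {n N : nat}.
Local Notation tens k := (tensEnd C n k).
Variables (Rm : C -> tens 2) (rho : C -> C) (Kp Km : C -> tens 1) (z : 'rV[C]_N).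

Local Notation sp := (spectral z).
Local Notation pp j := (sp (j, true)).
Local Notation mm j := (sp (j, false)).

Hypothesis z0 : forall i, z 0 i != 0.
Hypothesis HU : forall j k, j != k -> unitary_at Rm rho (sp j / sp k).
Hypothesis HY : forall j k l, j != k -> j.1 != l.1 -> k.1 != l.1 ->
  yang_baxter_at Rm (sp j / sp l) (sp k / sp l).

Definition left_reflection_at (x y : C) :=
  let R12 x := leg2 ord0 ord_max (Rm x) in
  let R21 x := leg2 ord_max ord0 (Rm x) in
  let K1 x : tens 2 := leg1 ord0 (Kp x) in
  let K2 x : tens 2 := leg1 ord_max (Kp x) in
    R12 (x / y) *m K1 x *m R21 (x * y) *m K2 y =
    K2 y *m R12 (x * y) *m K1 x *m R21 (x / y).

Definition right_reflection_at (x y : C) :=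
  let R12 x := leg2 ord0 ord_max (Rm x) in
  let R21 x := leg2 ord_max ord0 (Rm x) in
  let K1 x : tens 2 := leg1 ord0 (Km x) in
  let K2 x : tens 2 := leg1 ord_max (Km x) in
    R21 (x / y) *m K1 x *m R12 (x * y) *m K2 y =
    K2 y *m R21 (x * y) *m K1 x *m R12 (x / y).

Hypothesis HL : forall i j, i != j -> left_reflection_at (z 0 i) (z 0 j).
Hypothesis HR : forall i j, i != j -> right_reflection_at (z 0 i) (z 0 j).

Notation Rleg := (Rleg Rm).

Let neqj (i j : 'I_N) : i != j -> forall s t : bool, (i, s) != (j, t).
Proof. by move=> ij s t; rewrite xpair_eqE (negbTE ij). Qed.

Let ybe (a b c : 'I_N) (s t u : bool) : a != b -> a != c -> b != c ->
  Rleg a b (sp (a, s) / sp (b, t)) * Rleg a c (sp (a, s) / sp (c, u)) * Rleg b c (sp (b, t) / sp (c, u)) =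
  Rleg b c (sp (b, t) / sp (c, u)) * Rleg a c (sp (a, s) / sp (c, u)) * Rleg a b (sp (a, s) / sp (b, t)).
Proof.
move=> ab ac bc; apply: Rleg_braid => //; first exact: spectral_neq0.
by apply: (@HY (a, s) (b, t) (c, u)) => //; exact: neqj.
Qed.

Let mmE (a b : 'I_N) : mm b / mm a = pp a / pp b.
Proof. by rewrite /spectral /= invrK mulrC. Qed.
Let pmE (a b : 'I_N) : pp b / mm a = pp a / mm b.
Proof. by rewrite /spectral /= !invrK mulrC. Qed.

(* K^- seen by the factor a through the factors in s, and likewise for K^+: both
   dressed K-matrices again satisfy reflection equations. *)
Definition dressm (s : seq 'I_N) (a : 'I_N) : tens N :=
  (\prod_(k <- s) Rleg k a (pp k / mm a)) * leg1 a (Km (z 0 a)) *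
  (\prod_(k <- rev s) invmx (Rleg k a (pp k / pp a))).

Definition dressp (s : seq 'I_N) (a : 'I_N) : tens N :=
  (\prod_(k <- rev s) Rleg a k (pp a / pp k)) * leg1 a (Kp (z 0 a)) *
  (\prod_(k <- s) Rleg k a (pp k / mm a)).

Lemma qKZ_word_dressed i : qKZ_word Rm Kp Km z i = dressp (below i) i * dressm (above i) i.
Proof. by rewrite /qKZ_word /dressp /dressm !mulrA. Qed.

Lemma dressm_cons k s a : dressm (k :: s) a =
  Rleg k a (pp k / mm a) * dressm s a * invmx (Rleg k a (pp k / pp a)).
Proof. by rewrite /dressm prod_rev_cons big_cons !mulrA. Qed.

Lemma dressp_rcons k s a : dressp (rcons s k) a =
  Rleg a k (pp a / pp k) * dressp s a * Rleg k a (pp k / mm a).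
Proof.
rewrite /dressp rev_rcons big_cons -!mulrA; do 3!congr (_ * _).
by rewrite -cats1 big_cat big_seq1.
Qed.

Lemma dressm_comm s a b c u : a != b -> a != c -> b \notin s -> c \notin s ->
  GRing.comm (dressm s a) (Rleg b c u).
Proof.
move=> ab ac bs cs; have sP k : k \in s -> k != b /\ k != c.
  by move=> ks; split; apply: contraTneq ks => ->.
apply/commr_sym; apply: commrM; [apply: commrM|].
- by apply: comm_prod => k /sP[kb kc]; apply/commr_sym/Rleg_comm.
- by apply/commr_sym/leg1_Rleg_comm.
- apply: comm_prod => k; rewrite mem_rev => /sP[kb kc].
  by apply: comm_invmx; apply/commr_sym/Rleg_comm.
Qed.

Lemma dressp_comm s a b c u : a != b -> a != c -> b \notin s -> c \notin s ->
  GRing.comm (dressp s a) (Rleg b c u).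
Proof.
move=> ab ac bs cs; have sP k : k \in s -> k != b /\ k != c.
  by move=> ks; split; apply: contraTneq ks => ->.
apply/commr_sym; apply: commrM; [apply: commrM|].
- by apply: comm_prod => k; rewrite mem_rev => /sP[kb kc]; apply/commr_sym/Rleg_comm.
- by apply/commr_sym/leg1_Rleg_comm.
- by apply: comm_prod => k /sP[kb kc]; apply/commr_sym/Rleg_comm.
Qed.

Lemma dressm_dressp_comm s t a b : a != b -> b \notin s -> a \notin t ->
  (forall k, k \in s -> k \notin t) -> GRing.comm (dressm s a) (dressp t b).
Proof.
move=> ab bs ata st; have tP k : k \in t -> k \notin s by move=> kt; apply: contraL kt => /st.
have aP k : k \in t -> a != k by move=> kt; apply: contraNneq ata => ->.
apply: commrM; [apply: commrM|].
- by apply: comm_prod => k; rewrite mem_rev => kt; apply: dressm_comm; [exact: ab|exact: aP|exact: bs|exact: tP].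
- apply/commr_sym; apply: commrM; [apply: commrM|].
  + apply: comm_prod => k ks; apply: leg1_Rleg_comm; last by rewrite eq_sym.
    by apply: contraNneq bs => ->.
  + by apply: comm_legs => _ _; rewrite eq_sym.
  + apply: comm_prod => k; rewrite mem_rev => ks; apply: comm_invmx.
    apply: leg1_Rleg_comm; last by rewrite eq_sym.
    by apply: contraNneq bs => ->.
- by apply: comm_prod => k kt; apply: dressm_comm; [exact: aP|exact: ab|exact: tP|exact: bs].
Qed.

(** Sklyanin's dressing, by induction: the head of s is the outermost factor k, added by four
    Yang-Baxter relations on the legs k, a, b, some with inverted factors. The empty dressing is the
    reflection equation of K^-. *)
Lemma dressm_reflection s a b : a != b -> a \notin s -> b \notin s -> uniq s ->
  Rleg b a (pp a / pp b) * dressm s a * Rleg a b (pp a / mm b) * dressm s b =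
  dressm s b * Rleg b a (pp a / mm b) * dressm s a * Rleg a b (pp a / pp b).
Proof.
move=> ab; elim: s => [|k s IH] /=.
  move=> _ _ _; rewrite /dressm !big_nil !mul1r !mulr1.
  have := HR ab; rewrite /right_reflection_at /=.
  move=> /(congr1 (legs (fun e : 'I_2 => if e == ord0 then a else b))).
  have si := leg2_inj ab.
  by rewrite !legsM// !legs_leg2// !legs_leg1//= /spectral /= invrK.
rewrite !inE !negb_or => /andP[ak as'] /andP[bk bs] /andP[ks us].
have ka : k != a by rewrite eq_sym.
have kb : k != b by rewrite eq_sym.
have ba : b != a by rewrite eq_sym.
have Ua : Rleg k a (pp k / pp a) \in unitmx by apply: (Rleg_unit (rho := rho)) => //; apply: HU; exact: neqj.
have Ub : Rleg k b (pp k / pp b) \in unitmx by apply: (Rleg_unit (rho := rho)) => //; apply: HU; exact: neqj.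
have Va : invmx (Rleg k a (pp k / pp a)) * Rleg k a (pp k / pp a) = 1 by exact: mulVmx.
have Va' : Rleg k a (pp k / pp a) * invmx (Rleg k a (pp k / pp a)) = 1 by exact: mulmxV.
have Vb : invmx (Rleg k b (pp k / pp b)) * Rleg k b (pp k / pp b) = 1 by exact: mulVmx.
have Vb' : Rleg k b (pp k / pp b) * invmx (Rleg k b (pp k / pp b)) = 1 by exact: mulmxV.
rewrite !dressm_cons; apply: dress_reflection; first exact: IH.
- apply: (swap_inv Va Va'); exact: (ybe true true false ka kb ab).
- by have := ybe true false false kb ka ba; rewrite mmE.
- apply: (swap_inv Vb Vb').
  by have := ybe true true false kb ka ba; rewrite (pmE a b).
- have := ybe true true true ka kb ab.
  set p0 := Rleg k a _ in Ua *; set q0 := Rleg k b _ in Ub *; set X := Rleg a b _ => H.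
  have V : p0 * invmx p0 = 1 by exact: mulmxV.
  have V' : invmx p0 * p0 = 1 by exact: mulVmx.
  have Vq : q0 * invmx q0 = 1 by exact: mulmxV.
  have Vq' : invmx q0 * q0 = 1 by exact: mulVmx.
  have -> : X * invmx p0 * invmx q0 = invmx q0 * invmx p0 * (p0 * q0 * X) * invmx p0 * invmx q0.
    by rewrite -!mulrA (mulrA (invmx p0) p0) V' mul1r (mulrA (invmx q0) q0) Vq' mul1r.
  by rewrite H -!mulrA (mulrA p0 (invmx p0)) V mul1r Vq mulr1.
- by apply: dressm_comm.
- by apply: comm_invmx; apply: dressm_comm.
- by apply: dressm_comm.
- by apply: comm_invmx; apply: dressm_comm.
Qed.

(** The counterpart for K^+; the outermost factor is now the last one of s, hence the induction from
    the right. *)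
Lemma dressp_reflection s a b : a != b -> a \notin s -> b \notin s -> uniq s ->
  Rleg a b (pp a / pp b) * dressp s a * Rleg b a (pp a / mm b) * dressp s b =
  dressp s b * Rleg a b (pp a / mm b) * dressp s a * Rleg b a (pp a / pp b).
Proof.
move=> ab; elim/last_ind: s => [|s k IH] /=.
  move=> _ _ _; rewrite /dressp !big_nil !mul1r !mulr1.
  have := HL ab; rewrite /left_reflection_at /=.
  move=> /(congr1 (legs (fun e : 'I_2 => if e == ord0 then a else b))).
  have si := leg2_inj ab.
  by rewrite !legsM// !legs_leg2// !legs_leg1//= /spectral /= invrK.
rewrite !mem_rcons !inE !negb_or rcons_uniq => /andP[ak as'] /andP[bk bs] /andP[ks us].
have ka : k != a by rewrite eq_sym.
have kb : k != b by rewrite eq_sym.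
have ba : b != a by rewrite eq_sym.
rewrite !dressp_rcons; apply: dress_reflection; first exact: IH.
- by have := ybe true true false bk ba ka; rewrite (pmE a b).
- by have := ybe true true true ab ak bk.
- by have := ybe true true false ak ab kb.
- by have := ybe true false false kb ka ba; rewrite mmE.
- by apply: dressp_comm.
- by apply: dressp_comm.
- by apply: dressp_comm.
- by apply: dressp_comm.
Qed.

Definition between (i j : 'I_N) := [seq k : 'I_N <- enum 'I_N | (i < k < j)%N].

Lemma above_split (i j : 'I_N) : (i < j)%N -> above i = between i j ++ j :: above j.
Proof.
move=> ij; rewrite /above {1}(enum_split j) filter_cat /= ij; congr (_ ++ _ :: _).
  by rewrite /below /between -filter_predI; apply: eq_filter => k /=.
apply/all_filterP/allP => k; rewrite mem_filter => /andP[jk _]; exact: ltn_trans jk.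
Qed.

Lemma below_split (i j : 'I_N) : (i < j)%N -> below j = below i ++ i :: between i j.
Proof.
move=> ij; rewrite /below {1}(enum_split i) filter_cat /= ij; congr (_ ++ _ :: _).
  apply/all_filterP/allP => k; rewrite mem_filter => /andP[ki _] /=; exact: ltn_trans ij.
by rewrite /above /between -filter_predI; apply: eq_filter => k /=; rewrite andbC.
Qed.

(* With M the factors strictly between i and j, conjugating by R_jM reduces to adjacent
   factors, where the reflection equations for the dressed K-matrices are applied. *)
Lemma qKZ_word_comm_lt (i j : 'I_N) : (i < j)%N ->
  GRing.comm (qKZ_word Rm Kp Km z i) (qKZ_word Rm Kp Km z j).
Proof.
move=> lij; rewrite !qKZ_word_dressed (above_split lij) (below_split lij).
have := enum_uniq 'I_N; rewrite (enum_split j) (below_split lij).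
set L := below i; set M := between i j; set S := above j.
rewrite -catA /= => uLiMjS.
have ij : i != j by rewrite neq_ltn lij.
have ji : j != i by rewrite eq_sym.
have iL : i \notin L by rewrite mem_filter ltnn.
have jL : j \notin L by rewrite mem_filter ltnNge ltnW.
have iM : i \notin M by rewrite mem_filter ltnn.
have jM : j \notin M by rewrite mem_filter ltnn andbF.
have iS : i \notin S by rewrite mem_filter ltnNge ltnW.
have jS : j \notin S by rewrite mem_filter ltnn.
have LM k : k \in L -> k \notin M.
  by rewrite !mem_filter => /andP[ki _]; rewrite ltnNge (ltnW ki).
have LS k : k \in L -> k \notin S.
  by rewrite !mem_filter => /andP[ki _]; rewrite ltnNge (ltnW (ltn_trans ki lij)).
have MS k : k \in M -> k \notin S.
  by rewrite !mem_filter => /andP[/andP[_ kj] _]; rewrite ltnNge (ltnW kj).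
have Mi k : k \in M -> k != i by apply: contraTneq => ->.
have Mj k : k \in M -> k != j by apply: contraTneq => ->.
have uL : uniq L by rewrite filter_uniq ?enum_uniq.
have uM : uniq M by rewrite filter_uniq ?enum_uniq.
have uMS : uniq (M ++ S).
  rewrite cat_uniq uM filter_uniq ?enum_uniq // andbT.
  by apply/hasPn => k kS; apply: contraL kS => /MS.
have iMS : i \notin M ++ S by rewrite mem_cat negb_or iM.
have jMS : j \notin M ++ S by rewrite mem_cat negb_or jM.
(* The conjugating element: it occurs as the leftmost intermediate part of the word of j. *)
pose T := \prod_(k <- rev M) Rleg j k (pp j / pp k).
pose T' := invmx T.
pose A := dressp L i; pose B := dressp L j.
pose U := dressm (M ++ S) i; pose W := dressm (M ++ S) j.
pose pj := Rleg j i (pp j / mm i); pose pj0 := Rleg j i (pp j / pp i); pose pj' := invmx pj0.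
pose r := Rleg i j (pp i / mm j).
have rE : r = Rleg i j (pp j / mm i) by rewrite /r (pmE j i).
have ru (a b : 'I_N) (s t : bool) : a != b -> Rleg a b (sp (a, s) / sp (b, t)) \in unitmx.
  by move=> ab; apply: (Rleg_unit (rho := rho)) => //; apply: HU; exact: neqj.
have Tu : T \in unitmx.
  by apply: prod_unitmx => k; rewrite mem_rev => kM; apply: ru; rewrite eq_sym Mj.
have TT' : T * T' = 1 by exact: mulmxV.
have T'T : T' * T = 1 by exact: mulVmx.
have p1 : pj0 * pj' = 1 by apply: mulmxV; exact: ru.
have p2 : pj' * pj0 = 1 by apply: mulVmx; exact: ru.
pose PM := \prod_(k <- M) Rleg k i (pp k / mm i).
pose PM0 := \prod_(k <- M) Rleg k i (pp k / pp i).
pose PM' := \prod_(k <- rev M) invmx (Rleg k i (pp k / pp i)).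
have q2 : PM' * PM0 = 1.
  have H k : k \in M -> invmx (Rleg k i (pp k / pp i)) * Rleg k i (pp k / pp i) = 1 *: 1%:M.
    by move=> kM; rewrite scale1r; apply: mulVmx; apply: ru; exact: Mi.
  by rewrite /PM' /PM0 (prod_cancel H) big1_eq scale1r.
have q1 : PM0 * PM' = 1 by exact: mulmx1C.
(* Needed both at z_i and at its inverse, for the two sides of the dressing of K^-. *)
have thr (t : bool) : (\prod_(k <- M) Rleg k i (pp k / sp (i, t))) * Rleg j i (pp j / sp (i, t)) * T =
    T * Rleg j i (pp j / sp (i, t)) * (\prod_(k <- M) Rleg k i (pp k / sp (i, t))).
  apply: prod_through => // [k kM|k l kM lM kl].
    have jk : j != k by rewrite eq_sym Mj.
    exact: esym (ybe true true t jk ji (Mi _ kM)).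
  have ki := Mi _ kM; have kj := Mj _ kM; have li := Mi _ lM; have lj := Mj _ lM.
  have jl : j != l by rewrite eq_sym.
  have il : i != l by rewrite eq_sym.
  by split; apply: Rleg_comm.
have A_T : GRing.comm A T.
  apply: comm_prod => k; rewrite mem_rev => kM; apply: dressp_comm => //.
    by rewrite eq_sym Mi.
  by apply: contraL kM => /LM.
have D_T : GRing.comm (dressm S i) T.
  apply: comm_prod => k; rewrite mem_rev => kM; apply: dressm_comm => //.
    by rewrite eq_sym Mi.
  exact: MS.
have dressm_cat s t a : dressm (s ++ t) a = (\prod_(k <- s) Rleg k a (pp k / mm a)) * dressm t a *
    (\prod_(k <- rev s) invmx (Rleg k a (pp k / pp a))).
  by rewrite /dressm rev_cat !big_cat /= !mulrA.
have Wi : A * dressm (M ++ j :: S) i = T * (A * pj * U * pj') * T'.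
  rewrite dressm_cat dressm_cons (conj_dress TT' T'T p1 p2 q1 q2 (thr false) (thr true) D_T).
  have -> : PM * dressm S i * PM' = U by rewrite /U dressm_cat.
  exact: conj_mull A_T.
(* By unitarity T is c times the product of inverses that closes the dressing of W; this is how the
   inverse of T appears in the word of j. *)
pose c := \prod_(k <- rev M) rho (pp k / pp j).
have TE : T = c *: \prod_(k <- rev M) invmx (Rleg k j (pp k / pp j)).
  rewrite -prodZ; apply: eq_big_seq => k; rewrite mem_rev => kM.
  have Uk := HU (neqj (Mj _ kM) true true).
  by rewrite (RlegV (Mj _ kM) Uk) scalerA divff ?scale1r// (UN_rho Uk).
(* The intermediate factors to the right of K^+ at j are absorbed in the dressing W of K^-. *)
have Wj : dressp (L ++ i :: M) j * dressm S j = c *: (T * (pj0 * B * r * W) * T').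
  have -> : dressp (L ++ i :: M) j = T * pj0 * B * r * (\prod_(k <- M) Rleg k j (pp k / mm j)).
    by rewrite /dressp rev_cat rev_cons -cats1 !big_cat !big_cons !big_nil /= mulr1 !mulrA.
  rewrite /W dressm_cat -scale_mull -scale_mulr -!scale_mulr -TE !mulrA.
  by rewrite -[RHS]mulrA TT' mulr1.
rewrite -/A Wi Wj /GRing.comm scale_mulr scale_mull; congr (_ *: _).
have conjM X Y : T * X * T' * (T * Y * T') = T * (X * Y) * T'.
  by rewrite -!mulrA (mulrA T' T) T'T mul1r.
rewrite !conjM; congr (_ * _ * _).
apply: (@commute_dressed _ _ _ _ _ _ _ _ _ (Rleg i j (pp j / pp i))) => //.
- apply: dressm_dressp_comm => //.
  by move=> k; rewrite mem_cat => /orP[kM|kS]; [apply: contraL kM => /LM|apply: contraL kS => /LS].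
- apply: dressm_dressp_comm => //.
  by move=> k; rewrite mem_cat => /orP[kM|kS]; [apply: contraL kM => /LM|apply: contraL kS => /LS].
- by rewrite rE; exact: dressp_reflection ji jL iL uL.
- by rewrite rE; exact: dressm_reflection ji jMS iMS uMS.
Qed.

Lemma qKZ_word_comm (i j : 'I_N) : qKZ_word Rm Kp Km z i *m qKZ_word Rm Kp Km z j =
  qKZ_word Rm Kp Km z j *m qKZ_word Rm Kp Km z i.
Proof.
case: (ltngtP i j) => [ij|ji|/val_inj ->] //; first exact: qKZ_word_comm_lt.
by rewrite mulmxE [RHS]qKZ_word_comm_lt.
Qed.

End Commute.

(** * Unitarity of R *)

Section ScalarLemma.
Context {C : numFieldType} {n : nat}.
Local Notation tens k := (tensEnd C n k).
Local Notation midx k := (multiindex n k).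

Definition mi2 (a b : 'I_n) : midx 2 := [ffun c => if c == ord0 then a else b].
Definition mi3 (a b c : 'I_n) : midx 3 :=
  [ffun e => if e == inord 0 then a else if e == inord 1 then b else c].

Lemma mi2_eta (f : midx 2) : f = mi2 (f ord0) (f ord_max).
Proof. by apply/ffunP => c; rewrite ffunE; have [->|->] := ord2P c. Qed.

Lemma mi3E a b c : [/\ mi3 a b c (inord 0) = a, mi3 a b c (inord 1) = b & mi3 a b c (inord 2) = c].
Proof. by have [o10 o20 o21] := ord3_neq; rewrite !ffunE eqxx o10 eqxx o20 o21. Qed.

Lemma tcoef_leg23 (V : tens 2) a b c a' b' c' :
  tcoef (leg2 (inord 1) (inord 2) V : tens 3) (mi3 a b c) (mi3 a' b' c') =
  (a == a')%:R * tcoef V (mi2 b c) (mi2 b' c').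
Proof.
have [o10 o20 o21] := ord3_neq; have [E0 E1 E2] := mi3E a b c; have [E0' E1' E2'] := mi3E a' b' c'.
rewrite tcoef_legs.
have R23 (x y w : 'I_n) : restr (fun e : 'I_2 => if e == ord0 then inord 1 else inord 2) (mi3 x y w) = mi2 y w.
  by have [_ F1 F2] := mi3E x y w; apply/ffunP => e; rewrite [LHS]ffunE [RHS]ffunE; case: ifP.
rewrite !R23; have [aa|naa] := eqVneq a a'.
  rewrite mul1r; case: agreeP => // H; exfalso; apply: H => e; rewrite codom_leg2.
  by have [->|->|->] := ord3P e; rewrite ?eqxx ?orbT // E0 E0'.
rewrite mul0r; case: agreeP => // H; have := H (inord 0); rewrite E0 E0' => E.
by case/eqP: naa; apply: E; rewrite codom_leg2 ![inord 0 == _]eq_sym o10 o20.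
Qed.

Lemma tcoef_leg12 (V : tens 2) a b c a' b' c' :
  tcoef (leg2 (inord 0) (inord 1) V : tens 3) (mi3 a b c) (mi3 a' b' c') =
  (c == c')%:R * tcoef V (mi2 a b) (mi2 a' b').
Proof.
have [o10 o20 o21] := ord3_neq; have [E0 E1 E2] := mi3E a b c; have [E0' E1' E2'] := mi3E a' b' c'.
rewrite tcoef_legs.
have R23 (x y w : 'I_n) : restr (fun e : 'I_2 => if e == ord0 then inord 0 else inord 1) (mi3 x y w) = mi2 x y.
  by have [F1 F2 _] := mi3E x y w; apply/ffunP => e; rewrite [LHS]ffunE [RHS]ffunE; case: ifP.
rewrite !R23; have [aa|naa] := eqVneq c c'.
  rewrite mul1r; case: agreeP => // H; exfalso; apply: H => e; rewrite codom_leg2.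
  by have [->|->|->] := ord3P e; rewrite ?eqxx ?orbT // E2 E2'.
rewrite mul0r; case: agreeP => // H; have := H (inord 2); rewrite E2 E2' => E.
by case/eqP: naa; apply: E; rewrite codom_leg2 o20 o21.
Qed.

(* [V_23 = V'_12] forces both to act in the middle factor only, so that V acts in
   its first factor; exchanging V and V', it also acts in its second factor only. *)
Lemma leg23_leg12_scalar (V V' : tens 2) (e : midx 2) :
  leg2 (inord 1) (inord 2) V = leg2 (inord 0) (inord 1) V' :> tens 3 ->
  leg2 (inord 1) (inord 2) V' = leg2 (inord 0) (inord 1) V :> tens 3 ->
  V = tcoef V e e *: 1%:M.
Proof.
move=> H1 H2.
have h1 a b c a' b' c' : (a == a')%:R * tcoef V (mi2 b c) (mi2 b' c') =
    (c == c')%:R * tcoef V' (mi2 a b) (mi2 a' b').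
  by rewrite -tcoef_leg23 -tcoef_leg12 H1.
have h2 a b c a' b' c' : (a == a')%:R * tcoef V' (mi2 b c) (mi2 b' c') =
    (c == c')%:R * tcoef V (mi2 a b) (mi2 a' b').
  by rewrite -tcoef_leg23 -tcoef_leg12 H2.
apply: tcoefP => f g; rewrite tcoefZ tcoef1 (mi2_eta f) (mi2_eta g) (mi2_eta e).
move: (f ord0) (f ord_max) (g ord0) (g ord_max) (e ord0) (e ord_max) => a b a' b' a0 b0.
(* The diagonal entry of V at (x, y) is that of V' at (b0, x), which is that of V at (a0, b0): the
   diagonal is constant. *)
have d1 x y : tcoef V (mi2 x y) (mi2 x y) = tcoef V' (mi2 b0 x) (mi2 b0 x).
  by have := h1 b0 x y b0 x y; rewrite !eqxx !mul1r.
have d2 x y w : tcoef V' (mi2 y w) (mi2 y w) = tcoef V (mi2 x y) (mi2 x y).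
  by have := h2 x y w x y w; rewrite !eqxx !mul1r.
have [bb|nbb] := eqVneq b b'; last first.
  have := h1 a a b a a' b'; rewrite eqxx mul1r (negbTE nbb) mul0r => ->.
  rewrite (_ : mi2 a b == _ = false) ?mulr0//; apply/negP => /eqP/ffunP/(_ ord_max).
  by rewrite !ffunE /= => /eqP; exact/negP.
have [aa|naa] := eqVneq a a'; last first.
  have := h2 a b b a' b' b; rewrite eqxx mul1r (negbTE naa) mul0r => <-.
  rewrite (_ : mi2 a b == _ = false) ?mulr0//; apply/negP => /eqP/ffunP/(_ ord0).
  by rewrite !ffunE /= => /eqP; exact/negP.
by rewrite -aa -bb eqxx mulr1 d1 (d2 a0).
Qed.

End ScalarLemma.

Definition mx_cont {R : realType} {V : normedModType R[i]} p q
    (X : V -> 'M[R[i]]_(p, q)) (w : V) :=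
  forall i j, {for w, continuous (fun x => X x i j : R[i]^o)}.

Section Entrywise.
Context {R : realType} {V : normedModType R[i]} {n : nat}.
Local Notation C := R[i].

Lemma mx_contM p q r (X : V -> 'M[C]_(p, q)) (Y : V -> 'M[C]_(q, r)) w :
  mx_cont X w -> mx_cont Y w -> mx_cont (fun x => X x *m Y x) w.
Proof.
move=> Xc Yc i j.
have -> : (fun x => (X x *m Y x) i j : C^o) = (fun x => \sum_k (X x i k * Y x k j) : C^o).
  by apply/funext => x; rewrite mxE.
elim: (index_enum _) => [|k s IH].
  rewrite (_ : (fun x => _) = fun=> 0); first exact: cst_continuous.
  by apply/funext => x; rewrite big_nil.
have -> : (fun x => \sum_(l <- k :: s) (X x i l * Y x l j) : C^o) =
    (fun x => X x i k * Y x k j + \sum_(l <- s) (X x i l * Y x l j) : C^o).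
  by apply/funext => x; rewrite big_cons.
apply: continuousD; last exact: IH.
by apply: continuousM; [exact: Xc|exact: Yc].
Qed.

Lemma mx_cont_legs k m (s : 'I_k -> 'I_m) (X : V -> tensEnd C n k) w :
  mx_cont X w -> mx_cont (fun x => legs s (X x)) w.
Proof.
move=> Xc i j; set f := enum_val i; set g := enum_val j.
have E x : legs s (X x) i j = if agree s f g then X x (enum_rank (restr s f)) (enum_rank (restr s g)) else 0.
  by have := tcoef_legs s (X x) f g; rewrite /tcoef !enum_valK.
have -> : (fun x => legs s (X x) i j : C^o) =
   fun x => if agree s f g then X x (enum_rank (restr s f)) (enum_rank (restr s g)) else 0.
  by apply/funext.
by case: (agree s f g); [exact: Xc|exact: cst_continuous].
Qed.

Lemma mx_cont_leg2 m (a b : 'I_m) (X : V -> tensEnd C n 2) w :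
  mx_cont X w -> mx_cont (fun x => leg2 a b (X x)) w.
Proof. exact: mx_cont_legs. Qed.

Lemma mx_cont_comp p q (X : C^o -> 'M[C]_(p, q)) (f : V -> C^o) w v :
  f w = v -> {for w, continuous f} -> mx_cont X v -> mx_cont (fun x => X (f x)) w.
Proof.
move=> <- fc Xc i j.
exact: (@continuous_comp V C^o C^o f (fun u => X u i j) w fc (Xc i j)).
Qed.

Lemma mx_cont_eq p q (X Y : V -> 'M[C]_(p, q)) D w : domain D -> D w ->
  mx_cont X w -> mx_cont Y w -> generically D (fun x => X x = Y x) -> X w = Y w.
Proof.
move=> dD Dw Xc Yc XY; apply/matrixP => i j; apply/eqP; rewrite -subr_eq0.
apply: contrapT => /negP nz.
have nn : \forall x \near w, X x i j - Y x i j != 0.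
  apply: (@near_neq0 _ _ (fun x => X x i j - Y x i j)) => //.
  by apply: continuousB; [exact: Xc|exact: Yc].
have [y [_ yn yE]] := generic_dense dD XY Dw nn.
by move: yn; rewrite /= yE subrr eqxx.
Qed.

End Entrywise.

Section UnitaryProd.
Context {C : numFieldType} {n : nat}.
Local Notation tens k := (tensEnd C n k).
Variable Rm : C -> tens 2.

Definition unitary_prod (u : C) : tens 2 :=
  leg2 ord0 ord_max (Rm u) *m leg2 ord_max ord0 (Rm u^-1).

(* The scalar of R_12(u) R_21(1/u), read off an arbitrary diagonal entry;
   1 when V = 0, where there is none. *)
Definition rho (u : C) : C :=
  if [pick f : multiindex n 2] is Some f then tcoef (unitary_prod u) f f else 1.

(** R_13(1) is kappa P_13 in the middle of both sides of the Yang-Baxter equation; pushed to the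
    right end it turns R_23(u) into R_21(u) on one side and R_12(1/u) into R_32(1/u) on the other,
    and cancels. *)
Lemma unitary_prod_leg (u : C) : regular Rm -> yang_baxter_at Rm 1 u ->
  leg2 (inord 1) (inord 2) (unitary_prod u) =
  leg2 (inord 0) (inord 1) (unitary_prod u^-1) :> tens 3.
Proof.
move=> [_ [kappa k0 R1]].
have [o10 o20 o21] := ord3_neq.
have n01 : inord 0 != inord 1 :> 'I_3 by rewrite eq_sym o10.
have n02 : inord 0 != inord 2 :> 'I_3 by rewrite eq_sym o20.
have n12 : inord 1 != inord 2 :> 'I_3 by rewrite eq_sym o21.
have legW (a b : 'I_3) v : a != b -> leg2 a b (unitary_prod v) =
    leg2 a b (Rm v) *m leg2 b a (Rm v^-1) :> tens 3.
  move=> ab; have si := leg2_inj ab.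
  by rewrite /unitary_prod {1}/leg2 (legsM _ _ si) !(legs_leg2 _ _ _ si).
rewrite !legW// invrK /yang_baxter_at R1 mul1r.
have -> (a b : 'I_3) : leg2 a b (kappa *: flip) = kappa *: leg2 a b flip :> tens 3 by exact: legsZ.
rewrite -!scalemxAr -!scalemxAl => /(can_inj (scalerK k0)).
have E1 := flip_leg2 (inord 1) (inord 2) (Rm u) n02.
have E2 := flip_leg2 (inord 0) (inord 1) (Rm u^-1) n02.
rewrite tpermR (tpermD n01 _) in E1; last by rewrite eq_sym.
rewrite tpermL (tpermD n01 _) in E2; last by rewrite eq_sym.
rewrite -!mulmxA E1 E2 !mulmxA => H.
have /mulmx1_unit[Pu _] := @flip_flip C n 3 _ _ n02.
by rewrite -[LHS](mulmxK Pu) -H (mulmxK Pu).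
Qed.

End UnitaryProd.

Section Unitarity.
Context {R : realType} {n : nat}.
Local Notation C := R[i].
Local Notation tens k := (tensEnd C n k).
Variable Rm : C -> tens 2.
Local Notation Cx := [set x : C^o | x != 0].

(** A proper analytic subset of C has no interior, so it cannot contain C^x, which is a
    neighbourhood of 1. *)
Lemma generic_punctured (P : C^o -> Prop) : generically setT P -> generically Cx P.
Proof.
apply: (@generic_pullback _ C^o C^o Cx setT (fun x => x)) => //.
- exact: domain_open punctured_domain.
- by move=> x _; exact: holomorphic_id.
- move=> A anA nA; apply: contrapT => nex.
  have [oT cT _] := @full_domain R.
  apply: (analytic_interior cT oT anA nA (x := 1)) => //.
  have n1 : \forall y \near (1 : C^o), Cx y.
    by apply: open_nbhs_nbhs; split; [exact: domain_open punctured_domain|exact: oner_neq0].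
  by apply: filterS n1 => y y0; apply: contrapT => nAy; apply: nex; exists y.
Qed.

Lemma holomorphic_inv (x : C^o) : x != 0 -> holomorphic_at (fun x : C^o => x^-1 : C) x.
Proof. by move=> x0; apply: holomorphicV => //; exact: holomorphic_id. Qed.

Lemma generic_inv (P : C^o -> Prop) : generically Cx P -> generically Cx (fun x => P x^-1).
Proof.
apply: (@generic_pullback _ C^o C^o Cx Cx (fun x => x^-1)).
- exact: domain_open punctured_domain.
- by move=> x; rewrite /= invr_eq0.
- by move=> x /holomorphic_inv.
- move=> A [AC _] /(exists_notin AC)[x x0 nAx]; exists x^-1; first by rewrite /= invr_eq0.
  by rewrite invrK.
Qed.

Lemma meromorphic_inv (f : C^o -> C) : meromorphic_on setT f ->
  meromorphic_on Cx (fun x : C^o => f x^-1).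
Proof.
apply: (@meromorphic_comp _ C^o (fun x : C^o => x^-1 : C^o)) => //.
  by move=> x /holomorphic_inv.
move=> x x0 ; rewrite /= in x0 *.
move=> H.
have H' : \forall z \near x^', z^-1 = x^-1 by exact: nbhs_dnbhs.
have nx : \forall z \near x^', z != x by rewrite near_withinE; near=> z.
have [z [/invr_inj -> /eqP]] := dnbhs_point (filterI H' nx).
exact.
Unshelve. all: by end_near. Qed.

Lemma generic_mx_cont : Mer Rm -> generically Cx (fun u : C^o => mx_cont (Rm : C^o -> _) u).
Proof.
move=> M.
apply: (generic_all punctured_domain) => i; apply: (generic_all punctured_domain) => j.
apply: generic_punctured; apply: meromorphic_generic_cont; first exact: full_domain.
exact: M.
Qed.

(* The Yang-Baxter equation holds on a dense subset of the torus only, but both of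
   its sides are continuous at (1, y). *)
Lemma yang_baxter_at1 (y : C^o) : yang_baxter Rm -> regular Rm -> y != 0 ->
  mx_cont (Rm : C^o -> _) y -> mx_cont (Rm : C^o -> _) y^-1 -> yang_baxter_at Rm 1 y.
Proof.
move=> hYB [hol1 _] y0 cy cy'.
have c1 : mx_cont (Rm : C^o -> _) 1.
  by move=> i j; exact: (@holomorphic_cont _ C^o (fun x => Rm x i j)).
pose V2 : normedModType C := 'rV[C]_2.
pose w : V2 := \row_k (if k == ord0 then 1 else y).
have w0 : (w : 'rV[C]_2) 0 ord0 = 1 by rewrite mxE.
have w1 : (w : 'rV[C]_2) 0 ord_max = y by rewrite mxE.
have Dw : torus C 2 w by move=> k; rewrite mxE; case: ifP => // _; exact: oner_neq0.
have cc (k : 'I_2) : {for w, continuous (fun x : V2 => (x : 'rV[C]_2) 0 k : C^o)}.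
  exact: holomorphic_cont (holomorphic_coord k w).
have cd : {for w, continuous (fun x : V2 => (x : 'rV[C]_2) 0 ord0 / (x : 'rV[C]_2) 0 ord_max : C^o)}.
  apply: continuousM; first exact: cc.
  by apply: continuousV; [rewrite /= w1|exact: cc].
have wd : (w : 'rV[C]_2) 0 ord0 / (w : 'rV[C]_2) 0 ord_max = y^-1 by rewrite w0 w1 mul1r.
have C1 := mx_cont_comp w0 (cc ord0) c1.
have C2 := mx_cont_comp w1 (cc ord_max) cy.
have C3 := mx_cont_comp wd cd cy'.
pose o1 : 'I_3 := inord 0; pose o2 : 'I_3 := inord 1; pose o3 : 'I_3 := inord 2.
have Xc := mx_contM (mx_contM (mx_cont_leg2 (a := o1) (b := o2) C3) (mx_cont_leg2 (a := o1) (b := o3) C1)) (mx_cont_leg2 (a := o2) (b := o3) C2).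
have Yc := mx_contM (mx_contM (mx_cont_leg2 (a := o2) (b := o3) C2) (mx_cont_leg2 (a := o1) (b := o3) C1)) (mx_cont_leg2 (a := o1) (b := o2) C3).
have := mx_cont_eq (torus_domain 2) Dw Xc Yc hYB.
by rewrite w0 w1.
Qed.

Lemma unitary_prod_scalar (y : C^o) (e : multiindex n 2) : yang_baxter Rm -> regular Rm -> y != 0 ->
  mx_cont (Rm : C^o -> _) y -> mx_cont (Rm : C^o -> _) y^-1 ->
  unitary_prod Rm y = tcoef (unitary_prod Rm y) e e *: 1%:M.
Proof.
move=> hYB hreg y0 cy cy'.
have y0' : y^-1 != 0 by rewrite invr_eq0.
have cy'' : mx_cont (Rm : C^o -> _) (y^-1)^-1 by rewrite invrK.
apply: (@leg23_leg12_scalar _ _ _ (unitary_prod Rm y^-1)).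
  exact: (unitary_prod_leg hreg (yang_baxter_at1 hYB hreg y0 cy cy')).
have := unitary_prod_leg hreg (yang_baxter_at1 hYB hreg y0' cy' cy'').
by rewrite invrK.
Qed.

(** Where R(u) and R(1/u) are invertible so is their unitarity product; being scalar, it has a
    nonzero rho. *)
Lemma generic_unitary_at : Mer_unit Rm -> Mer_unit (fun x => ptranspose ord0 (Rm x)) ->
  yang_baxter Rm -> regular Rm -> generically Cx (fun u : C^o => unitary_at Rm (rho Rm) u).
Proof.
move=> [M U] [_ Ut] hYB hreg.
have gU := generic_punctured U; have gUt := generic_punctured Ut.
have gc := generic_mx_cont M.
have dC := @punctured_domain R.
have g := genericI dC (genericI dC gU gUt) (genericI dC (generic_inv gU) (genericI dC gc (generic_inv gc))).
apply: genericS g => u u0 [[Uu Utu] [Uu' [cu cu']]].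
have W1 : unitary_prod Rm u \in unitmx.
  rewrite /unitary_prod unitmx_mul; apply/andP.
  have inj (a b : 'I_2) : a != b -> injective (fun c : 'I_2 => if c == ord0 then a else b) by move=> ab; exact: leg2_inj.
  by split; [exact: legs_unit (inj _ _ _) Uu|exact: legs_unit (inj _ _ _) Uu'].
have WE : unitary_prod Rm u = rho Rm u *: 1%:M.
  rewrite /rho; case: pickP => [e _|no]; first exact: unitary_prod_scalar.
  (* There is no multiindex at all, so the matrices have no entries. *)
  by apply: tcoefP => f; have := no f.
split=> //; rewrite /rho; case: pickP => [e _|_]; last exact: oner_neq0.
apply/eqP => r0; have := unitary_prod_scalar e hYB hreg u0 cu cu'; rewrite r0 scale0r => W0.
have := congr1 (fun X => tcoef X e e) (mulmxV W1).
by rewrite W0 mul0mx tcoef1 eqxx /tcoef mxE => /esym/eqP; rewrite oner_eq0.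
Qed.

End Unitarity.

(** * Generic parameters *)

Lemma propto_genericI {R : realType} {V : normedModType R[i]} (D : set V) p q
    (X Y : V -> 'M[R[i]]_(p, q)) (m : V -> R[i]) : domain D -> meromorphic_on D m ->
  generically D (fun x => m x != 0) -> generically D (fun x => X x = m x *: Y x) ->
  propto_generically D X Y.
Proof.
move=> dD mm mn XY; exists m; split=> // m0; apply: (generic_false dD).
by apply: genericS (genericI dD mn m0) => x _ [/eqP].
Qed.

Section Main.
Context {R : realType} {n N : nat}.
Local Notation C := R[i].
Local Notation tens k := (tensEnd C n k).
Local Notation Cx := [set x : C^o | x != 0].
Local Notation D := (torus C N).
Variables (Rm : C -> tens 2) (Kp Km : C -> tens 1).
Hypotheses (hR : Mer_unit Rm) (hRt : Mer_unit (fun x => ptranspose ord0 (Rm x))).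
Hypotheses (hYB : yang_baxter Rm) (hreg : regular Rm).

(** rho is a constant or one entry of a matrix product, a sum of products of entries of R(u) and
    R(1/u). *)
Lemma meromorphic_rho : meromorphic_on Cx (rho Rm : C^o -> C).
Proof.
have [M _] := hR; rewrite /rho; case: pickP => [e _|_]; last exact: meromorphic_cst.
have Rr i j : meromorphic_on Cx (fun x : C^o => Rm x i j) by move=> x _; exact: M.
have Ri i j : meromorphic_on Cx (fun x : C^o => Rm x^-1 i j).
  have MX : meromorphic_on setT (fun x : C^o => Rm x i j) by move=> x xT; exact: M.
  exact: (meromorphic_inv MX).
have L (X : C -> tens 2) (a b : 'I_2) i j : (forall i j, meromorphic_on Cx (fun x : C^o => X x i j)) ->
    meromorphic_on Cx (fun x : C^o => (leg2 a b (X x) : tens 2) i j).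
  move=> mX; pose s (c : 'I_2) := if c == ord0 then a else b.
  pose f := enum_val i; pose g := enum_val j.
  have -> : (fun x : C^o => (leg2 a b (X x) : tens 2) i j) = fun x => if agree s f g
      then X x (enum_rank (restr s f)) (enum_rank (restr s g)) else 0.
    by apply/funext => x; have := tcoef_legs s (X x) f g; rewrite /tcoef !enum_valK.
  by case: (agree s f g); [exact: mX|exact: meromorphic_cst].
rewrite /tcoef /unitary_prod.
rewrite (_ : (fun u => _) = (fun u : C^o => \sum_k
  (leg2 ord0 ord_max (Rm u) : tens 2) (enum_rank e) k * (leg2 ord_max ord0 (Rm u^-1) : tens 2) k (enum_rank e))).
  apply: meromorphic_sum => k _; apply: meromorphicM; first exact: (L Rm).
  exact: (L (fun u => Rm u^-1)).
by apply/funext => x; rewrite mxE.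
Qed.

Lemma generic_rho_neq0 : generically Cx (fun u : C^o => rho Rm u != 0).
Proof. by apply: genericS (generic_unitary_at hR hRt hYB hreg) => u _ U; exact: UN_rho U. Qed.

Lemma meromorphic_rhoV : meromorphic_on Cx (fun u : C^o => (rho Rm u)^-1).
Proof. exact: meromorphicV punctured_domain meromorphic_rho generic_rho_neq0. Qed.

Definition unitary_all (z : 'rV[C]_N) := forall j k, j != k -> unitary_at Rm (rho Rm) (spectral z j / spectral z k).
Definition braided_all (z : 'rV[C]_N) := forall j k l, j != k -> j.1 != l.1 -> k.1 != l.1 ->
  yang_baxter_at Rm (spectral z j / spectral z l) (spectral z k / spectral z l).

Lemma generic_unitary : generically D unitary_all.
Proof.
have dD := @torus_domain R N.
apply: (generic_all dD) => j; apply: (generic_all dD) => k.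
have [->|jk] := eqVneq j k; first by apply: genericW => // z _.
apply: genericS (generic_spectral_div jk (generic_unitary_at hR hRt hYB hreg)) => z _ U _.
exact: U.
Qed.

Lemma generic_braided : generically D braided_all.
Proof.
have dD := @torus_domain R N.
apply: (generic_all dD) => j; apply: (generic_all dD) => k; apply: (generic_all dD) => l.
case: (boolP [&& j != k, j.1 != l.1 & k.1 != l.1]) => [/and3P[jk jl kl]|h]; last first.
  by apply: genericW => // z _ a b c; case/negP: h; rewrite a b c.
apply: genericS (generic2_spectral jk jl kl hYB) => z _ U _ _ _.
exact: U.
Qed.

Lemma meromorphic_rho_div (j k : 'I_N * bool) : j != k ->
  meromorphic_on D (fun z => rho Rm (spectral z j / spectral z k)).
Proof. by move=> jk; exact: (meromorphic_spectral_div jk meromorphic_rho). Qed.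

Lemma meromorphic_rhoV_div (j k : 'I_N * bool) : j != k ->
  meromorphic_on D (fun z => (rho Rm (spectral z j / spectral z k))^-1).
Proof. by move=> jk; exact: (meromorphic_spectral_div jk meromorphic_rhoV). Qed.

Lemma pair_neq (i j : 'I_N) (s t : bool) : i != j -> (j, s) != (i, t).
Proof. by apply: contraNneq => -[->]. Qed.

Lemma meromorphic_transfer_scalar kappa i : meromorphic_on D (fun z => transfer_scalar (rho Rm) kappa z i).
Proof.
apply: meromorphicM; last first.
  by apply: meromorphic_prod_in => j /above_neq ij; exact: (meromorphic_rho_div (pair_neq true true ij)).
apply: meromorphicM; first exact: meromorphic_cst.
apply: meromorphic_prod => j _; apply: (@meromorphic_rhoV_div (i, false) (j, true)).
by apply/eqP => -[].
Qed.

Lemma transfer_scalar_neq0 kappa z i : kappa != 0 -> unitary_all z -> transfer_scalar (rho Rm) kappa z i != 0.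
Proof.
move=> k0 U; have r0 j k : j != k -> rho Rm (spectral z j / spectral z k) != 0 by move=> /U/UN_rho.
rewrite /transfer_scalar !mulf_neq0//; rewrite prodf_seq_neq0; apply/allP => j ja /=.
  by rewrite invr_eq0; apply: r0; apply/eqP => -[].
by apply: r0; apply: pair_neq; exact: above_neq.
Qed.

Lemma transfer_propto i :
  propto_generically D (fun z => transfer Rm Kp Km (z 0 i) z) (qKZ_transport Rm Kp Km i).
Proof.
have dD := @torus_domain R N; have [_ [kappa k0 R1]] := hreg.
apply: (propto_genericI dD (meromorphic_transfer_scalar kappa i)).
  by apply: genericS generic_unitary => z _; exact: transfer_scalar_neq0.
apply: genericS (genericI dD generic_unitary generic_braided) => z Dz [U B].
rewrite qKZ_transportE; exact: transfer_at.
Qed.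

Lemma meromorphic_transfer_inv_scalar kappa (mup mum : 'rV[C]_N -> C) i :
  meromorphic_on D mup -> meromorphic_on D mum ->
  meromorphic_on D (fun z => transfer_inv_scalar (rho Rm) kappa z (mup z) (mum z) i).
Proof.
move=> mp mm; rewrite /transfer_inv_scalar; apply: meromorphicM; last first.
  apply: meromorphic_prod_in => j /above_neq ij; apply: (@meromorphic_rhoV_div (i, true) (j, true)).
  by apply: pair_neq; rewrite eq_sym.
apply: meromorphicM; last first.
  by apply: meromorphic_prod_in => j /above_neq ij; exact: (meromorphic_rho_div (pair_neq true false ij)).
apply: meromorphicM; last first.
  by apply: meromorphic_prod_in => j /below_neq ij; exact: (meromorphic_rho_div (pair_neq true false ij)).
apply: meromorphicM => //; apply: meromorphicM => //; exact: meromorphic_cst.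
Qed.

Lemma transfer_inv_scalar_neq0 kappa z mup mum i : kappa != 0 -> mup != 0 -> mum != 0 -> unitary_all z ->
  transfer_inv_scalar (rho Rm) kappa z mup mum i != 0.
Proof.
move=> k0 p0 m0 U; have r0 j k : j != k -> rho Rm (spectral z j / spectral z k) != 0 by move=> /U/UN_rho.
rewrite /transfer_inv_scalar !mulf_neq0 ?invr_eq0//; rewrite prodf_seq_neq0; apply/allP => j ja /=.
- by apply: r0; apply/eqP => -[].
- by apply: r0; apply/eqP => -[].
- by rewrite invr_eq0; apply: r0; apply: pair_neq; rewrite eq_sym; exact: above_neq.
Qed.

(** The boundary scalar is only given as not identically zero; generic nonvanishing is obtained in
    one variable, where it follows from connectedness, and then pulled back to the torus. *)
Lemma boundary_at (K : C -> tens 1) i : boundary_unitarity K -> exists m : 'rV[C]_N -> C,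
  [/\ meromorphic_on D m, generically D (fun z => m z != 0) &
      generically D (fun z => K (z 0 i) *m K (z 0 i)^-1 = m z *: 1%:M)].
Proof.
move=> [m [mm m0 E]]; exists (fun z => m (z 0 i)); split.
- exact: (@meromorphic_spectral _ _ m (i, true) mm).
- have g := meromorphic_generic_neq0 (@punctured_domain R) mm m0.
  exact: (@generic_spectral _ _ (fun u : C => m u != 0) (i, true) g).
- exact: (@generic_spectral _ _ (fun u : C => K u *m K u^-1 = m u *: 1%:M) (i, true) E).
Qed.

(** Both conclusions follow from one identity: A_i times the transfer matrix at 1/z_i is m Id with m
    generically nonzero, so A_i is invertible and its inverse is identified. *)
Lemma transfer_inv_propto i : boundary_unitarity Kp -> boundary_unitarity Km ->
  generically D (fun z => qKZ_transport Rm Kp Km i z \in unitmx) /\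
  propto_generically D (fun z => transfer Rm Kp Km (z 0 i)^-1 z)
    (fun z => invmx (qKZ_transport Rm Kp Km i z)).
Proof.
move=> bp bm; have dD := @torus_domain R N; have [_ [kappa k0 R1]] := hreg.
have [mup [mp p0 pE]] := boundary_at i bp.
have [mum [mm m0 mE]] := boundary_at i bm.
pose m z := transfer_inv_scalar (rho Rm) kappa z (mup z) (mum z) i.
have gU := generic_unitary; have gB := generic_braided.
have mn : generically D (fun z => m z != 0).
  by apply: genericS (genericI dD gU (genericI dD p0 m0)) => z _ [U [a b]]; exact: transfer_inv_scalar_neq0.
have E : generically D (fun z => qKZ_transport Rm Kp Km i z *m transfer Rm Kp Km (z 0 i)^-1 z
    = m z *: 1%:M).
  apply: genericS (genericI dD (genericI dD gU gB) (genericI dD pE mE)) => z Dz [[U B] [a b]].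
  rewrite qKZ_transportE; exact: qKZ_word_transfer_inv.
have gE := genericI dD mn E.
have unit z : m z != 0 -> qKZ_transport Rm Kp Km i z *m transfer Rm Kp Km (z 0 i)^-1 z
    = m z *: 1%:M -> qKZ_transport Rm Kp Km i z \in unitmx.
  move=> mz0 H; have : qKZ_transport Rm Kp Km i z *m ((m z)^-1 *: transfer Rm Kp Km (z 0 i)^-1 z) = 1%:M.
    by rewrite -scalemxAr H scalerA mulVf// scale1r.
  by move=> /mulmx1_unit[].
split; first by apply: genericS gE => z _ [mz0 H]; exact: unit.
apply: (propto_genericI dD _ mn); first exact: meromorphic_transfer_inv_scalar.
apply: genericS gE => z _ [mz0 H].
by apply: (can_inj (mulKmx (unit z mz0 H))); rewrite H -scalemxAr mulmxV// unit.
Qed.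

(** On a common generic set every transfer matrix involved is a multiple of some A_i or of its
    inverse, and commutation passes to inverses and multiples. *)
Lemma transfer_comm : boundary_unitarity Kp -> boundary_unitarity Km ->
  left_reflection Rm Kp -> right_reflection Rm Km ->
  let pm (s : bool) (x : C) := if s then x else x^-1 in
  generically D (fun z => forall (i j : 'I_N) (s t : bool),
    transfer Rm Kp Km (pm s (z 0 i)) z *m transfer Rm Kp Km (pm t (z 0 j)) z =
    transfer Rm Kp Km (pm t (z 0 j)) z *m transfer Rm Kp Km (pm s (z 0 i)) z).
Proof.
move=> bp bm lr rr pm; have dD := @torus_domain R N.
pose A (i : 'I_N) z := qKZ_transport Rm Kp Km i z.
pose T x (z : 'rV[C]_N) := transfer Rm Kp Km x z.
have gU := generic_unitary; have gB := generic_braided.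
have gT : generically D (fun z => forall i, exists c, T (z 0 i) z = c *: A i z).
  apply: (generic_all dD) => i; have [m [_ _ E]] := transfer_propto i.
  by apply: genericS E => z _ E; exists (m z).
have gA : generically D (fun z => forall i, A i z \in unitmx).
  by apply: (generic_all dD) => i; have [] := transfer_inv_propto i bp bm.
have gTV : generically D (fun z => forall i, exists c, T (z 0 i)^-1 z = c *: invmx (A i z)).
  apply: (generic_all dD) => i; have [_ [m [_ _ E]]] := transfer_inv_propto i bp bm.
  by apply: genericS E => z _ E; exists (m z).
have gL : generically D (fun z => forall i j : 'I_N, i != j -> left_reflection_at Rm Kp (z 0 i) (z 0 j)).
  apply: (generic_all dD) => i; apply: (generic_all dD) => j.
  have [->|ij] := eqVneq i j; first by apply: genericW.
  by apply: genericS (generic2_coord ij lr) => z _ E _; exact: E.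
have gR : generically D (fun z => forall i j : 'I_N, i != j -> right_reflection_at Rm Km (z 0 i) (z 0 j)).
  apply: (generic_all dD) => i; apply: (generic_all dD) => j.
  have [->|ij] := eqVneq i j; first by apply: genericW.
  by apply: genericS (generic2_coord ij rr) => z _ E _; exact: E.
have g := genericI dD (genericI dD (genericI dD gT gTV) gA)
  (genericI dD (genericI dD gU gB) (genericI dD gL gR)).
apply: genericS g => z Dz [[[hT hTV] hA] [[U B] [HL HR]]] i j s t.
have AA k l : A k z *m A l z = A l z *m A k z.
  by rewrite /A !qKZ_transportE; exact: (qKZ_word_comm Dz U B HL HR).
have AV k l : invmx (A k z) *m A l z = A l z *m invmx (A k z) by exact/esym/comm_invmx/esym/AA.
pose B' k (b : bool) := if b then A k z else invmx (A k z).
have TB k (b : bool) : exists c, T (pm b (z 0 k)) z = c *: B' k b.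
  by case: b; [exact: hT|exact: hTV].
have BB : B' i s *m B' j t = B' j t *m B' i s.
  rewrite /B'; case: s; case: t; [exact: AA|exact/esym/AV|exact: AV|].
  exact/comm_invmx/AV.
have [c cE] := TB i s; have [d dE] := TB j t.
rewrite -!/(T _ z) cE dE.
by rewrite -!scalemxAl -!scalemxAr BB !scalerA mulrC.
Qed.

End Main.

Unset Implicit Arguments.

Theorem theorem3p13 (R : realType) (n N : nat) (hN : (0 < N)%N)
    (Rm : R[i] -> tensEnd R[i] n 2) (Kp Km : R[i] -> tensEnd R[i] n 1)
    (hR : Mer_unit Rm)
    (hRt : Mer_unit (fun x => ptranspose ord0 (Rm x)))
    (hKp : Mer Kp) (hKm : Mer Km)
    (hYB : yang_baxter Rm) (hreg : regular Rm) :
  let T := @transfer R[i] n Rm Kp Km N in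
  let A := @qKZ_transport R[i] n Rm Kp Km N in
  let D := torus R[i] N in
  let pm (s : bool) (x : R[i]) := if s then x else x^-1 in
  [/\ forall i : 'I_N,
        propto_generically D (fun z => T (z 0 i) z) (A i),
      boundary_unitarity Kp -> boundary_unitarity Km ->
      forall i : 'I_N,
        generically D (fun z => A i z \in unitmx) /\
        propto_generically D (fun z => T (z 0 i)^-1 z)
                             (fun z => invmx (A i z))
    & boundary_unitarity Kp -> boundary_unitarity Km ->
      left_reflection Rm Kp -> right_reflection Rm Km ->
      generically D (fun z => forall (i j : 'I_N) (s t : bool),
        T (pm s (z 0 i)) z *m T (pm t (z 0 j)) z =
        T (pm t (z 0 j)) z *m T (pm s (z 0 i)) z)].
Proof.
move=> T A D pm; split.
- by move=> i; exact: transfer_propto.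
- by move=> bp bm i; exact: transfer_inv_propto.
- by move=> bp bm lr rr; exact: transfer_comm.
Qed.
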